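(* Let $u\colon\mathbb N\to\mathbb C$ be an arithmetic function taking finitely many values. Then $u\perp\mathscr C_{\rm ZE}$ if and only if for each increasing sequence $(N_k)$ defining a Furstenberg system of $u$ and each $\varepsilon>0$ there exists $M\ge1$ (depending only on $(N_k)$ and $\varepsilon$) such that for each $\ell\ge1$, each set $C$ of blocks of length $\ell$ appearing in $u$, and each $m\ge M$, $$\lim_{k\to\infty}\left|\frac1{N_k}\sum_{n\le N_k}u(n)\,\mathbf 1_{(u(m+n),u(m+n+1),\ldots,u(m+n+\ell-1))\in C}\right|\le\varepsilon .$$
   Context: A topological dynamical system $(X,T)$ is a homeomorphism $T$ of a compact metric space $X$. $\mathscr C_{\rm ZE}$ is the class of topological systems of zero topological entropy. $u\perp\mathscr C_{\rm ZE}$ means that $\lim_{N\to\infty}\frac1N\sum_{n\le N}f(T^nx)u(n)=0$ for all $(X,T)\in\mathscr C_{\rm ZE}$, $f\in C(X)$ and $x\in X$. Let $|u|\le L$. Extend $u$ to $\mathbb Z$ by $u(-n)=u(n)$ for $n\in\mathbb N$ and any $u(0)$ with $|u(0)|\le L$. Let $S$ be the left shift on $\{z\in\mathbb C:|z|\le L\}^{\mathbb Z}$. An increasing sequence $(N_k)$ of positive integers defines a Furstenberg system of $u$ if the probability measures $\frac1{N_k}\sum_{n\le N_k}\delta_{S^nu}$ converge in the weak-$*$ topology. A block of length $\ell$ is an $\ell$-tuple of values of $u$. *)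

(* Defs.v *)
From HB Require Import structures.
From mathcomp Require Import all_boot all_order all_algebra finmap.
From mathcomp Require Import all_classical all_reals all_analysis.
From mathcomp.real_closed Require Import complex.

Set Implicit Arguments.
Unset Strict Implicit.
Unset Printing Implicit Defensive.

Import Order.TTheory GRing.Theory Num.Theory.
Import numFieldNormedType.Exports.

Local Open Scope classical_set_scope.
Local Open Scope ring_scope.

(* The library puts the norm topology on
   K^o for every numFieldType K; it is transported here to R[i]. *)
#[export, non_forgetful_inheritance]
HB.instance Definition _ (R : rcfType) := PseudoPointedMetric.copy R[i] R[i]^o.
#[export, non_forgetful_inheritance]
HB.instance Definition _ (R : rcfType) := GRing.ComAlgebra.copy R[i] R[i]^o.
#[export, non_forgetful_inheritance]
HB.instance Definition _ (R : rcfType) := Vector.copy R[i] R[i]^o.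
#[export, non_forgetful_inheritance]
HB.instance Definition _ (R : rcfType) := NormedModule.copy R[i] R[i]^o.

(* The modulus with values in R (`|z| lives in R[i]). *)
Notation cmod := (@ComplexField.Normc.normc _).

(* Arithmetic functions are u : nat -> R[i] whose value at 0 is never used. *)
Definition mean (R : realType) (a : nat -> R[i]) (N : nat) : R[i] :=
  N%:R^-1 * \sum_(1 <= n < N.+1) a n.

Definition homeomorphism (X : topologicalType) (T : X -> X) : Prop :=
  continuous T /\
  exists T' : X -> X, [/\ cancel T T', cancel T' T & continuous T'].

Section entropy.
Context {R : realType} {X : metricType R}.
Implicit Types (T : X -> X) (F : {fset X}) (n : nat) (e : R).

Definition spanning T n e F : Prop :=
  forall x, exists2 y, y \in F &
    forall i, (i < n)%N -> mdist (iter i T x) (iter i T y) < e.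

(* Minimal cardinality of an (n,e)-spanning set. *)
Definition span_card T n e : \bar R :=
  ereal_inf [set ((#|` F|)%:R)%:E | F in spanning T n e].

(* Topological entropy in the Bowen-Dinaburg form: the limit as e decreases to
   0 of the exponential growth rate of span_card is a supremum over e > 0. *)
Definition topological_entropy T : \bar R :=
  ereal_sup [set limn_esup (fun n => (n%:R^-1)%:E * lne (span_card T n e))%E
            | e in [set e : R | 0 < e]].

End entropy.

Definition orthogonal_ZE (R : realType) (u : nat -> R[i]) : Prop :=
  forall (X : metricType R) (T : X -> X),
    compact [set: X] -> homeomorphism T -> topological_entropy T = 0%E ->
  forall (f : X -> R[i]) (x : X), continuous f ->
    mean (fun n => f (iter n T x) * u n) N @[N --> \oo] --> (0 : R[i]).

Section shift.
Context {R : realType} (L : {nonneg R}).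

Definition disc : set R[i] := [set z | cmod z <= L%:num].

Definition disc_type : Type := set_type disc.

HB.instance Definition _ := SubType.on disc_type.
HB.instance Definition _ := Topological.on disc_type.

Lemma disc0 : (0 : R[i]) \in disc.
Proof.
by rewrite inE /disc /= expr0n /= addr0 sqrtr0.
Qed.

HB.instance Definition _ := isPointed.Build disc_type (exist _ 0 disc0).

(* {|z| <= L}^Z with the product topology. *)
Definition shift_space : Type := {ptws int -> disc_type}.

HB.instance Definition _ := Topological.on shift_space.
HB.instance Definition _ := isPointed.Build shift_space (fun=> point).

Definition left_shift (z : shift_space) : shift_space := fun i => z (i + 1).

Definition borel_shift_space := g_sigma_algebraType (@open shift_space).

(* z is a two-sided extension of u by u(-n) = u(n), with arbitrary z(0) in the
   disc; its existence forces |u(n)| <= L for n >= 1. *)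
Definition extends (u : nat -> R[i]) (z : shift_space) : Prop :=
  forall n, (0 < n)%N ->
    \val (z n%:Z) = u n /\ \val (z (- n%:Z)) = u n.

(* (1/N) \sum_(1 <= n <= N) delta_(S^n z); msum is indexed from 0. *)
Definition empirical (z : shift_space) (N : nat) :
    {measure set borel_shift_space -> \bar R} :=
  mscale (N%:R^-1)%:nng
    (msum (fun n => \d_(iter n.+1 left_shift z : borel_shift_space)) N).

Definition weakly_converges (mu : nat -> {measure set borel_shift_space -> \bar R})
    (kappa : probability borel_shift_space R) : Prop :=
  forall f : shift_space -> R, continuous f ->
    (\int[mu k]_x (f x)%:E @[k --> \oo] --> \int[kappa]_x (f x)%:E)%E.

Definition defines_furstenberg (z : shift_space) (N_ : nat -> nat) : Prop :=
  [/\ {homo N_ : i j / (i < j)%N}, forall k, (0 < N_ k)%N &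
      exists kappa, weakly_converges (fun k => empirical z (N_ k)) kappa].

End shift.

Definition block (R : realType) (u : nat -> R[i]) (l j : nat) : l.-tuple R[i] :=
  [tuple u (j + i)%N | i < l].

Definition blocks (R : realType) (u : nat -> R[i]) (l : nat) :
    set (l.-tuple R[i]) :=
  [set block u l j | j in [set j | (0 < j)%N]].

Arguments blocks {R} u l _.

(* Main.v *)
From HB Require Import structures.
Require Import Defs.
From mathcomp Require Import all_boot all_order all_algebra.
From mathcomp Require Import all_classical all_reals all_analysis measurable_realfun.
From mathcomp.real_closed Require Import complex.
From mathcomp Require Import ring lra zify.

Import Order.TTheory GRing.Theory Num.Theory.
Import numFieldNormedType.Exports.

Set Implicit Arguments.
Unset Strict Implicit.
Unset Printing Implicit Defensive.

Local Open Scope classical_set_scope.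
Local Open Scope ring_scope.

(** Along an ultrafilter of lengths N, the frequencies of all sets of integers
    converge together, and u becomes a stationary finite-valued process for a
    finitely additive, shift-invariant probability on the subsets of nat.  The
    second condition then says that u(0) is nearly uncorrelated with every
    event of the future of u after time M: it is a finitary form of the
    vanishing of the conditional expectation of u(0) given the tail field, that
    is, by Rokhlin and Sinai, given the factors of zero entropy.  Both
    implications are proved by finite entropy estimates on this process.

    Decorrelation implies orthogonality.  In a system of zero entropy,
    exp (delta n) names describe all orbit segments of length n
    (zero_entropy_names).  The information that the name carries on the letters
    u(t+s), ..., u(t+n-1) decreases with s, from at most delta n down to 0; so
    for most s the name and u(t+s) are nearly independent given the letters
    from t+s+M on.  The observable at time t+s is a function of the name, so
    its correlation with u is governed by the correlation of u(t+s) with events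
    of that future (low_entropy_decorrelates, decorrelated_averages).  If the
    averages did not tend to 0, this would be contradicted along a sequence of
    lengths that defines a Furstenberg system.  Such a sequence exists inside
    any infinite set of lengths (furstenberg_subsequence): the limit word
    frequencies are realized by a random point, a function on the unit interval
    with Lebesgue measure.

    Orthogonality implies decorrelation.  If every future contains an event
    correlated with u, then near-optimal choices form a Cauchy sequence of
    events, an approximate tail event (tail_events).  It has small block
    entropy, because its names are determined both by the letters of one block
    and, up to a small error, by the letters after that block, while adjacent
    blocks share sublinear information (name_entropy).  Hence few words carry
    most of its mass (typical_words); erasing the other ones at all scales
    costs little correlation (exists_phase, masked_block), and gluing the
    results along the lengths N gives one sequence y with subexponentially many
    words that is correlated with u infinitely often (correlated_sequence).
    The subshift of y has zero entropy (subshift_entropy0), so u is not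
    orthogonal to all systems of zero entropy. *)

(** * Finitely additive densities *)

Section finite_prob.
Variable R : realType.

(** Termwise, ln x <= x - 1 at x = sqrt (q / p). The comparison of total
    masses turns 2 p - 2 sqrt (p q) into the square. *)
Lemma kl_ge_hellinger (T : finType) (p q : T -> R) :
  (forall x, 0 <= p x) -> (forall x, 0 <= q x) ->
  (forall x, p x != 0 -> q x != 0) ->
  \sum_x q x <= \sum_x p x ->
  \sum_x (Num.sqrt (p x) - Num.sqrt (q x)) ^+ 2 <=
  \sum_x p x * (ln (p x) - ln (q x)).
Proof.
move=> p0 q0 pq qp.
have pt x : 2 * p x - 2 * (Num.sqrt (p x) * Num.sqrt (q x)) <=
            p x * (ln (p x) - ln (q x)).
  have [->|px] := eqVneq (p x) 0; first by rewrite sqrtr0 !mul0r mulr0 subr0.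
  have {}px : 0 < p x by rewrite lt_def px p0.
  have qx : 0 < q x by rewrite lt_def q0 pq // gt_eqF.
  set a := Num.sqrt (p x); set b := Num.sqrt (q x).
  have a0 : 0 < a by rewrite sqrtr_gt0.
  have b0 : 0 < b by rewrite sqrtr_gt0.
  have pE : p x = a ^+ 2 by rewrite sqr_sqrtr.
  have qE : q x = b ^+ 2 by rewrite sqr_sqrtr.
  rewrite pE qE !lnXn //.
  have h : ln b - ln a <= b / a - 1.
    rewrite -ln_div ?posrE //.
    have := @le_ln1Dx R (b / a - 1).
    rewrite (_ : 1 + (b / a - 1) = b / a); last by ring.
    apply.
    by rewrite ltrBrDl subrr divr_gt0.
  have : a ^+ 2 * (ln b - ln a) <= a ^+ 2 * (b / a - 1).
    by rewrite ler_wpM2l // sqr_ge0.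
  have -> : a ^+ 2 * (b / a - 1) = a * b - a ^+ 2 by field; rewrite gt_eqF.
  rewrite !mulr2n; nra.
apply: (@le_trans _ _ (\sum_x (2 * p x - 2 * (Num.sqrt (p x) * Num.sqrt (q x))))).
  rewrite -subr_ge0 -sumrB.
  have -> : \sum_x (2 * p x - 2 * (Num.sqrt (p x) * Num.sqrt (q x)) -
        (Num.sqrt (p x) - Num.sqrt (q x)) ^+ 2) = \sum_x (p x - q x).
    apply: eq_bigr => x _.
    have := sqr_sqrtr (p0 x); have := sqr_sqrtr (q0 x).
    set a := Num.sqrt (p x); set b := Num.sqrt (q x) => <- <-; ring.
  by rewrite sumrB subr_ge0.
by apply: ler_sum => x _; exact: pt.
Qed.

(** A process is a sequence of letters together with a density on subsets of
    nat. Any function of the sequence is then a random variable; as all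
    variables used are finite-valued, finite additivity suffices for entropy
    theory. *)
Record density := Density {
  Pr :> (nat -> bool) -> R ;
  Pr_ge0 : forall e, 0 <= Pr e ;
  Pr_T : Pr (fun=> true) = 1 ;
  Pr_add : forall e f, (forall t, ~~ (e t && f t)) ->
    Pr (fun t => e t || f t) = Pr e + Pr f ;
  Pr_shift1 : forall e, Pr (fun t => e t.+1) = Pr e }.

Variable P : density.

Lemma Pr_ext e f : e =1 f -> P e = P f.
Proof. by move=> ef; congr (Pr P _); apply/funext. Qed.

Lemma Pr_0 : P (fun=> false) = 0.
Proof.
have := @Pr_add P (fun=> false) (fun=> false) (fun=> isT).
by rewrite (@Pr_ext _ (fun=> false)) // => h; lra.
Qed.

Lemma Pr_shift k e : P (fun t => e (t + k)%N) = P e.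
Proof.
elim: k => [|k <-]; first by apply: Pr_ext => t; rewrite addn0.
rewrite -[RHS]Pr_shift1; apply: Pr_ext => t; congr e; lia.
Qed.

Lemma Pr_partition (T : finType) (X : nat -> T) e :
  P e = \sum_x P (fun t => e t && (X t == x)).
Proof.
have gen (r : seq T) : uniq r ->
    P (fun t => e t && (X t \in r)) = \sum_(x <- r) P (fun t => e t && (X t == x)).
  elim: r => [|x r IH] /=.
    by move=> _; rewrite big_nil (@Pr_ext _ (fun=> false)) ?Pr_0 // => t; rewrite andbF.
  move=> /andP[xr ur]; rewrite big_cons -IH // -Pr_add.
    by apply: Pr_ext => t; rewrite in_cons; case: (e t).
  move=> t; case: (e t) => //=; apply/negP => /andP[/eqP ->].
  by apply/negP.
have := gen (index_enum T) (index_enum_uniq T).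
move=> <-; apply: Pr_ext => t.
by rewrite mem_index_enum andbT.
Qed.

Lemma Pr_le (e f : nat -> bool) : (forall t, e t -> f t) -> P e <= P f.
Proof.
move=> ef; rewrite (@Pr_ext f (fun t => e t || (f t && ~~ e t))); last first.
  by move=> t; case: (boolP (e t)) => [/ef ->|] //; case: (f t).
rewrite Pr_add ?lerDl ?Pr_ge0 // => t; case: (e t) => //=.
by rewrite andbF.
Qed.

Lemma Pr_le1 e : P e <= 1.
Proof. by rewrite -(Pr_T P); apply: Pr_le. Qed.

Definition Ex (T : finType) (X : nat -> T) (g : T -> R) : R :=
  \sum_x g x * P (fun t => X t == x).

Lemma Ex_comp (A B : finType) (X : nat -> A) (f : A -> B) g :
  Ex (fun t => f (X t)) g = Ex X (g \o f).
Proof.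
rewrite /Ex.
transitivity (\sum_y \sum_x g y * P (fun t => (f (X t) == y) && (X t == x))).
  by apply: eq_bigr => y _; rewrite -mulr_sumr -Pr_partition.
rewrite exchange_big /=; apply: eq_bigr => x _.
rewrite (bigD1 (f x)) //= big1 ?addr0.
  congr (_ * _); apply: Pr_ext => t.
  by case: (X t =P x) => [->|]; rewrite ?eqxx ?andbF.
move=> y yx; rewrite (@Pr_ext _ (fun=> false)) ?Pr_0 ?mulr0 // => t.
by apply/negP => /andP[+ /eqP Xx]; rewrite Xx eq_sym (negPf yx).
Qed.

Lemma Ex_le (T : finType) (X : nat -> T) g h :
  (forall t, g (X t) <= h (X t)) -> Ex X g <= Ex X h.
Proof.
move=> gh; apply: ler_sum => x _.
have [[t tx]|nx] := pselect (exists t, X t = x).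
  by rewrite ler_wpM2r ?Pr_ge0 // -tx.
rewrite (@Pr_ext _ (fun=> false)) ?Pr_0 ?mulr0 // => t.
by apply/negP => /eqP tx; apply: nx; exists t.
Qed.

Lemma Ex_cst (T : finType) (X : nat -> T) c : Ex X (fun=> c) = c.
Proof.
rewrite /Ex -mulr_sumr (_ : \sum__ _ = 1) ?mulr1 //.
by rewrite -(Pr_T P) (Pr_partition X).
Qed.

Lemma Ex_Pr (T : finType) (X : nat -> T) (c : pred T) :
  Ex X (fun x => (c x)%:R) = P (fun t => c (X t)).
Proof.
rewrite (Pr_partition X); apply: eq_bigr => x _.
case: (boolP (c x)) => cx; rewrite ?mul1r ?mul0r.
  by apply: Pr_ext => t; case: eqP => [->|]; rewrite ?cx ?andbF.
rewrite (@Pr_ext _ (fun=> false)) ?Pr_0 // => t.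
by apply/negP => /andP[+ /eqP tx]; rewrite tx (negPf cx).
Qed.

Lemma Ex_shift (T : finType) (X : nat -> T) g k :
  Ex (fun t => X (t + k)%N) g = Ex X g.
Proof.
apply: eq_bigr => x _; congr (_ * _).
exact: (Pr_shift k (fun t => X t == x)).
Qed.

Lemma Ex_sum (T I : finType) (X : nat -> T) (g : I -> T -> R) :
  Ex X (fun x => \sum_i g i x) = \sum_i Ex X (g i).
Proof.
by rewrite exchange_big; apply: eq_bigr => x _; rewrite mulr_suml.
Qed.

(** Both sides are expectations of the numbers of events that occur at time
    t. *)
Lemma Pr_double_count (I J : finType) (e : I -> nat -> bool) (f : J -> nat -> bool) :
  (forall t, #|[pred i | e i t]| <= #|[pred j | f j t]|)%N ->
  \sum_i P (e i) <= \sum_j P (f j).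
Proof.
move=> ef.
pose X t : {ffun I -> bool} * {ffun J -> bool} :=
  ([ffun i => e i t], [ffun j => f j t]).
have eE i : P (e i) = Ex X (fun x => (x.1 i)%:R).
  by rewrite (Ex_Pr X (fun x => x.1 i)); apply: Pr_ext => t; rewrite ffunE.
have fE j : P (f j) = Ex X (fun x => (x.2 j)%:R).
  by rewrite (Ex_Pr X (fun x => x.2 j)); apply: Pr_ext => t; rewrite ffunE.
rewrite (eq_bigr _ (fun i _ => eE i)) (eq_bigr _ (fun i _ => fE i)) -!Ex_sum.
apply: Ex_le => t; rewrite -!natr_sum ler_nat.
have ->: (\sum_i (X t).1 i)%N = #|[pred i | e i t]|.
  by rewrite -sum1_card [RHS]big_mkcond; apply: eq_bigr => i _; rewrite ffunE inE; case: (e i t).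
have ->: (\sum_i (X t).2 i)%N = #|[pred i | f i t]|.
  by rewrite -sum1_card [RHS]big_mkcond; apply: eq_bigr => i _; rewrite ffunE inE; case: (f i t).
exact: ef.
Qed.

Lemma Pr_union (I : finType) (e : I -> nat -> bool) :
  P (fun t => [exists i, e i t]) <= \sum_i P (e i).
Proof.
have -> : P (fun t => [exists i, e i t]) = \sum_(i < 1) P (fun t => [exists i, e i t]).
  by rewrite big_ord1.
apply: Pr_double_count => t; case: existsP => [[i ei]|_] /=.
  by rewrite (leq_trans (max_card _)) // card_ord; apply/card_gt0P; exists i.
by rewrite (@eq_card0 _ [pred _ : 'I_1 | false]).
Qed.

(** * Entropy *)

Definition entropy (T : finType) (X : nat -> T) : R :=
  - \sum_x P (fun t => X t == x) * ln (P (fun t => X t == x)).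

Lemma entropy_comp (A B : finType) (X : nat -> A) (f : A -> B) :
  entropy (fun t => f (X t)) =
  - \sum_x P (fun t => X t == x) * ln (P (fun t => f (X t) == f x)).
Proof.
have := Ex_comp X f (fun y => ln (P (fun t => f (X t) == y))).
rewrite /Ex /entropy /= => h; congr (- _).
by rewrite (eq_bigr _ (fun x _ => mulrC _ _)) h; apply: eq_bigr => x _; rewrite mulrC.
Qed.

Lemma entropy_inj (A B : finType) (X : nat -> A) (f : A -> B) :
  injective f -> entropy (fun t => f (X t)) = entropy X.
Proof.
move=> fi; rewrite entropy_comp; congr (- _); apply: eq_bigr => x _.
by congr (_ * ln _); apply: Pr_ext => t; rewrite inj_eq.
Qed.

Lemma entropy_fun_le (A B : finType) (X : nat -> A) (f : A -> B) :
  entropy (fun t => f (X t)) <= entropy X.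
Proof.
rewrite entropy_comp lerN2; apply: ler_sum => x _.
have [->|px] := eqVneq (P (fun t => X t == x)) 0; first by rewrite !mul0r.
have {}px : 0 < P (fun t => X t == x) by rewrite lt_def px Pr_ge0.
have le : P (fun t => X t == x) <= P (fun t => f (X t) == f x).
  by apply: Pr_le => t /eqP ->.
rewrite ler_pM2l // ler_ln ?posrE //.
exact: lt_le_trans le.
Qed.

Lemma entropy_ge0 (A : finType) (X : nat -> A) : 0 <= entropy X.
Proof.
rewrite oppr_ge0; apply: sumr_le0 => x _.
by rewrite mulr_ge0_le0 ?Pr_ge0 // ln_le0 // Pr_le1.
Qed.

Lemma entropy_shift (A : finType) (X : nat -> A) k : entropy (fun t => X (t + k)%N) = entropy X.
Proof.
congr (- _); apply: eq_bigr => x _.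
by have := Pr_shift k (fun t => X t == x) => /= ->.
Qed.

Lemma sum_P (A : finType) (X : nat -> A) : \sum_x P (fun t => X t == x) = 1.
Proof. by rewrite -(Pr_T P) (Pr_partition X). Qed.

Lemma entropy_le_card (A : finType) (X : nat -> A) : entropy X <= ln (#|A|%:R).
Proof.
have A0 : (0 < #|A|)%N by apply/card_gt0P; exists (X 0%N).
have A0' : 0 < #|A|%:R :> R by rewrite ltr0n.
have s1 : \sum_(x : A) (#|A|%:R)^-1 = 1 :> R.
  by rewrite sumr_const -[LHS]mulr_natr mulVf // gt_eqF.
have i0 : 0 < (#|A|%:R)^-1 :> R by rewrite invr_gt0.
have : 0 <= \sum_x P (fun t => X t == x) *
    (ln (P (fun t => X t == x)) - ln (#|A|%:R)^-1).
  apply: le_trans (kl_ge_hellinger _ _ _ _) => [|x|x|x _|].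
  - by apply: sumr_ge0 => x _; exact: sqr_ge0.
  - exact: Pr_ge0.
  - exact: ltW.
  - by rewrite gt_eqF.
  - by rewrite s1 sum_P.
rewrite (eq_bigr _ (fun x _ => mulrBr _ _ _)) sumrB -mulr_suml sum_P mul1r.
rewrite lnV ?posrE // /entropy; lra.
Qed.

(** The law of a pair with the same first marginal as (X, Y) and the same
    joint law of g X and Y, but independent coordinates given g X. *)
Definition cond_indep_law (A B C : finType) (X : nat -> A) (Y : nat -> B) (g : A -> C)
    (w : A * B) : R :=
  P (fun t => X t == w.1) * P (fun t => (g (X t), Y t) == (g w.1, w.2)) /
  P (fun t => g (X t) == g w.1).

(** Mutual information of X and Y given g X. The usual formula has the
    entropy of (X, g X), which is that of X. *)
Definition cond_mutual_info (A B C : finType) (X : nat -> A) (Y : nat -> B) (g : A -> C) : R :=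
  entropy X + entropy (fun t => (g (X t), Y t)) - entropy (fun t => (X t, Y t)) - entropy (fun t => g (X t)).

Lemma cind_ge0 (A B C : finType) (X : nat -> A) (Y : nat -> B) (g : A -> C) w :
  0 <= cond_indep_law X Y g w.
Proof. by rewrite /cond_indep_law divr_ge0 ?Pr_ge0 // mulr_ge0 ?Pr_ge0. Qed.

Lemma sum_cind_le1 (A B C : finType) (X : nat -> A) (Y : nat -> B) (g : A -> C) :
  \sum_w cond_indep_law X Y g w <= 1.
Proof.
rewrite (eq_bigr (fun w => cond_indep_law X Y g (w.1, w.2))); last by case.
rewrite -(pair_bigA _ (fun x y => cond_indep_law X Y g (x, y))) /= -(sum_P X).
apply: ler_sum => x _; rewrite /cond_indep_law /= -mulr_suml -mulr_sumr.
have -> : \sum_y P (fun t => (g (X t), Y t) == (g x, y)) = P (fun t => g (X t) == g x).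
  by rewrite [RHS](Pr_partition Y).
have [->|gx] := eqVneq (P (fun t => g (X t) == g x)) 0.
  by rewrite invr0 mulr0 Pr_ge0.
by rewrite mulfK.
Qed.

(** The conditional mutual information is the relative entropy of the law of
    (X, Y) with respect to cond_indep_law. *)
Lemma cond_mi_ge_hellinger (A B C : finType) (X : nat -> A) (Y : nat -> B) (g : A -> C) :
  \sum_w (Num.sqrt (P (fun t => (X t, Y t) == w)) - Num.sqrt (cond_indep_law X Y g w)) ^+ 2
   <= cond_mutual_info X Y g.
Proof.
pose W t := (X t, Y t).
have le1 w : P (fun t => W t == w) <= P (fun t => X t == w.1).
  by apply: Pr_le => t; rewrite /W => /eqP <-.
have le2 w : P (fun t => W t == w) <= P (fun t => (g (X t), Y t) == (g w.1, w.2)).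
  by apply: Pr_le => t; rewrite /W => /eqP <-.
have le3 w : P (fun t => W t == w) <= P (fun t => g (X t) == g w.1).
  by apply: Pr_le => t; rewrite /W => /eqP <-.
have pos w : P (fun t => W t == w) != 0 ->
  [/\ 0 < P (fun t => X t == w.1), 0 < P (fun t => (g (X t), Y t) == (g w.1, w.2)),
   0 < P (fun t => g (X t) == g w.1) & 0 < P (fun t => W t == w)].
  move=> w0; have {}w0 : 0 < P (fun t => W t == w) by rewrite lt_def w0 Pr_ge0.
  by split => //; apply: (lt_le_trans w0).
have -> : cond_mutual_info X Y g = \sum_w P (fun t => W t == w) *
      (ln (P (fun t => W t == w)) - ln (cond_indep_law X Y g w)).
  rewrite /cond_mutual_info (entropy_comp W fst) (entropy_comp W (fun w => (g w.1, w.2))) (entropy_comp W (fun w => g w.1)).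
  rewrite /entropy -!sumrN -!big_split /=; apply: eq_bigr => w _.
  rewrite -/(W _).
  have [->|/pos [p1 p2 p3 p4]] := eqVneq (P (fun t => W t == w)) 0.
    by rewrite !mul0r !oppr0 !addr0.
  rewrite /cond_indep_law ln_div ?posrE ?mulr_gt0 // lnM ?posrE //.
  by set a := P _; set b := ln _; set c := ln _; set d := ln _; set e := ln _; ring.
apply: kl_ge_hellinger; [by move=> w; exact: Pr_ge0|exact: cind_ge0| |].
  by move=> w /pos[p1 p2 p3 p4]; rewrite /cond_indep_law gt_eqF // divr_gt0 ?mulr_gt0.
by rewrite (sum_P W) sum_cind_le1.
Qed.

Lemma cond_mi_ge0 (A B C : finType) (X : nat -> A) (Y : nat -> B) (g : A -> C) :
  0 <= cond_mutual_info X Y g.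
Proof.
apply: le_trans (cond_mi_ge_hellinger X Y g).
by apply: sumr_ge0 => w _; rewrite sqr_ge0.
Qed.

(** A Pinsker inequality made linear in the information, so that it can be
    summed over times: |p - q| is the product of |sqrt p - sqrt q| and sqrt
    p + sqrt q, and the product is split by the arithmetic-geometric
    inequality with weight tau. *)
Lemma cond_mi_ge_tv (A B C : finType) (X : nat -> A) (Y : nat -> B) (g : A -> C) (tau : R) :
  0 < tau ->
  \sum_w `|P (fun t => (X t, Y t) == w) - cond_indep_law X Y g w|
   <= cond_mutual_info X Y g / tau + tau.
Proof.
move=> tau0; set p := fun w => P (fun t => (X t, Y t) == w); set q := cond_indep_law X Y g.
have pt w : `|p w - q w| <= (Num.sqrt (p w) - Num.sqrt (q w)) ^+ 2 / tau
                        + tau / 2 * (p w + q w).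
  have := sqr_sqrtr (Pr_ge0 P _ : 0 <= p w); have := sqr_sqrtr (cind_ge0 X Y g w).
  rewrite -/q; have := sqrtr_ge0 (p w); have := sqrtr_ge0 (q w).
  set a := Num.sqrt (p w); set b := Num.sqrt (q w) => b0 a0 <- <-.
  rewrite subr_sqr normrM (ger0_norm (addr_ge0 a0 b0)).
  have -> : (a - b) ^+ 2 = `|a - b| ^+ 2 by rewrite real_normK // num_real.
  set d := `|a - b|; have d0 : 0 <= d by exact: normr_ge0.
  have h1 : 0 <= (d / tau - (a + b) / 2) ^+ 2 * tau by rewrite mulr_ge0 ?sqr_ge0 // ltW.
  have e1 : (d / tau - (a + b) / 2) ^+ 2 * tau
      = d ^+ 2 / tau - d * (a + b) + tau / 4 * (a + b) ^+ 2.
    by field; rewrite gt_eqF.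
  have h2 : 0 <= tau / 4 * (a - b) ^+ 2 by rewrite mulr_ge0 ?sqr_ge0 // divr_ge0 // ltW.
  have e2 : tau / 2 * (a ^+ 2 + b ^+ 2) =
     tau / 4 * (a + b) ^+ 2 + tau / 4 * (a - b) ^+ 2 by field.
  rewrite e2; lra.
apply: le_trans (ler_sum _ (fun w _ => pt w)) _.
rewrite big_split /= -mulr_suml -mulr_sumr big_split /=.
apply: lerD; first by rewrite ler_pM2r ?invr_gt0 //; exact: cond_mi_ge_hellinger.
have := sum_cind_le1 X Y g; rewrite -/q => hq.
have -> : \sum_w p w = 1 by exact: (sum_P (fun t => (X t, Y t))).
rewrite -[leRHS](divfK (_ : 2 != 0)) // ler_wpM2l //; last by lra.
by rewrite divr_ge0 // ltW.
Qed.

Lemma entropy_pair_le (A B : finType) (X : nat -> A) (Y : nat -> B) :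
  entropy (fun t => (X t, Y t)) <= entropy X + entropy Y.
Proof.
have := cond_mi_ge0 X Y (fun=> tt); rewrite /cond_mutual_info.
have -> : entropy (fun t => (tt, Y t)) = entropy Y.
  by apply: (@entropy_inj _ _ Y (fun y => (tt, y))) => x y [].
have := @entropy_ge0 _ (fun=> tt); lra.
Qed.

Definition mutual_info (A B : finType) (X : nat -> A) (Y : nat -> B) : R :=
  entropy X + entropy Y - entropy (fun t => (X t, Y t)).

Lemma mi_fun_l (A B C : finType) (X : nat -> A) (Y : nat -> B) (g : A -> C) :
  mutual_info (fun t => g (X t)) Y <= mutual_info X Y.
Proof. have := cond_mi_ge0 X Y g; rewrite /cond_mutual_info /mutual_info; lra. Qed.

Lemma mi_sym (A B : finType) (X : nat -> A) (Y : nat -> B) : mutual_info X Y = mutual_info Y X.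
Proof.
rewrite /mutual_info -(@entropy_inj _ _ (fun t => (X t, Y t)) (fun w => (w.2, w.1))).
  by rewrite (addrC (entropy X)).
by move=> [a b] [c d] /= [-> ->].
Qed.

Lemma mi_fun (A B C D : finType) (X : nat -> A) (Y : nat -> B) (g : A -> C) (h : B -> D) :
  mutual_info (fun t => g (X t)) (fun t => h (Y t)) <= mutual_info X Y.
Proof.
apply: le_trans (mi_fun_l _ _ _) _; rewrite mi_sym [leRHS]mi_sym; exact: mi_fun_l.
Qed.

Lemma mi_le_r (A B : finType) (X : nat -> A) (Y : nat -> B) : mutual_info X Y <= entropy Y.
Proof. have := entropy_fun_le (fun t => (X t, Y t)) fst; rewrite /mutual_info /=; lra. Qed.

Lemma mi_ge0 (A B : finType) (X : nat -> A) (Y : nat -> B) : 0 <= mutual_info X Y.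
Proof. have := entropy_pair_le X Y; rewrite /mutual_info; lra. Qed.

Lemma cond_miE (A B C : finType) (X : nat -> A) (Y : nat -> B) (g : A -> C) :
  cond_mutual_info X Y g = mutual_info X Y - mutual_info (fun t => g (X t)) Y.
Proof. by rewrite /cond_mutual_info /mutual_info; lra. Qed.

(** An explicit modulus that tends to 0 with eta; the square root dominates
    the term - p ln p. *)
Lemma entropy_bool_le (e : nat -> bool) (eta : R) :
  P e <= eta -> entropy e <= 2 * Num.sqrt eta + eta.
Proof.
move=> he.
have e0 : 0 <= eta by apply: le_trans he; exact: Pr_ge0.
have eT : P (fun t => e t == true) = P e by apply: Pr_ext => t; case: (e t).
have eF : P (fun t => e t == false) = 1 - P e.
  rewrite -(Pr_T P) (Pr_partition e (fun=> true)) big_bool /= eT.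
  by rewrite addrC addrK; apply: Pr_ext => t; rewrite ?andTb.
rewrite /entropy big_bool /= eT eF.
have p0 := Pr_ge0 P e; have p1 := Pr_le1 e.
set p := P e in he p0 p1 *.
have h1 : - (p * ln p) <= 2 * Num.sqrt eta.
  apply: (@le_trans _ _ (2 * Num.sqrt p)); last by rewrite ler_pM2l // ler_sqrt.
  have [->|pn0] := eqVneq p 0; first by rewrite mul0r oppr0 mulr_ge0 ?sqrtr_ge0.
  have {}pn0 : 0 < p by rewrite lt_def pn0.
  have a0 : 0 < Num.sqrt p by rewrite sqrtr_gt0.
  have := ln_sublinear (x := (Num.sqrt p)^-1); rewrite invr_gt0 => /(_ a0).
  have pE : p = Num.sqrt p ^+ 2 by rewrite sqr_sqrtr.
  rewrite lnV ?posrE // {3 4}pE lnXn //.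
  set a := Num.sqrt p in a0 * => h.
  have : a ^+ 2 * - ln a <= a ^+ 2 * a^-1 by rewrite ler_wpM2l ?sqr_ge0 // ltW.
  have -> : a ^+ 2 * a^-1 = a by field; rewrite gt_eqF.
  rewrite mulr2n; lra.
have h2 : - ((1 - p) * ln (1 - p)) <= eta.
  apply: le_trans he.
  have [->|pn1] := eqVneq p 1; first by rewrite subrr mul0r oppr0.
  have q0 : 0 < 1 - p by rewrite subr_gt0 lt_def eq_sym pn1.
  have := @le_ln1Dx R ((1 - p)^-1 - 1).
  rewrite (_ : 1 + ((1 - p)^-1 - 1) = (1 - p)^-1); last by ring.
  rewrite lnV ?posrE // ltrBrDl subrr invr_gt0 => /(_ q0) h.
  have : (1 - p) * - ln (1 - p) <= (1 - p) * ((1 - p)^-1 - 1).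
    by rewrite ler_wpM2l // ltW.
  have -> : (1 - p) * ((1 - p)^-1 - 1) = p by field; rewrite gt_eqF.
  lra.
lra.
Qed.

End finite_prob.

(** * Low-entropy factors and asymptotically independent futures *)

Section blocks.
Variable A : finType.
Variable al : nat -> A.

Definition blk (n t : nat) : n.-tuple A := [tuple al (t + i)%N | i < n].

Definition sub_blk (n k m : nat) (x : n.-tuple A) : m.-tuple A :=
  [tuple nth (al 0%N) x (k + i) | i < m].

Lemma nth_blk n t i a : (i < n)%N -> nth a (blk n t) i = al (t + i)%N.
Proof. by move=> lin; have := tnth_mktuple (fun i : 'I_n => al (t + i)%N) (Ordinal lin); rewrite (tnth_nth a). Qed.

Lemma sub_blkE n k m t : (k + m <= n)%N -> sub_blk k m (blk n t) = blk m (t + k).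
Proof.
move=> kmn; apply: eq_from_tnth => i; rewrite !tnth_mktuple nth_blk ?addnA //.
by rewrite (leq_trans _ kmn) // ltn_add2l.
Qed.

End blocks.

Section decorrelation.
Variables (R : realType) (P : density R).

(** The fibers of positive correlation make up one event of g X, those of
    negative correlation another. *)
Lemma sum_abs_fibers (A C : finType) (X : nat -> A) (g : A -> C) (f : A -> R) eps :
  (forall D : pred C, `|Ex P X (fun x => f x * (D (g x))%:R)| <= eps) ->
  \sum_z `|Ex P X (fun x => f x * (g x == z)%:R)| <= 2 * eps.
Proof.
move=> h; pose e z := Ex P X (fun x => f x * (g x == z)%:R).
have eD (D : pred C) : \sum_(z | D z) e z = Ex P X (fun x => f x * (D (g x))%:R).
  rewrite /e /Ex exchange_big /=; apply: eq_bigr => x _.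
  rewrite -mulr_suml -mulr_sumr; congr (_ * _ * _).
  case: (boolP (D (g x))) => Dg.
    by rewrite (bigD1 (g x)) //= eqxx big1 ?addr0 // => z /andP[_]; rewrite eq_sym => /negPf ->.
  by rewrite big1 // => z Dz; case: eqP => // gz; move: Dg; rewrite gz Dz.
rewrite (bigID (fun z => 0 <= e z)) /=.
rewrite (eq_bigr e); last by move=> z; rewrite -/(e z) => ?; rewrite ger0_norm.
rewrite [X in _ + X](eq_bigr (fun z => - e z)); last first.
  by move=> z; rewrite -/(e z) -ltNge => ?; rewrite ltr0_norm.
rewrite sumrN !eD.
have := h (fun z => 0 <= e z); have := h (fun z => ~~ (0 <= e z)).
rewrite !ler_norml => /andP[? ?] /andP[? ?]; lra.
Qed.

(** Replacing the law of (X, Y) by cond_indep_law costs the total variation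
    distance. Under the new law psi Y may be replaced by its conditional
    expectation given g X, a bounded function of g X. *)
Lemma Ex_decorrelate (A B C : finType) (X : nat -> A) (Y : nat -> B) (g : A -> C)
    (f : A -> R) (psi : B -> R) (L Bd eps tau : R) :
  (forall x, `|f x| <= L) -> (forall y, `|psi y| <= Bd) -> 0 <= Bd ->
  (forall D : pred C, `|Ex P X (fun x => f x * (D (g x))%:R)| <= eps) ->
  0 < tau ->
  `|Ex P (fun t => (X t, Y t)) (fun w => f w.1 * psi w.2)| <=
  L * Bd * (cond_mutual_info P X Y g / tau + tau) + 2 * Bd * eps.
Proof.
move=> fL pB B0 h tau0.
pose q := cond_indep_law P X Y g; pose p w := P (fun t => (X t, Y t) == w).
have -> : Ex P (fun t => (X t, Y t)) (fun w => f w.1 * psi w.2) =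
  \sum_w f w.1 * psi w.2 * (p w - q w) + \sum_w f w.1 * psi w.2 * q w.
  by rewrite -big_split; apply: eq_bigr => w _ /=; rewrite -mulrDr subrK.
apply: le_trans (ler_normD _ _) _; apply: lerD.
  apply: le_trans (ler_norm_sum _ _ _) _.
  apply: (@le_trans _ _ (\sum_w L * Bd * `|p w - q w|)).
    by apply: ler_sum => w _; rewrite !normrM ler_wpM2r // ler_pM.
  rewrite -mulr_sumr ler_wpM2l ?mulr_ge0 //; last exact: cond_mi_ge_tv.
  by apply: le_trans (fL (X 0%N)).
pose Phi z := \sum_y psi y * (P (fun t => (g (X t), Y t) == (z, y)) / P (fun t => g (X t) == z)).
have PhiB z : `|Phi z| <= Bd.
  apply: le_trans (ler_norm_sum _ _ _) _.
  apply: (@le_trans _ _ (\sum_y Bd * (P (fun t => (g (X t), Y t) == (z, y)) / P (fun t => g (X t) == z)))).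
    apply: ler_sum => y _; rewrite normrM (ger0_norm (divr_ge0 (Pr_ge0 _ _) (Pr_ge0 _ _))).
    by rewrite ler_wpM2r // divr_ge0 ?Pr_ge0.
  rewrite -mulr_sumr -mulr_suml.
  have -> : \sum_y P (fun t => (g (X t), Y t) == (z, y)) = P (fun t => g (X t) == z).
    by rewrite [RHS](Pr_partition P Y).
  have [->|gx] := eqVneq (P (fun t => g (X t) == z)) 0.
    by rewrite mul0r mulr0.
  by rewrite divff // mulr1.
have -> : \sum_w f w.1 * psi w.2 * q w =
  \sum_z Phi z * Ex P X (fun x => f x * (g x == z)%:R).
  rewrite (eq_bigr (fun w => f w.1 * psi w.2 * q (w.1, w.2))); last by case.
  rewrite -(pair_bigA _ (fun x y => f x * psi y * q (x, y))) /=.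
  transitivity (\sum_x \sum_z Phi z * (f x * (g x == z)%:R * P (fun t => X t == x))).
    apply: eq_bigr => x _; rewrite (bigD1 (g x)) //= eqxx [X in _ + X]big1 ?addr0.
      rewrite mulr1 /Phi mulr_suml; apply: eq_bigr => y _; rewrite /q /cond_indep_law /=.
      set c := (P (fun t => g (X t) == g x))^-1; ring.
    by move=> z; rewrite eq_sym => /negPf ->; rewrite mulr0 mul0r mulr0.
  rewrite exchange_big; apply: eq_bigr => z _; rewrite /Ex mulr_sumr.
  by [].
apply: le_trans (ler_norm_sum _ _ _) _.
apply: (@le_trans _ _ (\sum_z Bd * `|Ex P X (fun x => f x * (g x == z)%:R)|)).
  by apply: ler_sum => z _; rewrite normrM ler_wpM2r.
rewrite -mulr_sumr [2 * Bd]mulrC -mulrA ler_wpM2l //.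
exact: sum_abs_fibers.
Qed.

Lemma sum_telescope_le (J : nat -> R) (K M : nat) : (forall s, 0 <= J s) ->
  \sum_(s < K) (J s - J (s + M)%N) <= \sum_(s < M) J s.
Proof.
move=> J0; rewrite sumrB lerBlDr.
have -> : \sum_(i < M) J i + \sum_(i < K) J (i + M)%N = \sum_(i < M + K) J i.
  by rewrite big_split_ord /=; congr (_ + _); apply: eq_bigr => i _; rewrite addnC.
rewrite addnC big_split_ord /= lerDl; exact: sumr_ge0.
Qed.

Variables (A : finType) (al : nat -> A) (v : A -> R).

(** The information J s that the name p t carries on the letters from t + s
    to t + n - 1 decreases in s and never exceeds ln #|F|, so the drops J s
    - J (s + M) add up to at most M ln #|F|. Such a drop is the mutual
    information of these letters and the name given the letters from t + s +
    M on; Ex_decorrelate applies with this conditioning. The last M times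
    are bounded trivially. *)
Lemma low_entropy_decorrelates (M n : nat) (F : finType) (p : nat -> F)
    (psi : nat -> F -> R) (L Bd eps tau : R) :
  (forall a, `|v a| <= L) -> (forall s y, `|psi s y| <= Bd) -> 0 <= Bd ->
  (forall l (D : pred (l.-tuple A)), (0 < l)%N ->
    `|Ex P (fun t => (al t, blk al l (t + M))) (fun w => v w.1 * (D w.2)%:R)| <= eps) ->
  0 < tau ->
  \sum_(s < n) `|Ex P (fun t => (al (t + s)%N, p t)) (fun w => v w.1 * psi s w.2)| <=
  L * Bd * (M%:R * ln #|F|%:R / tau + n%:R * tau) + n%:R * (2 * Bd * eps) +
  M%:R * (L * Bd).
Proof.
move=> vL pB B0 h tau0.
have L0 : 0 <= L by apply: le_trans (vL (al 0%N)).
have eps0 : 0 <= eps by apply: le_trans (h 1%N (fun=> true) isT).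
pose T s := `|Ex P (fun t => (al (t + s)%N, p t)) (fun w => v w.1 * psi s w.2)|.
pose J s := mutual_info P (fun t => blk al (n - s) (t + s)) p.
have J0 s : 0 <= J s by exact: mi_ge0.
have JF s : J s <= ln #|F|%:R by apply: le_trans (mi_le_r _ _ _) (entropy_le_card _ _).
have triv s : T s <= L * Bd.
  rewrite /T ler_norml -(Ex_cst P (fun t => (al (t + s)%N, p t)) (- _)).
  rewrite -[X in _ && (_ <= X)](Ex_cst P (fun t => (al (t + s)%N, p t))).
  have bd t : `|v (al (t + s)%N) * psi s (p t)| <= L * Bd by rewrite normrM ler_pM.
  by apply/andP; split; apply: Ex_le => t; have := bd t; rewrite ler_norml => /andP[].
have main s : (s + M < n)%N ->
  T s <= L * Bd * ((J s - J (s + M)%N) / tau + tau) + 2 * Bd * eps.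
  move=> sMn.
  pose g := @sub_blk _ al (n - s) M (n - (s + M)).
  pose X t := blk al (n - s) (t + s).
  have gE t : g (X t) = blk al (n - (s + M)) (t + (s + M)).
    by rewrite /g /X sub_blkE ?addnA //; lia.
  pose f (x : (n - s).-tuple A) := v (nth (al 0%N) x 0).
  have fE t : f (X t) = v (al (t + s)%N).
    by rewrite /f nth_blk ?addn0 //; lia.
  have -> : T s = `|Ex P (fun t => (X t, p t)) (fun w => f w.1 * psi s w.2)|.
    congr `|_|.
    have := Ex_comp P (fun t => (X t, p t)) (fun w => (nth (al 0%N) w.1 0, w.2))
      (fun w => v w.1 * psi s w.2).
    move=> <-; congr (Ex P _ _); apply/funext => t.
    by rewrite /= /X nth_blk ?addn0 //; lia.
  have -> : J s - J (s + M)%N = cond_mutual_info P X p g.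
    rewrite cond_miE; congr (_ - mutual_info _ _ _); apply/funext => t.
    by rewrite gE.
  apply: Ex_decorrelate => // [x|D]; first exact: vL.
  suff -> : Ex P X (fun x => f x * (D (g x))%:R) =
      Ex P (fun t => (al t, blk al (n - (s + M)) (t + M))) (fun w => v w.1 * (D w.2)%:R).
    by apply: h; rewrite subn_gt0.
  have := Ex_comp P X (fun x => (nth (al 0%N) x 0, g x)) (fun w => v w.1 * (D w.2)%:R).
  move=> /esym hh; apply: (etrans hh).
  rewrite -[RHS](Ex_shift P _ _ s).
  congr (Ex P _ _); apply/funext => t.
  by rewrite gE /X nth_blk ?addn0 ?addnA // subn_gt0 (leq_ltn_trans _ sMn) // leq_addr.
have [Mn|nM] := leqP n M.
  apply: (@le_trans _ _ (\sum_(s < n) L * Bd)).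
    by apply: ler_sum => s _; exact: triv.
  rewrite sumr_const card_ord -[_ *+ n]mulr_natl.
  apply: (@le_trans _ _ (M%:R * (L * Bd))).
    by rewrite ler_wpM2r ?mulr_ge0 // ler_nat.
  rewrite lerDr addr_ge0 // ?mulr_ge0 ?addr_ge0 ?mulr_ge0 ?invr_ge0 //; try exact: ltW.
  exact: le_trans (J0 0%N) (JF 0%N).
have -> : \sum_(s < n) `|Ex P (fun t => (al (t + s)%N, p t)) (fun w => v w.1 * psi s w.2)|
  = \sum_(s < (n - M) + M) T s by rewrite subnK // ltnW.
rewrite big_split_ord /=; apply: lerD; last first.
  apply: (@le_trans _ _ (\sum_(s < M) L * Bd)).
    by apply: ler_sum => s _; exact: triv.
  by rewrite sumr_const card_ord -[_ *+ M]mulr_natl.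
apply: (@le_trans _ _ (\sum_(s < n - M)
   (L * Bd * ((J s - J (s + M)%N) / tau + tau) + 2 * Bd * eps))).
  by apply: ler_sum => s _; apply: main; have := ltn_ord s; lia.
rewrite big_split /= -mulr_sumr big_split /= -mulr_suml !sumr_const card_ord.
apply: lerD; last first.
  rewrite -[leLHS]mulr_natl ler_wpM2r ?mulr_ge0 // ler_nat; exact: leq_subr.
rewrite ler_wpM2l ?mulr_ge0 //; apply: lerD; last first.
  rewrite -[leLHS]mulr_natl ler_wpM2r ?(ltW tau0) // ler_nat; exact: leq_subr.
rewrite ler_pM2r ?invr_gt0 //; apply: le_trans (sum_telescope_le _ _ J0) _.
apply: (@le_trans _ _ (\sum_(s < M) ln #|F|%:R)).
  by apply: ler_sum => s _; exact: JF.
by rewrite sumr_const card_ord -[_ *+ M]mulr_natl.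
Qed.

End decorrelation.

(** * Densities along ultrafilters *)

Section averages.
Variable R : realType.

Definition av (F : nat -> R) (N : nat) : R := N%:R^-1 * \sum_(1 <= n < N.+1) F n.

Lemma avD F G N : av (fun t => F t + G t) N = av F N + av G N.
Proof. by rewrite /av big_split mulrDr. Qed.

Lemma avZ c F N : av (fun t => c * F t) N = c * av F N.
Proof. by rewrite /av -mulr_sumr mulrCA. Qed.

Lemma avN F N : av (fun t => - F t) N = - av F N.
Proof. by rewrite /av sumrN mulrN. Qed.

Lemma av_sum (I : finType) (F : I -> nat -> R) N :
  av (fun t => \sum_i F i t) N = \sum_i av (F i) N.
Proof. by rewrite /av exchange_big mulr_sumr. Qed.

Lemma av_le F G N : (forall t, (0 < t)%N -> F t <= G t) -> av F N <= av G N.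
Proof.
move=> FG; rewrite /av ler_wpM2l ?invr_ge0 //.
by rewrite !big_nat; apply: ler_sum => n /andP[n0 _]; exact: FG.
Qed.

Lemma eq_av F G N : (forall t, (0 < t)%N -> F t = G t) -> av F N = av G N.
Proof.
move=> FG; apply/eqP; rewrite eq_le.
by apply/andP; split; apply: av_le => t /FG ->.
Qed.

Lemma av_cst c N : (0 < N)%N -> av (fun=> c) N = c.
Proof.
move=> N0; rewrite /av sumr_const_nat subSS subn0 -[c *+ N]mulr_natl mulKf //.
by rewrite pnatr_eq0 -lt0n.
Qed.

Lemma av_norm_le F (B : R) N : 0 <= B -> (forall t, (0 < t)%N -> `|F t| <= B) -> `|av F N| <= B.
Proof.
move=> B0 FB; have [->|N0] := posnP N; first by rewrite /av invr0 mul0r normr0.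
rewrite ler_norml -{1}(av_cst (- B) N0) -{2}(av_cst B N0).
by apply/andP; split; apply: av_le => t /FB; rewrite ler_norml => /andP[].
Qed.

Lemma av_shift F (B : R) s N : (0 < N)%N -> 0 <= B -> (forall t, (0 < t)%N -> `|F t| <= B) ->
  `|av (fun t => F (t + s)%N) N - av F N| <= (2 * B * s%:R) / N%:R.
Proof.
move=> N0 B0 FB; rewrite /av -mulrBr normrM ger0_norm ?invr_ge0 // mulrC.
rewrite ler_wpM2r ?invr_ge0 //.
have e1 : \sum_(1 <= n < N.+1) F (n + s)%N = \sum_(1 + s <= n < N.+1 + s) F n.
  by rewrite big_addn addnK.
have -> : \sum_(1 <= n < N.+1) F (n + s)%N - \sum_(1 <= n < N.+1) F n =
   \sum_(N.+1 <= n < N.+1 + s) F n - \sum_(1 <= n < 1 + s) F n.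
  apply/eqP; rewrite subr_eq addrAC eq_sym subr_eq e1.
  have -> : \sum_(1 + s <= n < N.+1 + s) F n + \sum_(1 <= n < 1 + s) F n =
      \sum_(1 <= n < N.+1 + s) F n.
    by rewrite addrC [RHS](@big_cat_nat _ _ _ (1 + s)%N) //= ?leq_addr // leq_add2r.
  by rewrite addrC [X in _ == X](@big_cat_nat _ _ _ N.+1) //= ?leq_addr.
have bd a : (0 < a)%N -> `|\sum_(a <= n < a + s) F n| <= B * s%:R.
  move=> a0; apply: le_trans (ler_norm_sum _ _ _) _.
  apply: (@le_trans _ _ (\sum_(a <= n < a + s) B)).
    by rewrite !big_nat; apply: ler_sum => n /andP[an _]; apply: FB; exact: leq_trans an.
  by rewrite sumr_const_nat addKn -[_ *+ s]mulr_natr.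
apply: le_trans (ler_normB _ _) _.
have := bd N.+1 isT; have := bd 1%N isT; lra.
Qed.

Lemma ultra_cvg_bounded (U : set_system nat) (a : nat -> R) B :
  UltraFilter U -> (forall k, `|a k| <= B) -> cvg (a k @[k --> U]).
Proof.
move=> UU aB.
have [] := @segment_compact R (- B) B (fmap a U) _ _.
  rewrite /fmap /=; apply: filterS filterT => k _ /=.
  by have := aB k; rewrite ler_norml in_itv.
move=> p [_ cp]; apply/cvg_ex; exists p => V Vp.
rewrite /fmap /=; have [//|UV] := in_ultra_setVsetC (a @^-1` V) UU.
have := cp (~` V) V UV Vp.
by move=> [x [nVx Vx]]; exfalso; apply: nVx.
Qed.

Variables (N_ : nat -> nat) (U : set_system nat).
Hypothesis UU : UltraFilter U.
Let FU : Filter U := @filter_filter _ _ (@ultra_proper _ _ UU).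
Hypothesis N_oo : forall m, \forall k \near U, (m <= N_ k)%N.

Definition ulim (F : nat -> R) : R := lim (av F (N_ k) @[k --> U]).

Lemma ulim_cvg F B : (forall t, (0 < t)%N -> `|F t| <= B) ->
  av F (N_ k) @[k --> U] --> ulim F.
Proof.
move=> FB; have B0 : 0 <= B by apply: le_trans (FB 1%N isT).
apply: (@ultra_cvg_bounded U (fun k => av F (N_ k)) B) => // k.
exact: av_norm_le.
Qed.

Lemma ulimP F a : av F (N_ k) @[k --> U] --> a -> ulim F = a.
Proof. by move=> h; apply: cvg_lim. Qed.

Definition ultra_Pr (e : nat -> bool) : R := ulim (fun t => (e t)%:R).

Lemma ind_norm (b : bool) : `|b%:R : R| <= 1.
Proof. by case: b; rewrite ?normr0 ?normr1. Qed.

Lemma ultra_Pr_cvg (e : nat -> bool) : av (fun t => (e t)%:R) (N_ k) @[k --> U] --> ultra_Pr e.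
Proof. by apply: (@ulim_cvg _ 1) => t _; exact: ind_norm. Qed.

Lemma ultra_Pr_ge0 (e : nat -> bool) : 0 <= ultra_Pr e.
Proof.
apply: (cvgr_to_ge (@ultra_Pr_cvg e)).
apply: filterE => k; rewrite /av mulr_ge0 ?invr_ge0 //.
by apply: sumr_ge0 => n _; rewrite ler0n.
Qed.

Lemma ultra_Pr_T : ultra_Pr (fun=> true) = 1.
Proof.
apply: ulimP; apply: cvg_near_cst; have := N_oo 1.
by apply: filterS => k k0; rewrite av_cst.
Qed.

Lemma ultra_Pr_add (e f : nat -> bool) : (forall t, ~~ (e t && f t)) ->
  ultra_Pr (fun t => e t || f t) = ultra_Pr e + ultra_Pr f.
Proof.
move=> ef; apply: ulimP.
have := @cvgD _ _ _ _ FU _ _ _ _ (@ultra_Pr_cvg e) (@ultra_Pr_cvg f).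
apply: cvg_trans; apply: near_eq_cvg; apply: filterE => k /=.
apply: (etrans (esym (avD _ _ _))); apply: eq_av => t _.
by have := ef t; case: (e t); case: (f t); rewrite ?addr0 ?add0r.
Qed.

Lemma cvg_invN (c : R) : c / (N_ k)%:R @[k --> U] --> (0 : R).
Proof.
apply/cvgrPdist_le => eps eps0.
have := N_oo (Num.trunc (`|c| / eps)).+1; apply: filterS => k kN.
have Nk : 0 < (N_ k)%:R :> R by rewrite ltr0n (leq_trans _ kN).
rewrite sub0r normrN normrM normfV (ger0_norm (ltW Nk)) ler_pdivrMr // mulrC.
rewrite -ler_pdivrMr //.
have := truncnS_gt (`|c| / eps); move=> h; apply/ltW/(lt_le_trans h).
by rewrite ler_nat.
Qed.

Lemma cvg_av_shift F (B : R) s (a : R) : (forall t, (0 < t)%N -> `|F t| <= B) ->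
  av F (N_ k) @[k --> U] --> a -> av (fun t => F (t + s)%N) (N_ k) @[k --> U] --> a.
Proof.
move=> FB Fa; have B0 : 0 <= B by apply: le_trans (FB 1%N isT).
suff d0 : av (fun t => F (t + s)%N) (N_ k) - av F (N_ k) @[k --> U] --> (0 : R).
  have := @cvgD _ _ _ _ FU _ _ _ _ d0 Fa; rewrite add0r; apply: cvg_trans; apply: near_eq_cvg.
  by apply: filterE => k /=; rewrite subrK.
apply/norm_cvg0P; apply: (@squeeze_cvgr _ _ _ _ (fun=> 0) (fun k => 2 * B * s%:R / (N_ k)%:R)).
- have := N_oo 1; apply: filterS => k k0; rewrite normr_ge0 /=.
  exact: av_shift.
- exact: cvg_cst.
- exact: cvg_invN.
Qed.

Lemma ultra_Pr_shift1 (e : nat -> bool) : ultra_Pr (fun t => e t.+1) = ultra_Pr e.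
Proof.
apply: ulimP.
have := @cvg_av_shift (fun t => (e t)%:R) 1 1 _ (fun t _ => ind_norm (e t)) (@ultra_Pr_cvg e).
apply: cvg_trans; apply: near_eq_cvg; apply: filterE => k /=.
by apply: eq_av => t _; rewrite addn1.
Qed.

(** Every set has a frequency along U, so all of them converge at once;
    shift invariance holds since the boundary terms are divided by N_ k. *)
Definition ultra_density : density R :=
  Density ultra_Pr_ge0 ultra_Pr_T ultra_Pr_add ultra_Pr_shift1.

Lemma ultra_Ex_cvg (T : finType) (X : nat -> T) (g : T -> R) :
  av (fun t => g (X t)) (N_ k) @[k --> U] --> Ex ultra_density X g.
Proof.
have -> : (fun k => av (fun t => g (X t)) (N_ k)) =
  (fun k => \sum_x g x * av (fun t => (X t == x)%:R) (N_ k)).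
  apply/funext => k; rewrite -[RHS](eq_bigr _ (fun x _ => avZ _ _ _)) -av_sum.
  apply: eq_av => t _; rewrite (bigD1 (X t)) //= eqxx mulr1 big1 ?addr0 //.
  by move=> x; rewrite eq_sym => /negPf ->; rewrite mulr0.
apply: cvg_big => // [|x _]; first exact: add_continuous.
apply: cvgM; first exact: cvg_cst.
exact: ultra_Pr_cvg.
Qed.

End averages.

(** * Approximate tail events correlated with the process *)

Section tail_events.
Variables (R : realType) (P : density R) (A : finType) (al : nat -> A) (v : A -> R).

Definition corr (c : nat -> bool) : R :=
  Ex P (fun t => (al t, c t)) (fun w => v w.1 * w.2%:R).

Definition future (m : nat) : set (nat -> bool) :=
  [set c | exists l (C : pred (l.-tuple A)), forall t, c t = C (blk al l (t + m))].

Lemma future_le m m' : (m <= m')%N -> future m' `<=` future m.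
Proof.
move=> mm c [l [C cE]]; exists (m' - m + l)%N.
exists (fun x => C (sub_blk al (m' - m) l x)) => t.
by rewrite sub_blkE // cE -addnA subnKC.
Qed.

Lemma future_op (op : bool -> bool -> bool) m c d : future m c -> future m d ->
  future m (fun t => op (c t) (d t)).
Proof.
move=> [l [C cE]] [k [D dE]]; exists (l + k)%N.
exists (fun x => op (C (sub_blk al 0 l x)) (D (sub_blk al 0 k x))) => t.
by rewrite !sub_blkE ?cE ?dE ?addn0 ?add0n ?leq_addr ?leq_addl.
Qed.

Lemma corr_modular c d :
  corr (fun t => c t || d t) + corr (fun t => c t && d t) = corr c + corr d.
Proof.
have e (f : bool -> bool -> bool) : corr (fun t => f (c t) (d t)) =
    Ex P (fun t => (al t, (c t, d t))) (fun w => v w.1 * (f w.2.1 w.2.2)%:R).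
  exact: (Ex_comp P (fun t => (al t, (c t, d t))) (fun w => (w.1, f w.2.1 w.2.2))).
rewrite (e orb) (e andb) (e (fun x _ => x)) (e (fun _ y => y)) /Ex -!big_split /=.
apply: eq_bigr => -[a [x y]] _ /=.
by case: x; case: y => /=; ring.
Qed.

Lemma corr_bound L c : (forall a, `|v a| <= L) -> `|corr c| <= L.
Proof.
move=> vL; rewrite ler_norml -(Ex_cst P (fun t => (al t, c t)) (- L)).
rewrite -[X in _ && (_ <= X)](Ex_cst P (fun t => (al t, c t))).
have L0 : 0 <= L by apply: le_trans (vL (al 0%N)).
have bd t : `|v (al t) * (c t)%:R| <= L.
  by case: (c t); rewrite ?mulr1 ?mulr0 ?normr0.
by apply/andP; split; apply: Ex_le => t; have := bd t; rewrite ler_norml => /andP[].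
Qed.

Lemma Pr_modular (c d : nat -> bool) :
  P (fun t => c t || d t) + P (fun t => c t && d t) = P c + P d.
Proof.
have -> : P (fun t => c t || d t) = P c + P (fun t => d t && ~~ c t).
  rewrite -Pr_add; last by move=> t; case: (c t); rewrite ?andbF.
  by apply: Pr_ext => t; case: (c t); case: (d t).
have -> : P d = P (fun t => d t && ~~ c t) + P (fun t => c t && d t).
  rewrite -Pr_add; last by move=> t; case: (c t); rewrite ?andbF.
  by apply: Pr_ext => t; case: (c t); case: (d t).
by rewrite addrA.
Qed.

Lemma Pr_symdiff (c d : nat -> bool) :
  P (fun t => c t (+) d t) = 2 * P (fun t => c t || d t) - P c - P d.
Proof.
have : P (fun t => c t || d t) = P (fun t => c t (+) d t) + P (fun t => c t && d t).
  rewrite -Pr_add; last by move=> t; case: (c t); case: (d t).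
  by apply: Pr_ext => t; case: (c t); case: (d t).
have := Pr_modular c d; lra.
Qed.

(** Among the events of the future after i whose correlation is optimal up
    to 1/(i+1), choose one of almost maximal probability. By modularity the
    union of two of these events is near-optimal too, so it is hardly more
    probable than each of them: the two events nearly agree. *)
Lemma tail_events (L s0 : R) : (forall a, `|v a| <= L) -> 0 < s0 ->
  (forall m, exists2 c, future m c & s0 <= corr c) ->
  exists cs : nat -> nat -> bool,
    [/\ forall i, future i (cs i), forall i, s0 / 2 <= corr (cs i) &
      forall eta, 0 < eta -> exists i0, forall i j, (i0 <= i)%N -> (i0 <= j)%N ->
        P (fun t => cs i t (+) cs j t) <= eta].
Proof.
move=> vL s00 hex.
have EvL c : corr c <= L by apply: le_trans (ler_norm _) (corr_bound c vL).
pose S m := sup [set corr c | c in future m].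
have supS m : has_sup [set corr c | c in future m].
  split; first by have [c fc _] := hex m; exists (corr c), c.
  by exists L => _ [c _ <-].
have leS m c : future m c -> corr c <= S m.
  by move=> fc; apply: sup_upper_bound => //; exists c.
have S_ge m : s0 <= S m by have [c fc /le_trans] := hex m; apply; exact: leS.
pose s := inf (range S).
have infs : has_inf (range S).
  by split; [exists (S 0%N), 0%N|exists s0 => _ [m _ <-]].
have s_le m : s <= S m by apply: ge_inf; [case: infs|exists m].
have s_ge : s0 <= s.
  by apply: lb_le_inf => [|_ [m _ <-]]; [case: infs|exact: S_ge].
pose r (i : nat) : R := i.+1%:R^-1.
have r0 i : 0 < r i by rewrite invr_gt0.
have r_le i j : (i <= j)%N -> r j <= r i.
  by move=> ij; rewrite lef_pV2 ?posrE // ler_nat.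
have r_small e : 0 < e -> exists i, r i <= e.
  move=> e0; exists (Num.trunc e^-1); rewrite /r invf_ple ?posrE //.
  exact/ltW/truncnS_gt.
pose G i := [set c | future i c /\ s - r i <= corr c].
pose p i := sup [set P c | c in G i].
have supp i : has_sup [set P c | c in G i].
  split; last by exists 1 => _ [c _ <-]; exact: Pr_le1.
  have : s - r i < S i by rewrite (lt_le_trans _ (s_le i)) // ltrBlDr ltrDl.
  move=> /(sup_gt (supS i).1) [_ [c fc <-]] h.
  by exists (P c), c => //; split => //; exact: ltW.
have lep i c : G i c -> P c <= p i.
  by move=> gc; apply: sup_upper_bound => //; exists c.
pose ps := inf (range p).
have infp : has_inf (range p).
  split; first by exists (p 0%N), 0%N.
  exists 0 => _ [i _ <-]; have [[_ [c gc _]] _] := supp i.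
  by apply: le_trans (lep i c gc); exact: Pr_ge0.
have ps_le i : ps <= p i by apply: ge_inf; [case: infp|exists i].
have /choice [c cP] : forall i, exists c, G i c /\ ps - r i <= P c.
  move=> i; have : ps - r i < p i by rewrite (lt_le_trans _ (ps_le i)) // ltrBlDr ltrDl.
  move=> /(sup_gt (supp i).1) [_ [c gc <-]] h.
  by exists c; split => //; exact: ltW.
have [k0 k0P] := r_small _ (divr_gt0 s00 (ltr0Sn R 1)).
exists (fun i => c (i + k0)%N); split.
- by move=> i; have [[fc _] _] := cP (i + k0)%N; apply: future_le fc; exact: leq_addr.
- move=> i; have [[_ hc] _] := cP (i + k0)%N; apply: le_trans hc.
  have := r_le _ _ (leq_addl i k0); lra.
move=> eta eta0; pose e := eta / 4.
have e0 : 0 < e by rewrite divr_gt0.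
have [_ [i1 _ <-] i1P] := inf_adherent e0 infp.
pose tau := r i1 / 3; have tau0 : 0 < tau by rewrite divr_gt0.
have [_ [i2 _ <-] i2P] := inf_adherent tau0 infs.
have [i3 i3P] := r_small _ tau0; have [i4 i4P] := r_small _ e0.
exists (i1 + i2 + i3 + i4)%N => i' j' ii' jj'.
pose i0 := (i1 + i2 + i3 + i4)%N.
have l4 : (i4 <= i0)%N := leq_addl _ _.
have l3 : (i3 <= i0)%N := leq_trans (leq_addl _ _) (leq_addr _ _).
have l2 : (i2 <= i0)%N := leq_trans (leq_addl _ _) (leq_trans (leq_addr _ _) (leq_addr _ _)).
have l1 : (i1 <= i0)%N := leq_trans (leq_addr _ _) (leq_trans (leq_addr _ _) (leq_addr _ _)).
set i := (i' + k0)%N; set j := (j' + k0)%N.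
have ii : (i0 <= i)%N by rewrite /i (leq_trans ii') // leq_addr.
have jj : (i0 <= j)%N by rewrite /j (leq_trans jj') // leq_addr.
have [[fi hi] pi] := cP i; have [[fj hj] pj] := cP j.
have fi0 := future_le ii fi; have fj0 := future_le jj fj.
have le3 k : (i0 <= k)%N -> r k <= tau.
  by move=> h; apply: le_trans i3P; apply: r_le; exact: leq_trans h.
have le4 k : (i0 <= k)%N -> r k <= e.
  by move=> h; apply: le_trans i4P; apply: r_le; exact: leq_trans h.
have hand : corr (fun t => c i t && c j t) <= s + tau.
  apply/ltW/(le_lt_trans _ i2P)/leS.
  apply: (future_le l2).
  exact: future_op.
have gor : G i1 (fun t => c i t || c j t).
  split.
    apply: (future_le l1).
    exact: future_op.
  have := corr_modular (c i) (c j); have := le3 _ ii; have := le3 _ jj.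
  have : r i1 = 3 * tau by rewrite /tau mulrC divfK.
  lra.
have := lep _ _ gor; rewrite Pr_symdiff.
have := le4 _ ii; have := le4 _ jj.
have : eta = 4 * e by rewrite /e mulrC divfK.
rewrite /ps in pi pj *; lra.
Qed.

End tail_events.

(** * Approximate tail events have small block entropy *)

Lemma count_lt_le a m : (\sum_(r < a) nat_of_bool (r < m)%N <= minn a m)%N.
Proof.
elim: a => [|a IH]; first by rewrite big_ord0.
by rewrite big_ord_recr /=; case: (ltnP a m) => h; move: IH => /=; lia.
Qed.

Section block_entropies.
Variables (R : realType) (P : density R) (A : finType) (al : nat -> A).

Definition block_entropy (n : nat) : R := entropy P (blk al n).

Lemma entropy_blk_at n k : entropy P (fun t => blk al n (t + k)) = block_entropy n.
Proof. exact: (entropy_shift P (blk al n) k). Qed.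

Lemma block_entropy0 : block_entropy 0 = 0.
Proof.
apply/eqP; rewrite eq_le entropy_ge0 andbT; apply: le_trans (entropy_le_card P _) _.
by rewrite card_tuple expn0 ln1.
Qed.

Lemma entropy_of (B C : finType) (X : nat -> B) (Y : nat -> C) (f : B -> C) :
  (forall t, Y t = f (X t)) -> entropy P Y <= entropy P X.
Proof. by move=> YE; rewrite (_ : Y = fun t => f (X t)) ?entropy_fun_le //; apply/funext. Qed.

Lemma block_entropy_cat a b : block_entropy (a + b) <= entropy P (fun t => (blk al a t, blk al b (t + a))).
Proof.
apply: (@entropy_of _ _ _ _ (fun w : a.-tuple A * b.-tuple A =>
  [tuple nth (al 0%N) (val w.1 ++ val w.2) i | i < a + b])) => t.
apply: eq_from_tnth => i; rewrite !tnth_mktuple nth_cat size_tuple.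
case: ltnP => ia; first by rewrite nth_blk.
by rewrite nth_blk ?ltn_subLR // -addnA subnKC.
Qed.

Definition entropy_incr (n : nat) : R := block_entropy n.+1 - block_entropy n.

Lemma entropy_incr_ge0 n : 0 <= entropy_incr n.
Proof.
rewrite subr_ge0; apply: (@entropy_of _ _ _ _ (sub_blk al 0 n)) => t.
by rewrite sub_blkE ?addn0 ?add0n.
Qed.

(** Strong subadditivity of entropy: conditioning the next letter on a
    longer past decreases its entropy. *)
Lemma entropy_incr_anti1 n : entropy_incr n.+1 <= entropy_incr n.
Proof.
have := cond_mi_ge0 P (blk al n.+1) (fun t => al (t + n.+1)%N) (sub_blk al 1 n).
rewrite /cond_mutual_info /entropy_incr.
have -> : entropy P (fun t => sub_blk al 1 n (blk al n.+1 t)) = block_entropy n.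
  by rewrite -(entropy_blk_at n 1); congr (entropy P _); apply/funext => t; rewrite sub_blkE.
have h1 : entropy P (fun t => (sub_blk al 1 n (blk al n.+1 t), al (t + n.+1)%N)) <= block_entropy n.+1.
  rewrite -(entropy_blk_at n.+1 1).
  apply: (@entropy_of _ _ _ _ (fun x => (sub_blk al 0 n x, nth (al 0%N) x n))) => t.
  by rewrite sub_blkE // sub_blkE ?add0n // nth_blk // addn0 -addnA add1n.
have h2 : block_entropy n.+2 <= entropy P (fun t => (blk al n.+1 t, al (t + n.+1)%N)).
  rewrite -[n.+2]addn1; apply: le_trans (block_entropy_cat n.+1 1) _.
  apply: (@entropy_of _ _ _ _ (fun w => (w.1, [tuple of [:: w.2]]))) => t /=.
  by congr pair; apply: eq_from_tnth => i; rewrite tnth_mktuple ord1 addn0.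
rewrite -/(block_entropy n.+1); lra.
Qed.

Lemma entropy_incr_anti m n : (m <= n)%N -> entropy_incr n <= entropy_incr m.
Proof.
elim: n => [|n IH]; first by rewrite leqn0 => /eqP ->.
rewrite leq_eqVlt => /orP[/eqP -> //|/IH]; exact: le_trans (entropy_incr_anti1 n).
Qed.

Lemma block_entropy_sum a b : block_entropy (a + b) - block_entropy b = \sum_(r < a) entropy_incr (b + r).
Proof.
elim: a => [|a IH]; first by rewrite big_ord0 subrr.
by rewrite big_ord_recr /= -IH /entropy_incr addSn (addnC b a); ring.
Qed.

(** The increments decrease to a limit h. From some r0 on all of them are
    within delta of h, so the entropy of an a-block and the entropy it adds
    to a b-block differ by at most delta a plus the contribution of the
    first r0 increments, uniformly in b. *)
Lemma block_mi_sublinear (delta : R) : 0 < delta ->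
  exists K : R, forall a b, block_entropy a + block_entropy b - block_entropy (a + b) <= K + delta * a%:R.
Proof.
move=> d0; pose h := inf (range entropy_incr).
have infh : has_inf (range entropy_incr).
  by split; [exists (entropy_incr 0), 0%N|exists 0 => _ [m _ <-]; exact: entropy_incr_ge0].
have h_le n : h <= entropy_incr n by apply: ge_inf; [case: infh|exists n].
have [_ [r0 _ <-] r0P] := inf_adherent d0 infh; rewrite -/h in r0P.
exists (r0%:R * entropy_incr 0) => a b.
have -> : block_entropy a + block_entropy b - block_entropy (a + b) = \sum_(r < a) entropy_incr r - \sum_(r < a) entropy_incr (b + r).
  rewrite -block_entropy_sum; have := block_entropy_sum a 0; rewrite block_entropy0 addn0 subr0 => ->; ring.
rewrite -sumrB.
apply: (@le_trans _ _ (\sum_(r < a) ((r < r0)%:R * entropy_incr 0 + delta))).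
  apply: ler_sum => r _; case: ltnP => rr.
    have := entropy_incr_anti (leq0n r); have := entropy_incr_ge0 (b + r); rewrite mul1r; lra.
  have := entropy_incr_anti rr; have := h_le (b + r)%N; rewrite mul0r; lra.
rewrite big_split /= -mulr_suml sumr_const card_ord -[_ *+ a]mulr_natr lerD2r.
apply: ler_wpM2r; first exact: entropy_incr_ge0.
rewrite -natr_sum ler_nat; apply: leq_trans (count_lt_le _ _) _.
exact: geq_minr.
Qed.

End block_entropies.

Lemma entropy_blk_le (R : realType) (P : density R) (A : finType) (al : nat -> A) n :
  entropy P (blk al n) <= n%:R * entropy P al.
Proof.
elim: n => [|n IH]; first by rewrite [entropy _ _]block_entropy0 mul0r.
rewrite -addn1 natrD mulrDl mul1r.
apply: le_trans (block_entropy_cat _ _ _ _) (le_trans (entropy_pair_le _ _ _) _).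
rewrite lerD //; rewrite -(entropy_shift P al n).
apply: (@entropy_of _ _ _ _ _ _ (fun a => [tuple of [:: a]])) => t /=.
by apply: eq_from_tnth => i; rewrite tnth_mktuple ord1 addn0.
Qed.

Section names.
Variables (R : realType) (P : density R) (A : finType) (al : nat -> A).
Variable cs : nat -> nat -> bool.
Hypothesis cs_future : forall i, future al i (cs i).
Hypothesis cs_cauchy : forall eta : R, 0 < eta -> exists i0, forall i j,
  (i0 <= i)%N -> (i0 <= j)%N -> P (fun t => cs i t (+) cs j t) <= eta.

Lemma blk_of_future (c : nat -> bool) l (C : pred (l.-tuple A)) i n a b t :
  (forall t, c t = C (blk al l (t + i))) -> (a <= i)%N -> (i + n + l <= a + b)%N ->
  blk c n t = [tuple C (sub_blk al (i - a + r) l (blk al b (t + a))) | r < n].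
Proof.
move=> cE ai inb; apply: eq_from_tnth => r; rewrite !tnth_mktuple cE.
rewrite sub_blkE.
  by congr (C (blk al l _)); clear -ai; lia.
rewrite -(leq_add2l a) !addnA subnKC // (leq_trans _ inb) // leq_add2r leq_add2l.
exact: ltnW.
Qed.

(** The n-name of cs i0 is a function of the first a letters, that of cs j a
    function of the letters after them, so the two names share sublinear
    information by block_mi_sublinear. But cs i0 and cs j rarely differ:
    given the first name, little entropy is left for the second one. So the
    second name has small entropy. *)
Lemma name_entropy (delta : R) : 0 < delta -> exists n0, forall n, (n0 <= n)%N ->
  exists i1, forall j, (i1 <= j)%N -> entropy P (blk (cs j) n) <= delta * n%:R.
Proof.
move=> d0; pose s := delta / 12; have s0 : 0 < s by rewrite divr_gt0.
pose eta := Num.min (s ^+ 2) s.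
have eta0 : 0 < eta by rewrite lt_min s0 exprn_gt0.
have etaP : 2 * Num.sqrt eta + eta <= 3 * s.
  have : Num.sqrt eta <= s.
    apply: (@le_trans _ _ (Num.sqrt (s ^+ 2))).
      by rewrite ler_sqrt ?sqr_ge0 // /eta ge_min lexx.
    by rewrite sqrtr_sqr ger0_norm // ltW.
  have : eta <= s by rewrite /eta ge_min lexx orbT.
  lra.
have [i0 i0P] := cs_cauchy eta0.
have [l [C cE]] := cs_future i0.
have q0 : 0 < delta / 4 by rewrite divr_gt0.
have [K KP] := block_mi_sublinear P al q0.
pose k := (i0 + l)%N.
exists (Num.trunc ((K + delta / 4 * k%:R) / (delta / 4))).+1 => n n0.
have nP : K + delta / 4 * k%:R <= delta / 4 * n%:R.
  rewrite [leRHS]mulrC -ler_pdivrMr //; apply/ltW/(lt_le_trans (truncnS_gt _)).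
  by rewrite ler_nat.
pose a := (n + k)%N.
exists (i0 + a)%N => j ij.
have i0j : (i0 <= j)%N := leq_trans (leq_addr _ _) ij.
have aj : (a <= j)%N := leq_trans (leq_addl _ _) ij.
have [l' [C' cE']] := cs_future j.
pose b := (j + n + l')%N.
pose D t := cs i0 t (+) cs j t.
have hD : entropy P (blk D n) <= n%:R * (3 * s).
  apply: le_trans (entropy_blk_le _ _ _) _; rewrite ler_wpM2l //.
  by apply: le_trans etaP; apply: entropy_bool_le; exact: i0P.
(* The second name is the first one plus the name of the difference D. *)
have hpair : entropy P (fun t => (blk (cs i0) n t, blk (cs j) n t)) <=
    entropy P (blk (cs i0) n) + entropy P (blk D n).
  apply: le_trans (entropy_pair_le _ _ _).
  apply: (@entropy_of _ _ _ _ _ _ (fun w => (w.1, [tuple tnth w.1 r (+) tnth w.2 r | r < n]))) => t /=.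
  congr pair; apply: eq_from_tnth => r; rewrite !tnth_mktuple /D.
  by rewrite addbA addbb.
have hmi : mutual_info P (blk (cs i0) n) (blk (cs j) n) <= K + delta / 4 * a%:R.
  apply: le_trans (KP a b).
  pose f (x : a.-tuple A) := [tuple C (sub_blk al (i0 - 0 + r) l x) | r < n].
  pose g (x : b.-tuple A) := [tuple C' (sub_blk al (j - a + r) l' x) | r < n].
  have e1 : blk (cs i0) n = fun t => f (blk al a t).
    apply/funext => t; rewrite (@blk_of_future _ _ _ i0 n 0 a t cE) ?addn0 //.
    by rewrite add0n /a /k addnCA addnA.
  have e2 : blk (cs j) n = fun t => g (blk al b (t + a)).
    apply/funext => t; rewrite (@blk_of_future _ _ _ j n a b t cE') //.
    by rewrite /b leq_addl.
  rewrite e1 e2; apply: le_trans (mi_fun _ _ _ _ _) _.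
  rewrite /mutual_info (entropy_blk_at P al b a) -/(block_entropy P al a).
  by rewrite lerD2l lerN2 block_entropy_cat.
move: hmi; rewrite /mutual_info /a natrD => hmi.
have n_ge0 : 0 <= n%:R :> R by [].
have e3 : n%:R * (3 * s) = delta / 4 * n%:R by rewrite /s; field.
rewrite e3 in hD; have := mulr_ge0 (ltW d0) n_ge0; lra.
Qed.

Definition word (c : nat -> bool) (n t : nat) : seq bool := mkseq (fun i => c (t + i)%N) n.

Lemma val_blk (c : nat -> bool) n t : val (blk c n t) = word c n t.
Proof.
apply: (@eq_from_nth _ false) => [|i]; first by rewrite size_tuple size_mkseq.
by rewrite size_tuple => lin; rewrite nth_blk // nth_mkseq.
Qed.

(** A word of probability p contributes - p ln p to the entropy, so words of
    probability below exp (- delta n / 2) are rare; at most exp (delta n /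
    2) words remain. One set W serves all late cs j since they nearly agree
    with cs J. The divisor q makes it possible to choose lengths that divide
    one another. *)
Lemma typical_words (delta eta : R) (q : nat) : 0 < delta -> 0 < eta -> (0 < q)%N ->
  exists n (W : seq (seq bool)),
    [/\ (0 < n)%N, (q %| n)%N, (size W)%:R + 1 <= expR (delta * n%:R) &
     exists J, forall j, (J <= j)%N -> P (fun t => word (cs j) n t \notin W) <= eta].
Proof.
move=> d0 eta0 q0.
have [n0 n0P] := name_entropy (mulr_gt0 (divr_gt0 d0 (ltr0Sn R 1)) (divr_gt0 eta0 (ltr0Sn R 1))).
pose n := (q * (n0 + (Num.trunc (2 / delta)).+1))%N.
have n_ge : (n0 + (Num.trunc (2 / delta)).+1 <= n)%N by rewrite /n leq_pmull.
have n_gt0 : (0 < n)%N by rewrite (leq_trans _ n_ge) // addnS.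
have [i1 i1P] := n0P n (leq_trans (leq_addr _ _) n_ge).
have n_gt0' : 0 < n%:R :> R by rewrite ltr0n.
have [i2 i2P] := cs_cauchy (divr_gt0 (divr_gt0 eta0 (ltr0Sn R 1)) n_gt0').
pose J := (i1 + i2)%N; pose X := blk (cs J) n.
have HX : entropy P X <= delta / 2 * (eta / 2) * n%:R by apply: i1P; rewrite leq_addr.
pose p x := P (fun t => X t == x).
pose V := [pred x : n.-tuple bool | expR (- (delta / 2 * n%:R)) <= p x].
have dn : 2 <= delta * n%:R.
  rewrite [leRHS]mulrC -ler_pdivrMr //; apply/ltW/(lt_le_trans (truncnS_gt _)).
  by rewrite ler_nat (leq_trans (leq_addl _ _) n_ge).
have dn0 : 0 < delta / 2 * n%:R by rewrite mulr_gt0 // divr_gt0.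
have cardV : #|V|%:R <= expR (delta / 2 * n%:R).
  have : \sum_(x | V x) expR (- (delta / 2 * n%:R)) <= 1 :> R.
    apply: (@le_trans _ _ (\sum_(x | V x) p x)); first exact: ler_sum.
    rewrite -[leRHS](sum_P P X) [leRHS](bigID V) lerDl.
    by apply: sumr_ge0 => x _; exact: Pr_ge0.
  rewrite sumr_const -[_ *+ _]mulr_natl -ler_pdivlMr ?expR_gt0 //.
  by rewrite div1r -expRN opprK.
have PV : P (fun t => ~~ V (X t)) <= eta / 2.
  have pV : (delta / 2 * n%:R) * P (fun t => ~~ V (X t)) <= entropy P X.
    rewrite -(Ex_Pr P X (fun x => ~~ V x)) /Ex mulr_sumr /entropy -sumrN.
    apply: ler_sum => x _; rewrite -/(p x); case: (boolP (V x)) => /= Vx.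
      rewrite mul0r mulr0 oppr_ge0 mulr_ge0_le0 ?ln_le0 ?Pr_le1 //; exact: Pr_ge0.
    rewrite mul1r -mulrN mulrC.
    have [->|px] := eqVneq (p x) 0; first by rewrite !mul0r.
    have {}px : 0 < p x by rewrite lt_def px Pr_ge0.
    rewrite ler_pM2l // lerNr -[leRHS]expRK ler_ln ?posrE ?expR_gt0 //.
    by move: Vx; rewrite -ltNge => /ltW.
  have := le_trans pV HX.
  have -> : delta / 2 * (eta / 2) * n%:R = (delta / 2 * n%:R) * (eta / 2) by ring.
  by rewrite ler_pM2l.
exists n, [seq val x | x <- enum V]; split => //.
- by rewrite /n dvdn_mulr.
- rewrite size_map -cardE.
  have -> : delta * n%:R = delta / 2 * n%:R + delta / 2 * n%:R by field.
  rewrite expRD.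
  have : 2 <= expR (delta / 2 * n%:R) :> R.
    by apply: le_trans (expR_ge1Dx _); lra.
  set z := expR _ in cardV *; nra.
exists J => j Jj.
apply: (@le_trans _ _ (P (fun t => ~~ V (X t) || [exists r : 'I_n, (cs J (t + r) (+) cs j (t + r))]))).
  apply: Pr_le => t; case: (boolP (V (X t))) => //= VX.
  apply: contraR; rewrite negb_exists => /forallP h.
  have -> : word (cs j) n t = val (X t).
    rewrite val_blk; apply: (@eq_from_nth _ false) => [|i]; first by rewrite !size_mkseq.
    rewrite size_mkseq => lin; rewrite !nth_mkseq //.
    by have := h (Ordinal lin); case: (cs j _); case: (cs J _).
  by apply: map_f; rewrite mem_enum.
have le2 : P (fun t => [exists r : 'I_n, (cs J (t + r) (+) cs j (t + r))]) <= eta / 2.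
  apply: le_trans (Pr_union P (fun (r : 'I_n) t => cs J (t + r) (+) cs j (t + r))) _.
  apply: (@le_trans _ _ (\sum_(r < n) (eta / 2 / n%:R))).
    apply: ler_sum => r _; rewrite (Pr_shift P r (fun t => cs J t (+) cs j t)).
    by apply: i2P; [rewrite leq_addl|rewrite (leq_trans _ Jj) // leq_addl].
  by rewrite sumr_const card_ord -[_ *+ n]mulr_natr divfK // gt_eqF.
have := Pr_modular P (fun t => ~~ V (X t))
  (fun t => [exists r : 'I_n, (cs J (t + r) (+) cs j (t + r))]).
have := Pr_ge0 P (fun t => ~~ V (X t) && [exists r : 'I_n, (cs J (t + r) (+) cs j (t + r))]).
lra.
Qed.

End names.

(** * Erasing atypical blocks at all scales *)

Section masking.
Variables (n_ : nat -> nat) (W_ : nat -> seq (seq bool)).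
Hypothesis n_gt0 : forall i, (0 < n_ i)%N.
Hypothesis n_dvd1 : forall i, (n_ i %| n_ i.+1)%N.

Lemma n_dvd i j : (i <= j)%N -> (n_ i %| n_ j)%N.
Proof.
elim: j => [|j IH]; first by rewrite leqn0 => /eqP ->.
rewrite leq_eqVlt => /orP[/eqP -> //|/IH h]; exact: dvdn_trans (n_dvd1 j).
Qed.

Lemma word_sub c n t o m : (o + m <= n)%N -> take m (drop o (word c n t)) = word c m (t + o).
Proof.
move=> omn; apply: (@eq_from_nth _ false).
  by rewrite size_takel ?size_drop !size_mkseq //; lia.
move=> i; rewrite size_takel ?size_drop ?size_mkseq; last by lia.
by move=> im; rewrite nth_take // nth_drop !nth_mkseq ?addnA //; lia.
Qed.

(** The effect on a block of length n_ i of erasing the bad blocks of the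
    scales below i; it depends only on the word of the block. *)
Definition mask (i : nat) (w : seq bool) : seq bool :=
  mkseq (fun s => nth false w s &&
    all (fun j => take (n_ j) (drop (s %/ n_ j * n_ j) w) \in W_ j) (iota 0 i)) (n_ i).

Definition masked_words (i : nat) : seq (seq bool) :=
  nseq (n_ i) false :: map (mask i) (W_ i).

Definition good (c : nat -> bool) i t : bool := word c (n_ i) (t %/ n_ i * n_ i) \in W_ i.

Definition masked (c : nat -> bool) k t : bool :=
  c t && all (fun i => good c i t) (iota 0 k.+1).

(** A block of scale i lies inside one block of each coarser scale, which
    either erases it completely or leaves it alone; the finer scales act by
    mask. *)
Lemma masked_block c k i r : (i <= k)%N ->
  word (masked c k) (n_ i) (r * n_ i) \in masked_words i.
Proof.
move=> ik; set b := (r * n_ i)%N.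
have coarse j s : (i <= j)%N -> (s < n_ i)%N -> good c j (b + s) = good c j b.
  move=> ij si; rewrite /good; have /dvdnP[d ->] := n_dvd ij.
  by rewrite (mulnC d) !divnMA /b divnMDl // (divn_small si) addn0 mulnK.
have fine j s : (j < i)%N -> (s < n_ i)%N ->
    good c j (b + s) = (take (n_ j) (drop (s %/ n_ j * n_ j) (word c (n_ i) b)) \in W_ j).
  move=> ji si; have /dvdnP[d dE] := n_dvd (ltnW ji).
  rewrite word_sub; last first.
    rewrite -mulSnr dE leq_mul2r ltn_divLR // -dE si; exact: orbT.
  by rewrite /good /b dE mulnA divnMDl // mulnDl.
rewrite in_cons; case: (boolP (all (fun j => good c j b) (iota i (k.+1 - i)))) => hall.
  apply/orP; right; apply/mapP; exists (word c (n_ i) b).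
    have /allP/(_ i) := hall; rewrite mem_iota leqnn subnKC ?ltnS ?ik ?leqW // => /(_ isT).
    by rewrite /good /b mulnK.
  apply: (@eq_from_nth _ false) => [|s]; rewrite !size_mkseq // => si.
  rewrite !nth_mkseq // /masked; congr (_ && _).
  have -> : iota 0 k.+1 = iota 0 i ++ iota i (k.+1 - i).
    by have := iotaD 0 i (k.+1 - i); rewrite add0n subnKC // leqW.
  rewrite all_cat -[RHS]andbT; congr (_ && _).
    by apply: eq_in_all => j; rewrite mem_iota add0n => /= ji; exact: fine.
  rewrite -{}hall; apply: eq_in_all => j; rewrite mem_iota => /andP[ij _].
  exact: coarse.
apply/orP; left; apply/eqP.
apply: (@eq_from_nth _ false) => [|s]; first by rewrite size_mkseq size_nseq.
rewrite size_mkseq => si; rewrite nth_mkseq // nth_nseq si /masked.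
apply/negP => /andP[_ /allP h]; move/negP: hall; apply.
apply/allP => j; rewrite mem_iota => /andP[ij jk].
rewrite -(coarse _ s) //; apply: h; rewrite mem_iota /=; lia.
Qed.

Variables (R : realType) (P : density R).

(** As phi runs over a multiple of n consecutive phases, the position of t
    in its block takes each value equally often. *)
Lemma bad_phase_sum (bad : nat -> bool) n K : (0 < n)%N -> (n %| K)%N ->
  \sum_(phi < K) P (fun t => bad (t + K - (t + phi) %% n)%N) <= K%:R * P bad.
Proof.
move=> n0 /dvdnP[d ->].
pose f (x : 'I_d * 'I_n) t := bad (t + d * n - x.2)%N.
have fE x : P (f x) = P bad.
  have d0 : (0 < d)%N by apply: leq_ltn_trans (ltn_ord x.1).
  rewrite -(Pr_shift P (d * n - x.2) bad); apply: Pr_ext => t; rewrite /f addnBA //.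
  by apply: (leq_trans (ltnW (ltn_ord x.2))); rewrite leq_pmull.
have -> : (d * n)%:R * P bad = \sum_x P (f x).
  by rewrite (eq_bigr _ (fun x _ => fE x)) sumr_const card_prod !card_ord mulr_natl.
apply: Pr_double_count => t.
have lt1 (phi : 'I_(d * n)) : (phi %/ n < d)%N by rewrite ltn_divLR.
have lt2 (phi : 'I_(d * n)) : ((t + phi) %% n < n)%N by rewrite ltn_mod.
pose h (phi : 'I_(d * n)) : 'I_d * 'I_n := (Ordinal (lt1 phi), Ordinal (lt2 phi)).
have hi : injective h.
  move=> x y [e1 /eqP e2]; apply/val_inj => /=.
  rewrite eqn_modDl in e2.
  by rewrite (divn_eq x n) (divn_eq y n) e1 (eqP e2).
rewrite -(fintype.card_image hi); apply/subset_leq_card/fintype.subsetP => y /fintype.imageP[phi hphi ->].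
by rewrite inE /f /=; move: hphi; rewrite inE.
Qed.

(** Averaged over the phases, the probability that t lies in a bad block of
    scale i is that of a bad word of scale i; some phase does at least as
    well as the average. *)
Lemma exists_phase (c : nat -> bool) k (eta : nat -> R) :
  (forall i, (i <= k)%N -> P (fun t => word c (n_ i) t \notin W_ i) <= eta i) ->
  exists phi, (phi < n_ k)%N /\
    P (fun t => c t (+) masked (fun s => c (s - phi)%N) k (t + phi)) <=
      \sum_(i < k.+1) eta i.
Proof.
move=> hbad; set K := n_ k.
pose bad i t := word c (n_ i) t \notin W_ i.
pose g (i : 'I_k.+1) phi t := ~~ good (fun s => c (s - phi)%N) i (t + phi).
have ik (i : 'I_k.+1) : (i <= k)%N by rewrite -ltnS.
have gE i phi : P (g i phi) = P (fun t => bad i (t + K - (t + phi) %% n_ i)%N).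
  rewrite -(Pr_shift P K); apply: Pr_ext => t; rewrite /g /good /bad.
  have dvd := n_dvd (ik i); have nK : (n_ i <= K)%N by apply: dvdn_leq => //; exact: n_gt0.
  suff -> : word (fun s => c (s - phi)%N) (n_ i) ((t + K + phi) %/ n_ i * n_ i) =
      word c (n_ i) (t + K - (t + phi) %% n_ i) by [].
  apply: (@eq_from_nth _ false); rewrite !size_mkseq // => s si.
  rewrite !nth_mkseq //; congr c.
  have e : (t + K + phi = (t + K + phi) %/ n_ i * n_ i + (t + phi) %% n_ i)%N.
    rewrite {1}(divn_eq (t + K + phi) (n_ i)); congr (_ + _)%N.
    by rewrite addnAC -modnDmr (eqP dvd) addn0.
  have := ltn_pmod (t + phi) (n_gt0 i).
  move: e; set x := (_ * n_ i)%N; set y := (_ %% _)%N; clear -nK; lia.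
have hsum : \sum_(phi < K) \sum_i P (g i phi) <= K%:R * \sum_(i < k.+1) eta i.
  rewrite exchange_big mulr_sumr; apply: ler_sum => i _ /=.
  under eq_bigr do rewrite gE.
  apply: le_trans (bad_phase_sum (bad i) (n_gt0 i) (n_dvd (ik i))) _.
  by rewrite ler_wpM2l // hbad.
have [phi hphi] : exists phi : 'I_K, \sum_i P (g i phi) <= \sum_(i < k.+1) eta i.
  apply: contrapT => /forallNP h.
  have : \sum_(phi < K) \sum_(i < k.+1) eta i < \sum_(phi < K) \sum_i P (g i phi).
    apply: ltr_sum => [|phi _]; last by rewrite ltNge; apply/negP; exact: h.
    by apply/hasP; exists (Ordinal (n_gt0 k)); rewrite // mem_index_enum.
  by rewrite sumr_const card_ord -[_ *+ K]mulr_natl ltNge hsum.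
exists phi; split => //.
apply: le_trans hphi; apply: le_trans (Pr_union P _).
apply: Pr_le => t; rewrite /masked addnK; case: (c t) => //.
rewrite addTb andTb; apply: contraR; rewrite negb_exists => /forallP h.
apply/allP => i; rewrite mem_iota add0n => /andP[_ ik1].
by have := h (Ordinal ik1); rewrite /g negbK.
Qed.

End masking.

(** * Sequences with few words *)

Section few_words.

Fixpoint words (M : seq (seq bool)) (k : nat) : seq (seq bool) :=
  if k is k'.+1 then [seq x ++ w | x <- M, w <- words M k'] else [:: [::]].

Lemma size_words M k : size (words M k) = (size M ^ k)%N.
Proof. by elim: k => //= k IH; rewrite size_allpairs IH expnS. Qed.

Lemma word_cat c m n t : word c (m + n) t = word c m t ++ word c n (t + m).
Proof.
rewrite /word /mkseq iotaD map_cat; congr (_ ++ _).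
rewrite add0n -{1}[m]addn0 iotaDl -map_comp; apply: eq_map => i /=.
by rewrite addnA.
Qed.

Lemma words_blocks (Z : nat -> bool) n M q k :
  (forall r, word Z n (r * n) \in M) -> word Z (k * n) (q * n) \in words M k.
Proof.
move=> ZM; elim: k q => [|k IH] q //=.
rewrite mulSn word_cat; apply/allpairsP.
exists (word Z n (q * n), word Z (k * n) (q.+1 * n)); split => //=.
by rewrite mulSnr.
Qed.

Definition built_from (n : nat) (M : seq (seq bool)) (Y : nat -> bool) : Prop :=
  exists phi (Z : nat -> bool),
    (forall t, Y t = Z (t + phi)%N) /\ forall r, word Z n (r * n) \in M.

(** A window of length k n of a concatenation of blocks of length n lies
    within k.+1 consecutive blocks; o is its offset in the first one. *)
Definition cover (n : nat) (M : seq (seq bool)) (k : nat) : seq (seq bool) :=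
  [seq take (k * n) (drop o w) | o <- iota 0 n, w <- words M k.+1].

Lemma size_cover n M k : size (cover n M k) = (n * size M ^ k.+1)%N.
Proof. by rewrite size_allpairs size_iota size_words. Qed.

Lemma built_from_cover n M Y k t : (0 < n)%N -> built_from n M Y ->
  word Y (k * n) t \in cover n M k.
Proof.
move=> n0 [phi [Z [YZ ZM]]]; apply/allpairsP.
exists ((t + phi) %% n, word Z (k.+1 * n) ((t + phi) %/ n * n))%N; split => /=.
- by rewrite mem_iota add0n ltn_mod.
- exact: words_blocks.
have lt := ltn_pmod (t + phi) n0.
rewrite word_sub -?divn_eq; last by rewrite mulSn leq_add2r ltnW.
by apply: eq_map => i; rewrite YZ addnAC.
Qed.

Lemma exp_beats_linear (R : realType) (K x : R) : 0 < x -> 0 <= K ->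
  exists r : nat, (0 < r)%N /\ K * (r%:R + 1) <= expR (x * r%:R).
Proof.
move=> x0 K0; exists (Num.trunc (8 * K / x ^+ 2)).+1; split => //.
set r := (Num.trunc _).+1.
have hr : 8 * K <= r%:R * x ^+ 2.
  by rewrite -ler_pdivrMr ?exprn_gt0 //; apply/ltW/truncnS_gt.
have r1 : 1 <= r%:R :> R by rewrite ler1n.
have e1 : 1 + x * r%:R / 2 <= expR (x * r%:R / 2) by exact: expR_ge1Dx.
have -> : x * r%:R = x * r%:R / 2 + x * r%:R / 2 by field.
rewrite expRD.
have h : (x * r%:R / 2) * (x * r%:R / 2) <= expR (x * r%:R / 2) * expR (x * r%:R / 2).
  have p0 : 0 <= x * r%:R / 2 by rewrite divr_ge0 // mulr_ge0 // ltW.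
  by apply: ler_pM => //; apply: le_trans e1; rewrite lerDr.
apply: le_trans h.
have -> : x * r%:R / 2 * (x * r%:R / 2) = (r%:R * x ^+ 2) * r%:R / 4 by field.
apply: (@le_trans _ _ (8 * K * r%:R / 4)).
  have -> : 8 * K * r%:R / 4 = K * (r%:R + r%:R) by field.
  by rewrite ler_wpM2l // lerD2l.
by rewrite ler_pM2r ?invr_gt0 // ler_wpM2r.
Qed.

Definition ext_int (y : nat -> bool) (a : int) : bool :=
  if a is Posz t then y t else false.

Definition wordz (x : int -> bool) (n : nat) (a : int) : seq bool :=
  mkseq (fun i => x (a + i%:Z)) n.

End few_words.

Section concatenation.
Variable R : realType.
Variables (N : nat -> nat) (Y : nat -> nat -> bool).
Variables (n_ : nat -> nat) (M_ : nat -> seq (seq bool)).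
Hypothesis n_gt0 : forall i, (0 < n_ i)%N.
Hypothesis N_grow : forall j, (2 * (N j).+1 <= N j.+1)%N.
Hypothesis Y_built : forall i j, (i <= j)%N -> built_from (n_ i) (M_ i) (Y j).
Hypothesis size_M : forall i, (size (M_ i))%:R <= expR (i.+1%:R^-1 * (n_ i)%:R) :> R.

Lemma N_incr i j : (i <= j)%N -> (N i <= N j)%N.
Proof.
elim: j => [|j IH]; first by rewrite leqn0 => /eqP ->.
rewrite leq_eqVlt => /orP[/eqP -> //|/IH h].
by apply: leq_trans h _; have := N_grow j; lia.
Qed.

Lemma N_unbounded t : exists j, (t <= N j)%N.
Proof.
exists t; elim: t => // t IH; have := N_grow t; lia.
Qed.

Definition stage (t : nat) : nat := ex_minn (N_unbounded t).

Lemma stageP t j : (forall i, (i < j)%N -> (N i < t)%N) -> (t <= N j)%N -> stage t = j.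
Proof.
move=> h tj; rewrite /stage; case: ex_minnP => m tm mmin.
apply/eqP; rewrite eqn_leq mmin //= leqNgt; apply/negP => /h; lia.
Qed.

Lemma stage_le t : (t <= N (stage t))%N.
Proof. by rewrite /stage; case: ex_minnP. Qed.

Lemma stage_gt t i : (i < stage t)%N -> (N i < t)%N.
Proof.
rewrite /stage; case: ex_minnP => m tm mmin im; rewrite ltnNge; apply/negP => /mmin; lia.
Qed.

(** The term Y j is used on the interval of integers t with N (j - 1) < t <=
    N j. *)
Definition glued (t : nat) : bool := (0 < t)%N && Y (stage t) t.

(** The lengths N grow so fast that a window of length l that starts at or
    after l meets at most two stages. *)
Lemma glued_window t l : (0 < t)%N -> (l <= t)%N ->
  exists p, (p <= l)%N /\
    word glued l t = take p (word (Y (stage t)) l t) ++ drop p (word (Y (stage t).+1) l t).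
Proof.
move=> t0 lt; set j := stage t.
exists (minn l (N j - t).+1); split; first exact: geq_minl.
have tN : (t <= N j)%N := stage_le t.
have st i : (i < l)%N -> stage (t + i) = if (i < (N j - t).+1)%N then j else j.+1.
  move=> il; case: ifP => hi; apply: stageP.
  - by move=> k kj; have := stage_gt kj; lia.
  - lia.
  - by move=> k kj; have := N_incr (kj : (k <= j)%N); lia.
  - have := N_grow j; lia.
apply: (@eq_from_nth _ false).
  by rewrite size_cat size_takel ?size_drop !size_mkseq ?geq_minl // subnKC // geq_minl.
move=> i; rewrite size_mkseq => il; rewrite nth_mkseq // nth_cat size_takel ?size_mkseq ?geq_minl //.
rewrite leq_min il /= /glued st // addn_gt0 t0 /=; case: ifP => hi.
  by rewrite nth_take ?leq_min ?il // nth_mkseq.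
have -> : minn l (N j - t).+1 = (N j - t).+1 by apply/minn_idPr; lia.
by rewrite nth_drop nth_mkseq subnKC //; lia.
Qed.

(** From stage i on, both parts of a window are parts of windows built from
    M_ i, which cover counts; their number grows at rate 2 ln (size M_ i) /
    n_ i, at most delta / 4 for the chosen i. The remaining windows start
    before N i + l or lie to the left of 0, and their number is linear in l.
    *)
Lemma glued_few_words (delta : R) : 0 < delta ->
  exists l (W : seq (seq bool)), [/\ (0 < l)%N, (size W)%:R <= expR (delta * l%:R) &
    forall a, wordz (ext_int glued) l a \in W].
Proof.
move=> d0; pose i := Num.trunc (8 / delta).
have iP : i.+1%:R^-1 <= delta / 8 :> R.
  rewrite invf_ple ?posrE ?ltr0n ?divr_gt0 // invf_div.
  exact/ltW/truncnS_gt.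
pose n := n_ i; pose M := M_ i.
have n0 : 0 < n%:R :> R by rewrite ltr0n n_gt0.
pose K : R := (2 * N i + 3 + 4 * n)%N%:R + (n + 1)%N%:R * n%:R ^+ 2 * (size M)%:R ^+ 2.
have K0 : 0 <= K by rewrite addr_ge0 // !mulr_ge0 // ?exprn_ge0.
have [k [k0 kP]] := exp_beats_linear (mulr_gt0 n0 (divr_gt0 d0 (ltr0Sn R 1))) K0.
pose l := (k * n)%N; pose c := cover n M k.
pose T1 := (N i + l).+1.
exists l, (nseq l false :: [seq wordz (ext_int glued) l (s%:Z - l%:Z) | s <- iota 0 (T1 + l)] ++
  [seq take p w.1 ++ drop p w.2 | p <- iota 0 l.+1, w <- [seq (w1, w2) | w1 <- c, w2 <- c]]).
have l0 : (0 < l)%N by rewrite muln_gt0 k0 n_gt0.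
split => //; last first.
  move=> a; rewrite in_cons mem_cat.
  have [al|la] := ltP a (- l%:Z).
    apply/orP; left; apply/eqP; apply: (@eq_from_nth _ false).
      by rewrite size_mkseq size_nseq.
    rewrite size_mkseq => s sl; rewrite nth_mkseq // nth_nseq sl.
    have : a + s%:Z < 0 by clear -al sl; lia.
    by case: (a + s%:Z).
  apply/orP; right; apply/orP.
  have [aT|Ta] := ltP a T1%:Z.
    left; apply/mapP; exists (absz (a + l%:Z)); last first.
      by congr wordz; clear -la; lia.
    by rewrite mem_iota; clear -la aT; lia.
  right; pose t := absz a.
  have ta : a = t%:Z by clear -Ta; rewrite /t; lia.
  have tT : (T1 <= t)%N by clear -Ta ta; lia.
  have -> : wordz (ext_int glued) l a = word glued l t.
    by rewrite ta.
  have t0 : (0 < t)%N by apply: leq_trans tT.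
  have lt : (l <= t)%N by apply: leq_trans tT; rewrite /T1; clear; lia.
  have [p [pl ->]] := glued_window t0 lt.
  have ist : (i <= stage t)%N.
    rewrite leqNgt; apply/negP => sti; have := stage_le t.
    have := N_incr (ltnW sti); move: tT; rewrite /T1; clear; lia.
  apply/allpairsP; exists (p, (word (Y (stage t)) l t, word (Y (stage t).+1) l t)); split => //=.
    by rewrite -[_ :: _]/(iota 0 l.+1) mem_iota add0n ltnS.
  apply/allpairsP; exists (word (Y (stage t)) l t, word (Y (stage t).+1) l t); split => //=.
    by apply: built_from_cover; [exact: n_gt0|exact: Y_built].
  by apply: built_from_cover; [exact: n_gt0|apply: Y_built; exact: leqW].
rewrite -cat1s size_cat [size [:: _]]/= add1n size_cat size_map size_iota size_allpairs size_iota.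
rewrite size_allpairs size_cover.
set m := size M in K K0 kP *.
pose X := expR (n%:R * (delta / 2) * k%:R).
have X1 : 1 <= X by rewrite -expR0 ler_expR !mulr_ge0 // ?divr_ge0 // ltW.
have mk : (m%:R ^+ (2 * k) : R) <= X.
  have mm : m%:R <= expR (delta / 8 * n%:R) :> R.
    apply: le_trans (size_M i) _; rewrite ler_expR ler_wpM2r //; exact: ltW.
  apply: (@le_trans _ _ (expR (delta / 8 * n%:R) ^+ (2 * k))).
    by rewrite lerXn2r // ?nnegrE ?expR_ge0.
  rewrite -expRM_natl ler_expR natrM.
  have -> : n%:R * (delta / 2) * k%:R = 4 * (delta / 8 * n%:R * k%:R) by field.
  have -> : 2%:R * k%:R * (delta / 8 * n%:R) = 2 * (delta / 8 * n%:R * k%:R) by ring.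
  by rewrite ler_wpM2r ?ler_nat // !mulr_ge0 // ?divr_ge0 // ltW.
have -> : delta * l%:R = n%:R * (delta / 2) * k%:R + n%:R * (delta / 2) * k%:R.
  by rewrite /l natrM; field.
rewrite expRD; apply: (@le_trans _ _ (K * (k%:R + 1) * X)); last by rewrite ler_wpM2r // expR_ge0.
have -> : (T1 + l + l.+1 * (n * m ^ k.+1 * (n * m ^ k.+1))).+1%:R =
   (N i + 2 + 2 * (k * n))%N%:R + (k%:R * n%:R + 1) * n%:R ^+ 2 * m%:R ^+ 2 * m%:R ^+ (2 * k) :> R.
  have -> : (T1 + l + l.+1 * (n * m ^ k.+1 * (n * m ^ k.+1))).+1 =
    ((N i + 2 + 2 * (k * n)) + (k * n + 1) * n ^ 2 * m ^ 2 * m ^ (2 * k))%N.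
    rewrite /T1 /l (mulnC 2 k) expnM [(m ^ k.+1)%N]expnS; set z := (m ^ k)%N.
    by rewrite -!mulnn -addn1; clear; lia.
  by rewrite [LHS]natrD; congr (_ + _); rewrite !natrM !natrX natrD natrM.
apply: (@le_trans _ _ ((2 * N i + 3 + 4 * n)%N%:R * (k%:R + 1) * X +
   ((n + 1)%N%:R * (k%:R + 1)) * n%:R ^+ 2 * m%:R ^+ 2 * X)); last first.
  by rewrite le_eqVlt; apply/orP; left; apply/eqP; rewrite /K; ring.
apply: lerD.
  apply: (@le_trans _ _ ((2 * N i + 3 + 4 * n)%N%:R * (k%:R + 1))); last first.
    by rewrite ler_peMr // mulr_ge0.
  by rewrite -[1]/(1%:R) -natrD -natrM ler_nat; clear; nia.
apply: ler_pM => //; rewrite ?mulr_ge0 ?addr_ge0 ?exprn_ge0 ?mulr_ge0 //.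
rewrite ler_wpM2r ?exprn_ge0 // ler_wpM2r ?exprn_ge0 //.
rewrite natrD -subr_ge0.
have -> : (n%:R + 1%:R) * (k%:R + 1) - (k%:R * n%:R + 1) = n%:R + k%:R :> R by ring.
by rewrite addr_ge0.
Qed.

End concatenation.

(** * A sequence of zero entropy correlated with a tail-dependent process *)

Section correlated_sequence.
Variable R : realType.

Lemma av_eq_after (F G : nat -> R) (L : R) m N : (0 < N)%N ->
  (forall t, (0 < t)%N -> `|F t| <= L) -> (forall t, (0 < t)%N -> `|G t| <= L) ->
  (forall t, (m < t <= N)%N -> F t = G t) ->
  `|av F N - av G N| <= 2 * L * m%:R / N%:R.
Proof.
move=> N0 FL GL FG; rewrite /av -mulrBr normrM ger0_norm ?invr_ge0 // mulrC.
rewrite ler_wpM2r ?invr_ge0 // -sumrB.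
apply: le_trans (ler_norm_sum _ _ _) _.
apply: (@le_trans _ _ (\sum_(1 <= n < N.+1) 2 * L * (n.-1 < m)%N%:R)).
  rewrite !big_nat; apply: ler_sum => n /andP[n0 nN].
  have [nm|mn] := ltnP n.-1 m.
    rewrite mulr1; apply: le_trans (ler_normB _ _) _.
    by have := FL n n0; have := GL n n0; lra.
  have -> : F n = G n.
    apply: FG; apply/andP; split; last by rewrite -ltnS.
    by move: mn n0; clear; case: n => //= n; rewrite ltnS.
  by rewrite subrr normr0 mulr0.
have L0 : 0 <= L by apply: le_trans (FL 1%N isT).
rewrite -mulr_sumr ler_wpM2l ?mulr_ge0 // big_add1 big_mkord /= -natr_sum ler_nat.
by apply: leq_trans (count_lt_le _ _) _; exact: geq_minr.
Qed.

Lemma sum_geom_le (s : R) k : 0 <= s -> \sum_(i < k) s * 2^-1 ^+ i.+1 <= s.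
Proof.
move=> s0.
suff -> : \sum_(i < k) s * 2^-1 ^+ i.+1 = s - s * 2^-1 ^+ k.
  by rewrite lerBlDr lerDl mulr_ge0 // exprn_ge0.
elim: k => [|k IH]; first by rewrite big_ord0 expr0 mulr1 subrr.
by rewrite big_ord_recr /= IH !exprS; field.
Qed.

Lemma corr_diff (P : density R) (A : finType) (al : nat -> A) (v : A -> R) (L : R)
    (c d : nat -> bool) : (forall a, `|v a| <= L) ->
  corr P al v c - L * P (fun t => c t (+) d t) <= corr P al v d.
Proof.
move=> vL.
have e (f : bool -> bool -> bool) : corr P al v (fun t => f (c t) (d t)) =
    Ex P (fun t => (al t, (c t, d t))) (fun w => v w.1 * (f w.2.1 w.2.2)%:R).
  exact: (Ex_comp P (fun t => (al t, (c t, d t))) (fun w => (w.1, f w.2.1 w.2.2))).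
rewrite (e (fun x _ => x)) (e (fun _ y => y)).
have -> : P (fun t => c t (+) d t) =
    Ex P (fun t => (al t, (c t, d t))) (fun w => (w.2.1 (+) w.2.2)%:R).
  by rewrite (Ex_Pr P (fun t => (al t, (c t, d t))) (fun w => w.2.1 (+) w.2.2)).
rewrite /Ex mulr_sumr -sumrB; apply: ler_sum => -[a [x y]] _ /=.
rewrite mulrA -mulrBl ler_wpM2r ?Pr_ge0 //.
have := vL a; rewrite ler_norml => /andP[? ?].
by case: x; case: y => /=; lra.
Qed.

Variables (N_ : nat -> nat) (U : set_system nat) (UU : UltraFilter U).
Hypothesis N_oo : forall m, \forall k \near U, (m <= N_ k)%N.
Let P : density R := ultra_density R UU N_oo.
Variables (A : finType) (al : nat -> A) (v : A -> R) (L s0 : R).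
Hypothesis vL : forall a, `|v a| <= L.
Hypothesis s0_gt0 : 0 < s0.

(** The scales are chosen one after the other, each length being a multiple
    of the preceding one. The probabilities eta i of bad words sum to at
    most s1, so masking at the scales up to j lowers the correlation by at
    most L s1 <= s0 / 4, whatever j is. *)
Lemma tail_scales :
  (forall m, exists2 c, future al m c & s0 <= corr P al v c) ->
  exists (n_ : nat -> nat) (M_ : nat -> seq (seq bool)) (Y : nat -> nat -> bool),
    [/\ forall i, (0 < n_ i)%N,
        forall i, (size (M_ i))%:R <= expR (i.+1%:R^-1 * (n_ i)%:R) :> R,
        forall i j, (i <= j)%N -> built_from (n_ i) (M_ i) (Y j) &
        forall j, s0 / 4 <= corr P al v (Y j)].
Proof.
move=> hex; have [cs [cs_fut cs_Ev cs_cauchy]] := tail_events vL s0_gt0 hex.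
have L0 : 0 <= L by apply: le_trans (vL (al 0%N)).
pose s1 := s0 / (4 * (L + 1)).
have s1_gt0 : 0 < s1 by rewrite divr_gt0 // mulr_gt0 // ltr_wpDl.
pose eta i : R := s1 * 2^-1 ^+ i.+1.
have eta_gt0 i : 0 < eta i by rewrite mulr_gt0 // exprn_gt0.
have /choice [F FP] : forall iq : nat * nat, exists nw : nat * seq (seq bool),
    (0 < iq.2)%N -> [/\ (0 < nw.1)%N, (iq.2 %| nw.1)%N,
      (size nw.2)%:R + 1 <= expR (iq.1.+1%:R^-1 * nw.1%:R) :> R &
      exists J, forall j, (J <= j)%N -> P (fun t => word (cs j) nw.1 t \notin nw.2) <= eta iq.1].
  move=> [i q] /=; have [->|q0] := posnP q; first by exists (0%N, [::]).
  have d0 : 0 < i.+1%:R^-1 :> R by rewrite invr_gt0.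
  have [n [W h]] := typical_words cs_fut cs_cauchy d0 (eta_gt0 i) q0.
  by exists (n, W).
pose sc := fix sc i := if i is i'.+1 then F (i, (sc i').1) else F (0%N, 1%N).
have sc_gt0 i : (0 < (sc i).1)%N.
  by elim: i => [|i IH]; [have [] := FP (0, 1)%N isT|have [] := FP (i.+1, (sc i).1) IH].
have sc_dvd i : ((sc i).1 %| (sc i.+1).1)%N.
  by have [] := FP (i.+1, (sc i).1) (sc_gt0 i).
have sc_size i : (size (sc i).2)%:R + 1 <= expR (i.+1%:R^-1 * (sc i).1%:R) :> R.
  by case: i => [|i]; [have [] := FP (0, 1)%N isT|have [] := FP (i.+1, (sc i).1) (sc_gt0 i)].
have /choice [J JP] : forall i, exists J, forall j, (J <= j)%N ->
    P (fun t => word (cs j) (sc i).1 t \notin (sc i).2) <= eta i.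
  by case=> [|i]; [have [] := FP (0, 1)%N isT|have [] := FP (i.+1, (sc i).1) (sc_gt0 i)].
pose n_ i := (sc i).1; pose W_ i := (sc i).2.
pose c j := cs (\max_(i < j.+1) J i).
have hbad j i : (i <= j)%N -> P (fun t => word (c j) (n_ i) t \notin W_ i) <= eta i.
  move=> ij; apply: JP; have ij' : (i < j.+1)%N by [].
  exact: (leq_bigmax (Ordinal ij')).
have /choice [phi phiP] : forall j, exists phi,
    P (fun t => c j t (+) masked n_ W_ (fun s => c j (s - phi)%N) j (t + phi)) <= s1.
  move=> j; have [phi [_ h]] := exists_phase sc_gt0 sc_dvd (hbad j).
  exists phi; apply: le_trans h _; apply: sum_geom_le; exact: ltW.
exists n_, (masked_words n_ W_),
  (fun j t => masked n_ W_ (fun s => c j (s - phi j)%N) j (t + phi j)).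
split => //.
- move=> i; rewrite /masked_words [size _]/= size_map -[(size (W_ i)).+1]addn1 natrD.
  exact: sc_size.
- move=> i j ij; exists (phi j), (masked n_ W_ (fun s => c j (s - phi j)%N) j).
  by split => // r; exact: masked_block.
move=> j; apply: le_trans (corr_diff P al (c j) _ vL).
have : L * P (fun t => c j t (+) masked n_ W_ (fun s => c j (s - phi j)%N) j (t + phi j)) <= s0 / 4.
  apply: (@le_trans _ _ ((L + 1) * s1)).
    by rewrite ler_pM ?Pr_ge0 // lerDl.
  by rewrite /s1 le_eqVlt; apply/orP; left; apply/eqP; field; rewrite gt_eqF // ltr_wpDl.
have := cs_Ev (\max_(i < j.+1) J i); rewrite -/(c j); lra.
Qed.

(** Each Y j of tail_scales is correlated with v in the limit, hence over
    arbitrarily long intervals [1, N_ k]. Such intervals are chosen so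
    sparse that in the average over the j-th one the times before it are
    negligible; the sequence that follows Y j there keeps half of the
    correlation. *)
Lemma correlated_sequence :
  (forall m, exists2 c, future al m c & s0 <= corr P al v c) ->
  exists y : nat -> bool,
    (forall delta : R, 0 < delta -> exists l (W : seq (seq bool)),
      [/\ (0 < l)%N, (size W)%:R <= expR (delta * l%:R) &
        forall a, wordz (ext_int y) l a \in W]) /\
    forall K, exists k, (K <= N_ k)%N /\
      s0 / 16 <= av (fun t => v (al t) * (y t)%:R) (N_ k).
Proof.
move=> /tail_scales[n_ [M_ [Y [n_gt0 size_M Y_built Y_Ev]]]].
have L0 : 0 <= L by apply: le_trans (vL (al 0%N)).
have bd (c : nat -> bool) t : `|v (al t) * (c t)%:R| <= L.
  by case: (c t); rewrite ?mulr1 ?mulr0 ?normr0.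
have /choice [pk pkP] : forall jm : nat * nat, exists k, (jm.2 <= N_ k)%N /\
    s0 / 8 <= av (fun t => v (al t) * (Y jm.1 t)%:R) (N_ k).
  move=> [j m] /=.
  have h := @ultra_Ex_cvg R N_ U UU N_oo _ (fun t => (al t, Y j t)) (fun w => v w.1 * w.2%:R).
  have lt : s0 / 8 < corr P al v (Y j) by apply: lt_le_trans (Y_Ev j); rewrite ltr_pM2l // ltf_pV2 ?posrE // ltr_nat.
  have := cvgr_gt _ h _ lt; move=> hgt.
  have [k [h1 h2]] := filter_ex (filterI (N_oo m) (hgt (@filter_filter _ _ (@ultra_proper _ _ UU)))).
  by exists k; split => //; exact: ltW.
(* The factor C makes the times before stage j contribute at most s0 / 16. *)
pose C := (Num.trunc (32 * L / s0)).+2.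
pose NN := fix NN j := if j is j'.+1 then N_ (pk (j, C * (NN j').+1)%N) else N_ (pk (0, 1)%N).
have NN_step j : (C * (NN j).+1 <= NN j.+1)%N by have [] := pkP (j.+1, C * (NN j).+1)%N.
have NN_grow j : (2 * (NN j).+1 <= NN j.+1)%N.
  by apply: leq_trans (NN_step j); rewrite leq_mul2r.
exists (glued Y NN_grow); split.
  by move=> d d0; exact: (glued_few_words n_gt0 NN_grow Y_built size_M d0).
move=> K; have [j Kj] := N_unbounded NN_grow K.
have NN_gt0 i : (0 < NN i)%N.
  case: i => [|i]; first by have [] := pkP (0, 1)%N.
  by apply: leq_trans (NN_grow i); rewrite muln_gt0.
have hav : s0 / 8 <= av (fun t => v (al t) * (Y j t)%:R) (NN j).
  by case: (j) => [|i]; [have [] := pkP (0, 1)%N|have [] := pkP (i.+1, C * (NN i).+1)%N].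
have [m [m_lt m_le]] : exists m, (forall t, (m < t <= NN j)%N -> forall i, (i < j)%N -> (NN i < t)%N)
    /\ (C * m <= NN j)%N.
  case: (j) => [|i]; first by exists 0%N; rewrite muln0.
  exists (NN i); split; last by apply: leq_trans (NN_step i); rewrite leq_mul2l leqnSn orbT.
  move=> t /andP[it _] i' ii'; apply: leq_ltn_trans it.
  by apply: (N_incr NN_grow); rewrite -ltnS.
have close : `|av (fun t => v (al t) * (glued Y NN_grow t)%:R) (NN j) -
              av (fun t => v (al t) * (Y j t)%:R) (NN j)| <= 2 * L * m%:R / (NN j)%:R.
  apply: av_eq_after => // t mt; congr (_ * _%:R).
  rewrite /glued (@stageP NN NN_grow t j); last by have /andP[] := mt.
    by have /andP[mt' _] := mt; rewrite (leq_trans _ mt').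
  exact: m_lt.
have small : 2 * L * m%:R / (NN j)%:R <= s0 / 16.
  rewrite ler_pdivrMr ?ltr0n //; apply: (@le_trans _ _ (s0 / 16 * (C%:R * m%:R))); last first.
    by rewrite ler_wpM2l ?divr_ge0 ?(ltW s0_gt0) // -natrM ler_nat.
  have hC : 32 * L <= s0 * C%:R.
    rewrite [leRHS]mulrC -ler_pdivrMr //; apply/ltW/(lt_le_trans (truncnS_gt _)).
    by rewrite ler_nat /C leqnSn.
  have -> : 2 * L * m%:R = 32 * L * m%:R / 16 by field.
  have -> : s0 / 16 * (C%:R * m%:R) = s0 * C%:R * m%:R / 16 by field.
  by rewrite ler_pM2r ?invr_gt0 // ler_wpM2r.
have [k kE] : exists k, NN j = N_ k.
  by case: (j) => [|i]; [exists (pk (0, 1)%N)|exists (pk (i.+1, C * (NN i).+1)%N)].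
exists k; rewrite -kE; split => //.
move: close; rewrite ler_norml => /andP[? _]; lra.
Qed.

End correlated_sequence.

(** * Subshifts with few words have zero entropy *)

Section window_lemmas.
Implicit Types (x : int -> bool) (a : int).

Lemma wordz_cat x m n a : wordz x (m + n) a = wordz x m a ++ wordz x n (a + m%:Z).
Proof.
rewrite /wordz /mkseq iotaD map_cat; congr (_ ++ _).
rewrite add0n -{1}[m]addn0 iotaDl -map_comp; apply: eq_map => i /=.
by rewrite PoszD addrA.
Qed.

Lemma wordz_words x l W k a : (forall a, wordz x l a \in W) ->
  wordz x (k * l) a \in words W k.
Proof.
move=> xW; elim: k a => [|k IH] a //=.
rewrite mulSn wordz_cat; apply/allpairsP.
by exists (wordz x l a, wordz x (k * l) (a + l%:Z)); split => //=.
Qed.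

Lemma wordz_eq x y n a i : wordz x n a = wordz y n a -> (i < n)%N ->
  x (a + i%:Z) = y (a + i%:Z).
Proof.
move=> /(congr1 (fun s => nth false s i)) + lin; by rewrite !nth_mkseq.
Qed.

End window_lemmas.

Definition admissible (y0 x : int -> bool) : Prop :=
  forall n a, exists b, wordz x n a = wordz y0 n b.

(** The field R is the one in which the distance takes its values. *)
Definition subshift (R : realType) (y0 : int -> bool) : Type :=
  {x : int -> bool | admissible y0 x}.

HB.instance Definition _ R y0 := gen_eqMixin (subshift R y0).
HB.instance Definition _ R y0 := gen_choiceMixin (subshift R y0).

Section subshift_metric.
Variables (R : realType) (y0 : int -> bool).
Local Notation X := (subshift R y0).
Implicit Types x y z : X.

(** The value 0 makes the set nonempty when x = y. *)
Definition gaps x y : set R :=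
  [set r | r = 0 \/ exists2 i : int, sval x i != sval y i & r = (absz i).+1%:R^-1].

Definition sdist x y : R := sup (gaps x y).

Lemma gaps_sup x y : has_sup (gaps x y).
Proof.
split; first by exists 0; left.
exists 1 => _ [-> //|[i _ ->]].
by rewrite invf_le1 ?ltr0n // ler1n.
Qed.

Lemma sdist_ge x y r : gaps x y r -> r <= sdist x y.
Proof. by move=> h; apply: sup_upper_bound => //; exact: gaps_sup. Qed.

Lemma sdist_le x y b : (forall r, gaps x y r -> r <= b) -> sdist x y <= b.
Proof. by move=> h; apply: ge_sup => //; exists 0; left. Qed.

Lemma sdist_ge0 x y : 0 <= sdist x y.
Proof. by apply: sdist_ge; left. Qed.

Lemma sdistxx x : sdist x x = 0.
Proof.
apply/eqP; rewrite eq_le sdist_ge0 andbT; apply: sdist_le => r [-> //|[j]].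
by rewrite eqxx.
Qed.

Lemma sdist_positivity x y : sdist x y = 0 -> x = y.
Proof.
move=> d0; apply: eq_sig_hprop => [? ? ?|]; first exact: Prop_irrelevance.
apply/funext => i; apply/eqP; apply: contrapT => /negP xy.
have := sdist_ge (or_intror (ex_intro2 _ _ i xy erefl)).
by rewrite d0 leNgt invr_gt0 ltr0n.
Qed.

Lemma sdist_sym x y : sdist x y = sdist y x.
Proof.
by congr sup; apply/seteqP; split => r [->|[i xy ->]]; [left|right|left|right] => //;
  exists i => //; rewrite eq_sym.
Qed.

Lemma sdist_triangle y x z : sdist x z <= sdist x y + sdist y z.
Proof.
apply: sdist_le => _ [->|[i xz ->]]; first by rewrite addr_ge0 // sdist_ge0.
have [xy|xy] := eqVneq (sval x i) (sval y i).
  rewrite -[leLHS]add0r lerD ?sdist_ge0 //; apply: sdist_ge; right; exists i => //.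
  by rewrite -xy.
rewrite -[leLHS]addr0 lerD ?sdist_ge0 //; apply: sdist_ge; right; by exists i.
Qed.

HB.instance Definition _ := @isMetric.Build R X sdist
  sdistxx sdist_positivity sdist_sym sdist_triangle.

Lemma sdist_lt x y m :
  (sdist x y < m.+1%:R^-1) <-> (forall i : int, (absz i <= m)%N -> sval x i = sval y i).
Proof.
split=> [h i im|h].
  apply/eqP; apply: contrapT => /negP xy.
  have := sdist_ge (or_intror (ex_intro2 _ _ i xy erefl)).
  rewrite leNgt => /negP; apply; apply: lt_le_trans h _.
  by rewrite lef_pV2 ?posrE ?ltr0n // ler_nat.
apply: (@le_lt_trans _ _ m.+2%:R^-1); last first.
  by rewrite ltf_pV2 ?posrE ?ltr0n // ltr_nat.
apply: sdist_le => _ [->|[i xy ->]]; first by rewrite invr_ge0.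
rewrite lef_pV2 ?posrE ?ltr0n // ler_nat ltnS ltnNge.
by apply: contra xy => im; rewrite h.
Qed.

Lemma nbhs_agree x (A : set X) : nbhs x A <->
  exists m, forall y, (forall i : int, (absz i <= m)%N -> sval x i = sval y i) -> A y.
Proof.
rewrite nbhs_ballP; split => [[e /= e0 eA]|[m mA]].
  exists (Num.trunc e^-1) => y /sdist_lt h; apply: eA; rewrite ballEmdist /=.
  apply: (lt_le_trans h); rewrite invf_ple ?posrE //.
  exact/ltW/truncnS_gt.
exists (m.+1%:R^-1); first by rewrite /= invr_gt0.
by move=> y; rewrite ballEmdist /= => /sdist_lt; exact: mA.
Qed.

(** An ultrafilter decides every coordinate, and any finite window of the
    resulting point is a window of some point of the subshift. *)
Lemma subshift_compact : compact [set: X].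
Proof.
rewrite compact_ultra => F UF _.
pose b i := `[< F [set x : X | sval x i] >].
have Fb i : F [set x : X | sval x i = b i].
  rewrite /b; case: asboolP => h; first by apply: filterS h => x /= ->.
  have [//|h'] := in_ultra_setVsetC [set x : X | sval x i] UF.
  by apply: filterS h' => x /= /negP/negbTE.
have Fs (s : seq int) : F [set x : X | forall i, i \in s -> sval x i = b i].
  elim: s => [|i s IH]; first by apply: filterS filterT.
  apply: filterS (filterI (Fb i) IH) => x [xi xs] j.
  by rewrite in_cons => /orP[/eqP -> //|]; exact: xs.
have bad : admissible y0 b.
  move=> n a; have [x xP] := filter_ex (Fs [seq a + k%:Z | k <- iota 0 n]).
  have [c cE] := svalP x n a; exists c; rewrite -cE.
  apply: (@eq_from_nth _ false); rewrite !size_mkseq // => k kn.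
  rewrite !nth_mkseq // xP //; apply/mapP; exists k => //.
  by rewrite mem_iota.
exists (exist _ b bad : X); split => // A /nbhs_agree[m mA].
apply: filterS (Fs ([seq k%:Z | k <- iota 0 m.+1] ++ [seq - k%:Z | k <- iota 0 m.+1])).
move=> x xP; apply: mA => i im /=; rewrite xP // mem_cat.
by case: (intP i) im => [|k|k] im; apply/orP; [left|left|right];
  apply/mapP; [exists 0%N|exists k.+1|exists k.+1] => //; rewrite mem_iota; move: im; lia.
Qed.

Lemma subshift_continuous (g : X -> X) :
  (forall m, exists m', forall x y, (forall i : int, (absz i <= m')%N -> sval x i = sval y i) ->
     (forall i : int, (absz i <= m)%N -> sval (g x) i = sval (g y) i)) ->
  continuous g.
Proof.
move=> h x A /nbhs_agree[m mA]; have [m' m'P] := h m.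
by apply/nbhs_agree; exists m' => y xy; apply: mA; exact: m'P.
Qed.

Lemma wordz_shift (z : int -> bool) c n a : wordz (fun i => z (i + c)) n a = wordz z n (a + c).
Proof. by apply: eq_map => i /=; rewrite addrAC. Qed.

Lemma admissible_shift (z : int -> bool) c : admissible y0 z -> admissible y0 (fun i => z (i + c)).
Proof. by move=> h n a; rewrite wordz_shift. Qed.

Definition translate (c : int) x : X :=
  exist _ (fun i => sval x (i + c)) (admissible_shift c (svalP x)).

Definition Tsub := translate 1.

Lemma sval_inj x y : (forall i, sval x i = sval y i) -> x = y.
Proof.
move=> h; apply: eq_sig_hprop => [? ? ?|]; first exact: Prop_irrelevance.
exact/funext.
Qed.

Lemma Tsub_homeo : homeomorphism Tsub.
Proof.
have cont c : continuous (translate c).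
  apply: subshift_continuous => m; exists (m + absz c)%N => x y xy i im /=.
  apply: xy; lia.
split; first exact: cont.
exists (translate (-1)); split => // [x|x].
- by apply: sval_inj => i /=; rewrite addrAC addrK ?subrK // addrNK.
- by apply: sval_inj => i /=; rewrite addrK.
Qed.

Lemma iter_Tsub n x i : sval (iter n Tsub x) i = sval x (i + n%:Z).
Proof.
elim: n x i => [|n IH] x i; first by rewrite addr0.
by rewrite iterSr IH /= -addrA -PoszD addn1.
Qed.

Definition base_point : X := exist _ y0 (fun n a => ex_intro _ a erefl).

Definition observable x : R[i] := (sval x 0)%:R.

Lemma observable_continuous : continuous observable.
Proof.
move=> x.
have h : nbhs x [set y | observable y = observable x].
  by apply/nbhs_agree; exists 0%N => y /(_ 0 isT) xy; rewrite /observable /= xy.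
exact: cvg_near_cst h.
Qed.

Hypothesis few : forall delta : R, 0 < delta -> exists l (W : seq (seq bool)),
  [/\ (0 < l)%N, (size W)%:R <= expR (delta * l%:R) & forall a, wordz y0 l a \in W].

(** Points that agree on the coordinates from - Q to n + Q stay e-close for
    n steps. A word of that length is a concatenation of r words of W, and
    one point is chosen for each such word. *)
Lemma span_card_le (delta e : R) : 0 < delta -> 0 < e ->
  exists c : nat, forall n, (span_card Tsub n e <= (expR (delta * (n + c)%N%:R))%:E)%E.
Proof.
move=> d0 e0; have [l [W [l0 sW yW]]] := few d0.
have xW (x : X) a : wordz (sval x) l a \in W by have [b ->] := svalP x l a.
pose Q := Num.trunc e^-1.
have QP : Q.+1%:R^-1 <= e by rewrite invf_ple ?posrE //; exact/ltW/truncnS_gt.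
exists (2 * Q + 1 + l)%N => n.
pose r := ((n + (2 * Q + 1)) %/ l).+1.
have rl : (n + (2 * Q + 1) <= r * l)%N by apply: ltnW; exact: ltn_ceil.
have rl2 : (r * l <= n + (2 * Q + 1 + l))%N.
  by rewrite /r mulSnr !addnA leq_add2r leq_trunc_div.
have /choice [rep repP] : forall w : seq bool, exists x : X,
    (exists z : X, wordz (sval z) (r * l) (- Q%:Z) = w) -> wordz (sval x) (r * l) (- Q%:Z) = w.
  move=> w; have [[z zw]|nz] := pselect (exists z : X, wordz (sval z) (r * l) (- Q%:Z) = w).
    by exists z.
  by exists base_point.
pose F := finmap.seq_fset tt (map rep (words W r)).
apply: (@le_trans _ _ (size (finmap.enum_fset F))%:R%:E).
  apply: ereal_inf_lbound; exists F => // x.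
  pose w := wordz (sval x) (r * l) (- Q%:Z).
  exists (rep w).
    by rewrite finmap.seq_fsetE map_f // wordz_words.
  move=> i lin; apply: lt_le_trans QP; apply/sdist_lt => k kQ.
  rewrite !iter_Tsub.
  have eqw : wordz (sval x) (r * l) (- Q%:Z) = wordz (sval (rep w)) (r * l) (- Q%:Z).
    by rewrite repP //; exists x.
  pose s := k + i%:Z + Q%:Z.
  have lt : (absz s < r * l)%N.
    apply: leq_trans rl; rewrite /s; move: kQ lin; clear; lia.
  have := wordz_eq eqw lt.
  have -> // : - Q%:Z + (absz s)%:Z = k + i%:Z.
  by rewrite /s; move: kQ; clear; lia.
rewrite lee_fin finmap.size_seq_fset.
apply: (@le_trans _ _ (size (words W r))%:R).
  by rewrite ler_nat -(size_map rep) size_undup.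
rewrite size_words natrX.
apply: (@le_trans _ _ (expR (delta * l%:R) ^+ r)).
  by rewrite lerXn2r // ?nnegrE ?expR_ge0.
rewrite -expRM_natl ler_expR mulrCA -natrM ler_wpM2l ?(ltW d0) // ler_nat.
exact: rl2.
Qed.

Lemma span_card_ge1 n e : (1 <= span_card Tsub n e)%E.
Proof.
apply: le_ereal_inf_tmp => _ [F sF <-]; rewrite lee_fin ler1n.
have [y + _] := sF base_point.
move=> yF; have {}yF : y \in finmap.enum_fset F by exact: yF.
by move: yF; case: (finmap.enum_fset F).
Qed.

Lemma subshift_entropy0 : topological_entropy Tsub = 0%E.
Proof.
have ge0 n e : (0 <= n%:R^-1%:E * lne (span_card Tsub n e))%E.
  by rewrite mule_ge0 ?lee_fin ?invr_ge0 // lne_ge0 span_card_ge1.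
apply/eqP; rewrite eq_le; apply/andP; split.
  apply: ge_ereal_sup => _ [e /= e0 <-].
  apply/lee_addgt0Pr => d d0; rewrite add0e.
  have [c cP] := span_card_le (divr_gt0 d0 (ltr0Sn R 1)) e0.
  rewrite limn_esup_lim; apply: lime_le; first exact: is_cvg_esups.
  exists c.+1 => // m /= cm; apply: ge_ereal_sup => _ [n /= mn <-].
  have n0 : (0 < n)%N by apply: leq_trans mn; apply: leq_trans cm.
  have n0' : 0 < n%:R :> R by rewrite ltr0n.
  apply: (@le_trans _ _ (n%:R^-1%:E * (d / 2 * (n + c)%N%:R)%:E)%E).
    apply: lee_wpmul2l; first by rewrite lee_fin invr_ge0.
    rewrite -[leRHS]expeRK lee_lne ?in_itv /= ?leey ?andbT //.
      exact: le_trans (span_card_ge1 n e).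
  rewrite -EFinM lee_fin mulrC ler_pdivrMr // -mulrA ler_pM2l // mulrC ler_pdivrMr //.
  rewrite -natrM ler_nat muln2 -addnn leq_add2l.
  by apply: leq_trans mn; apply: leq_trans cm.
apply: le_ereal_sup_tmp; exists (limn_esup (fun n => n%:R^-1%:E * lne (span_card Tsub n 1)))%E.
  by exists 1; [exact: ltr01|].
rewrite limn_esup_lim; apply: lime_ge; first exact: is_cvg_esups.
apply: nearW => m; apply: le_trans (ge0 m 1) _.
by apply: ereal_sup_ubound; exists m => /=.
Qed.

End subshift_metric.

(** * Complex numbers and their averages *)

Section complex_topology.
Variable R : realType.
Implicit Types (x y : R[i]).

Lemma normCE x : `|x| = (cmod x)%:C%C.
Proof. by []. Qed.

Lemma nbhsC x (A : set R[i]) :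
  nbhs x A <-> exists2 e : R, 0 < e & forall y, cmod (x - y) < e -> A y.
Proof.
rewrite nbhs_ballP; split => [[e /= e0 eA]|[e e0 eA]].
  have eE : e = (complex.Re e)%:C%C.
    by apply/eqP; move: e0; rewrite ltcE eq_complex /= => /andP[/eqP -> _]; rewrite !eqxx.
  exists (complex.Re e); first by move: e0; rewrite {1}eE ltcR.
  by move=> y xy; apply: eA; rewrite /ball /= eE normCE ltcR.
exists e%:C%C; first by rewrite /= ltcR.
by move=> y; rewrite /ball /= normCE ltcR; exact: eA.
Qed.

Lemma cmod_ge0 x : 0 <= cmod x.
Proof. by case: x => a b; exact: sqrtr_ge0. Qed.

Lemma cmodB_le x y : `|cmod x - cmod y| <= cmod (x - y).
Proof.
have h1 := le_normcD (x - y) y; rewrite subrK in h1.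
have h2 := le_normcD (y - x) x; rewrite subrK -opprB normcN in h2.
by rewrite ler_norml; apply/andP; split; lra.
Qed.

Lemma cmod_le_abs x : cmod x <= `|complex.Re x| + `|complex.Im x|.
Proof.
case: x => a b /=.
rewrite -[leRHS]ger0_norm ?addr_ge0 // -sqrtr_sqr ler_sqrt ?sqr_ge0 //.
rewrite -(real_normK (num_real a)) -(real_normK (num_real b)) sqrrD.
have := mulr_ge0 (normr_ge0 a) (normr_ge0 b); lra.
Qed.

Lemma Re_le_cmod x : `|complex.Re x| <= cmod x.
Proof.
case: x => a b /=; rewrite -sqrtr_sqr ler_sqrt ?addr_ge0 ?sqr_ge0 //.
by rewrite lerDl sqr_ge0.
Qed.

Lemma Im_le_cmod x : `|complex.Im x| <= cmod x.
Proof.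
case: x => a b /=; rewrite -sqrtr_sqr ler_sqrt ?addr_ge0 ?sqr_ge0 //.
by rewrite lerDr sqr_ge0.
Qed.

Lemma lipschitz_continuousC (g : R[i] -> R) :
  (forall x y, `|g x - g y| <= cmod (x - y)) -> continuous g.
Proof.
move=> gl x A /nbhs_ballP[e /= e0 eA]; apply/nbhsC; exists e => // y xy.
by apply: eA; rewrite /ball /=; exact: le_lt_trans (gl x y) xy.
Qed.

Lemma Re_continuous : continuous (@complex.Re R).
Proof.
apply: lipschitz_continuousC => // x y; apply: le_trans (Re_le_cmod _).
by case: x; case: y.
Qed.

Lemma Im_continuous : continuous (@complex.Im R).
Proof.
apply: lipschitz_continuousC => // x y; apply: le_trans (Im_le_cmod _).
by case: x; case: y.
Qed.

Lemma cvgCP (T : Type) (F : set_system T) (FF : Filter F) (f : T -> R[i]) (l : R[i]) :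
  f x @[x --> F] --> l <-> cmod (f x - l) @[x --> F] --> (0 : R).
Proof.
split => [h|/cvgrPdist_lt h].
  apply/cvgrPdist_lt => e e0.
  have nl : nbhs l [set y | cmod (l - y) < e] by apply/nbhsC; exists e.
  have hF : F (f @^-1` [set y | cmod (l - y) < e]) := h _ nl.
  apply: filterS hF => x /=.
  by rewrite sub0r normrN ger0_norm ?cmod_ge0 // -opprB normcN.
move=> A /nbhsC[e e0 eA]; have := h e e0; apply: filterS => x /=.
by rewrite sub0r normrN ger0_norm ?cmod_ge0 // -opprB normcN; exact: eA.
Qed.

Lemma Re_mean (a : nat -> R[i]) N : complex.Re (mean a N) = av (fun n => complex.Re (a n)) N.
Proof.
rewrite /mean /av -(rmorph_nat (@real_complex R)) -fmorphV.
have -> : \sum_(1 <= n < N.+1) complex.Re (a n) = complex.Re (\sum_(1 <= n < N.+1) a n).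
  by rewrite raddf_sum.
by case: (\sum_(1 <= n < N.+1) a n) => x y /=; rewrite mul0r subr0.
Qed.

Lemma Im_mean (a : nat -> R[i]) N : complex.Im (mean a N) = av (fun n => complex.Im (a n)) N.
Proof.
rewrite /mean /av -(rmorph_nat (@real_complex R)) -fmorphV.
have -> : \sum_(1 <= n < N.+1) complex.Im (a n) = complex.Im (\sum_(1 <= n < N.+1) a n).
  by rewrite raddf_sum.
by case: (\sum_(1 <= n < N.+1) a n) => x y /=; rewrite mul0r addr0.
Qed.

End complex_topology.

(** * Integrals against empirical measures *)

Section empirical.
Variables (R : realType) (L : {nonneg R}).

Lemma continuous_borel_measurable (f : borel_shift_space L -> R) :
  continuous (f : shift_space L -> R) -> measurable_fun setT f.
Proof.
move=> cf; apply: (measurability _ (RGenOpens.measurableE R)).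
move=> _ [_ [a [b ->] <-]]; rewrite setTI; apply: sub_sigma_algebra.
by move/continuousP : cf; apply; exact: interval_open.
Qed.

Lemma integral_empirical (f : borel_shift_space L -> R) (z : shift_space L) N :
  measurable_fun setT f ->
  (\int[empirical z N]_x (f x)%:E = (av (fun n => f (iter n (@left_shift R L) z)) N)%:E)%E.
Proof.
move=> mf; have step (g : borel_shift_space L -> R) : measurable_fun setT g ->
    (forall x, 0 <= g x) ->
    (\int[empirical z N]_x (g x)%:E =
     (N%:R^-1 * \sum_(n < N) g (iter n.+1 (@left_shift R L) z))%:E)%E.
  move=> mg g0; rewrite /empirical ge0_integral_mscale //; last first.
    by move=> x _; rewrite lee_fin.
    exact/measurable_EFinP.
  rewrite ge0_integral_measure_sum //; last 2 first.
    by move=> x _; rewrite lee_fin.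
    exact/measurable_EFinP.
  rewrite EFinM -sumEFin; congr (_ * _)%E.
  apply: eq_bigr => n _; rewrite integral_dirac // ?diracT ?mul1e //.
  exact/measurable_EFinP.
rewrite integralE.
have -> : (fun x : borel_shift_space L => (f x)%:E)^\+%E = (fun x => (Num.max (f x) 0)%:E).
  by apply/funext => x; rewrite funeposE EFin_max.
have -> : (fun x : borel_shift_space L => (f x)%:E)^\-%E = (fun x => (Num.max (- f x) 0)%:E).
  by apply/funext => x; rewrite funenegE EFin_max.
rewrite !step; [|by apply: measurable_maxr => //; exact: measurableT_comp|
  by move=> x; rewrite le_max lexx orbT|by apply: measurable_maxr|
  by move=> x; rewrite le_max lexx orbT].
rewrite -EFinB -mulrBr -sumrB /av big_add1 big_mkord; congr (_ * _)%:E.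
apply: eq_bigr => n _ /=; set y := f _.
have [h|h] := lerP 0 y.
  by rewrite max_r ?subr0 // oppr_le0.
by rewrite max_l ?sub0r ?opprK // oppr_ge0 ltW.
Qed.

End empirical.

(** * Block statistics are integrals of continuous functions *)

Section coding.
Variables (R : realType) (u : nat -> R[i]) (s : seq R[i]) (q : nat).
Hypothesis s_uniq : uniq s.
Hypothesis size_s : size s = q.+1.
Hypothesis us : forall n, (0 < n)%N -> u n \in s.

Definition letter (n : nat) : 'I_q.+1 := inord (index (u n) s).
Definition value (a : 'I_q.+1) : R[i] := nth 0 s a.

Lemma value_letter n : (0 < n)%N -> value (letter n) = u n.
Proof.
by move=> /us un; rewrite /value /letter inordK ?nth_index // -size_s index_mem.
Qed.

Lemma value_inj : injective value.
Proof.
move=> a b /eqP; rewrite /value nth_uniq ?size_s ?ltn_ord // => /eqP ab.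
exact: val_inj.
Qed.

(** Lagrange interpolation in modulus: a continuous function on the plane
    that is 1 at value a and 0 at the other values of u. *)
Definition chi (a : 'I_q.+1) (x : R[i]) : R :=
  \prod_(b | b != a) (cmod (x - value b) / cmod (value a - value b)).

Lemma chi_value a b : chi a (value b) = (b == a)%:R.
Proof.
rewrite /chi; case: eqP => [->|/eqP ba].
  rewrite big1 // => c ca; rewrite divff //.
  apply/eqP => /ComplexField.Normc.eq0_normc /eqP; rewrite subr_eq0 => /eqP /value_inj ac.
  by rewrite ac eqxx in ca.
by rewrite (bigD1 b) //= subrr ComplexField.Normc.normc0 !mul0r.
Qed.

Lemma continuous_bigop (T : topologicalType) (I : finType) (Q : pred I) (f : I -> T -> R) :
  (forall i, continuous (f i)) ->
  continuous (fun x => \prod_(i | Q i) f i x).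
Proof.
move=> cf x; apply: cvg_big => [|i _]; first exact: mul_continuous.
exact: cf.
Qed.

Lemma continuous_sum (T : topologicalType) (I : finType) (f : I -> T -> R) :
  (forall i, continuous (f i)) ->
  continuous (fun x => \sum_i f i x).
Proof.
move=> cf x; apply: cvg_big => [|i _]; first exact: add_continuous.
exact: cf.
Qed.

Lemma continuous_mul (T : topologicalType) (f g : T -> R) :
  continuous f -> continuous g -> continuous (fun x => f x * g x).
Proof. by move=> cf cg x; exact: (cvgM (cf x) (cg x)). Qed.

Lemma continuous_scale (T : topologicalType) (c : R) (f : T -> R) :
  continuous f -> continuous (fun x => c * f x).
Proof. by move=> cf x; exact: (cvgM (cvg_cst c) (cf x)). Qed.

Lemma cmod_dist_continuous (c : R[i]) : continuous (fun x : R[i] => cmod (x - c)).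
Proof.
apply: lipschitz_continuousC => x y.
by apply: le_trans (cmodB_le _ _) _; rewrite opprB addrA subrK.
Qed.

Lemma chi_continuous a : continuous (chi a).
Proof.
apply: continuous_bigop => b x.
exact: (cvgM (@cmod_dist_continuous (value b) x) (cvg_cst _)).
Qed.

Variables (L : {nonneg R}) (z : shift_space L).
Hypothesis z_u : extends u z.

Lemma iter_left_shift n (x : shift_space L) i : iter n (@left_shift R L) x i = x (i + n%:Z).
Proof.
elim: n x i => [|n IH] x i; first by rewrite addr0.
by rewrite iterSr IH /left_shift -addrA -PoszD addn1.
Qed.

Lemma coord_continuous (i : int) : continuous (fun x : shift_space L => \val (x i) : R[i]).
Proof.
move=> x; apply: (@continuous_comp _ _ _ (fun x : shift_space L => x i) val).
  exact: (@proj_continuous _ (fun _ : int => disc_type L) i).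
exact: initial_continuous.
Qed.

Lemma chi_coord_continuous a (i : int) :
  continuous (fun x : shift_space L => chi a (\val (x i))).
Proof.
move=> x; apply: (@continuous_comp _ _ _ (fun x : shift_space L => \val (x i)) (chi a)).
  exact: coord_continuous.
exact: chi_continuous.
Qed.

(** Weak convergence only concerns continuous functions; on the finite range
    of u every function of a block is the restriction of a continuous one.
    *)
Lemma block_test_function l m (G : 'I_q.+1 -> l.-tuple 'I_q.+1 -> R) :
  exists2 f : shift_space L -> R, continuous f &
    forall n, (0 < n)%N -> f (iter n (@left_shift R L) z) = G (letter n) (blk letter l (n + m)).
Proof.
pose f (x : shift_space L) : R := \sum_(w : 'I_q.+1 * l.-tuple 'I_q.+1)
  G w.1 w.2 * (chi w.1 (\val (x 0)) * \prod_(i < l) chi (tnth w.2 i) (\val (x (m + i)%N%:Z))).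
exists f.
  apply: (@continuous_sum (shift_space L)) => w.
  have c1 := @chi_coord_continuous w.1 0.
  have c2 : continuous (fun x : shift_space L =>
      \prod_(i < l) chi (tnth w.2 i) (\val (x (m + i)%N%:Z))).
    apply: (@continuous_bigop (shift_space L) _ _
      (fun (i : 'I_l) (x : shift_space L) => chi (tnth w.2 i) (\val (x (m + i)%N%:Z)))).
    move=> i; exact: chi_coord_continuous.
  have c3 := @continuous_mul (shift_space L) _ _ c1 c2.
  have c4 := @continuous_scale (shift_space L) (G w.1 w.2) _ c3.
  exact c4.
move=> n n0; rewrite /f.
have zv (j : nat) : \val (iter n (@left_shift R L) z j%:Z) = value (letter (n + j)).
  rewrite iter_left_shift value_letter ?addn_gt0 ?n0 // addnC -PoszD.
  by have [] := z_u (_ : 0 < j + n)%N; rewrite ?addn_gt0 ?n0 ?orbT.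
rewrite (bigD1 (letter n, blk letter l (n + m))) //= [X in _ + X]big1 ?addr0.
  rewrite (zv 0) addn0 chi_value eqxx mul1r big1 ?mulr1 // => i _.
  by rewrite zv chi_value tnth_mktuple addnA eqxx.
move=> [a c] /=; rewrite xpair_eqE negb_and => /orP[ha|hc].
  by rewrite (zv 0) addn0 chi_value eq_sym (negbTE ha) mul0r mulr0.
have [i hi] : exists i, tnth c i != tnth (blk letter l (n + m)) i.
  apply/existsP; rewrite -negb_forall; apply: contra hc => /forallP h.
  by apply/eqP/eq_from_tnth => i; apply/eqP.
have e : (letter (n + (m + i)) == tnth c i) = false.
  by move: hi; rewrite tnth_mktuple eq_sym -addnA => /negbTE.
by rewrite (bigD1 i) //= (zv (m + i)%N) chi_value e mul0r !mulr0.
Qed.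

Lemma furstenberg_block_cvg (N_ : nat -> nat) l m (G : 'I_q.+1 -> l.-tuple 'I_q.+1 -> R) :
  defines_furstenberg z N_ ->
  cvgn (fun k => av (fun n => G (letter n) (blk letter l (n + m))) (N_ k)).
Proof.
move=> [_ N0 [kappa wc]].
have [f cf fE] := block_test_function m G.
have := wc f cf.
have -> : (fun k => \int[empirical z (N_ k)]_x (f x)%:E)%E =
   EFin \o (fun k => av (fun n => G (letter n) (blk letter l (n + m))) (N_ k)).
  apply/funext => k /=; rewrite integral_empirical; last exact: continuous_borel_measurable.
  congr EFin; apply: eq_av => n; exact: fE.
set a := fun k => av _ (N_ k) => ca.
pose B := \sum_(w : 'I_q.+1 * l.-tuple 'I_q.+1) `|G w.1 w.2|.
have aB k : `|a k| <= B.
  apply: av_norm_le => [|t _]; first exact: sumr_ge0.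
  by rewrite /B (bigD1 (letter t, blk letter l (t + m))) //= lerDl sumr_ge0.
have fin : (\int[kappa]_x (f x)%:E)%E \is a fin_num.
  rewrite fin_numElt; apply/andP; split.
    apply: (@lt_le_trans _ _ (- B)%:E); first exact: ltNyr.
    rewrite -(cvg_lim _ ca) //; apply: lime_ge; first by apply/cvg_ex; eexists; exact: ca.
    by apply: nearW => k /=; rewrite lee_fin; have := aB k; rewrite ler_norml => /andP[].
  apply: (@le_lt_trans _ _ B%:E); last exact: ltry.
  rewrite -(cvg_lim _ ca) //; apply: lime_le; first by apply/cvg_ex; eexists; exact: ca.
  by apply: nearW => k /=; rewrite lee_fin; have := aB k; rewrite ler_norml => /andP[].
apply/cvg_ex; exists (fine (\int[kappa]_x (f x)%:E)%E).
by move: ca; rewrite -{1}(fineK fin) => /fine_cvg.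
Qed.

End coding.

(** * Realizing consistent word frequencies on the unit interval *)

Section unit_interval.
Variable R : realType.

Definition leb01 : set (measurableTypeR R) -> \bar R :=
  mrestr lebesgue_measure (measurable_itv (`[0, 1[ : interval R)).

HB.instance Definition _ := Measure.on leb01.

Let leb01_setT : leb01 setT = 1%E.
Proof. by rewrite /leb01 /mrestr setTI lebesgue_measure_itv /= lte_fin ltr01 oppr0 adde0. Qed.

HB.instance Definition _ := @Measure_isProbability.Build _ _ _ leb01 leb01_setT.

End unit_interval.

Section nested_intervals.
Variables (R : realType) (A : finType) (a0 : A).

(** Most recent letter first, so that reading one more letter is a cons. *)
Fixpoint rword (c : nat -> A) (n : nat) : seq A :=
  if n is n'.+1 then c n' :: rword c n' else [::].

Lemma size_rword c n : size (rword c n) = n.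
Proof. by elim: n => //= n ->. Qed.

Lemma rword_eq c d n : rword c n = rword d n <-> (forall i, (i < n)%N -> c i = d i).
Proof.
elim: n => [|n IH]; first by split.
split => [[cd /IH h] i|h].
  by rewrite ltnS leq_eqVlt => /orP[/eqP -> //|]; exact: h.
by rewrite /= h // (IH.2 (fun i lt => h i (ltnW lt))).
Qed.

Variable mass : seq A -> R.
Hypothesis mass_ge0 : forall y, 0 <= mass y.
Hypothesis mass_nil : mass [::] = 1.
Hypothesis mass_cons : forall y, mass y = \sum_a mass (a :: y).

(** A word y is coded by the interval of length mass y starting at lo y; the
    intervals of the words a :: y tile it, in the order of the letters a. *)
Fixpoint lo (y : seq A) : R :=
  if y is a :: y' then
    lo y' + \sum_(b | (enum_rank b < enum_rank a)%N) mass (b :: y') else 0.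

Definition hi (y : seq A) : R := lo y + mass y.

Let cum y k : R := lo y + \sum_(b | (enum_rank b < k)%N) mass (b :: y).

Let cum_lo y a : lo (a :: y) = cum y (enum_rank a).
Proof. by []. Qed.

Let cum_hi y a : hi (a :: y) = cum y (enum_rank a).+1.
Proof.
rewrite /hi cum_lo /cum -addrA; congr (_ + _).
rewrite [RHS](bigD1 a) //= addrC; congr (_ + _); apply: eq_bigl => b.
by rewrite ltnS -(inj_eq enum_rank_inj) -val_eqE /= andbC ltn_neqAle.
Qed.

Let cum_mono y j k : (j <= k)%N -> cum y j <= cum y k.
Proof.
move=> jk; rewrite lerD2l [leRHS](bigID (fun b => (enum_rank b < j)%N)) /=.
rewrite [X in _ <= X + _](eq_bigl (fun b => (enum_rank b < j)%N)).
  by rewrite lerDl sumr_ge0.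
by move=> b; case: (ltnP _ j) => h; rewrite ?andbF // (leq_trans h).
Qed.

Let cum0 y : cum y 0 = lo y.
Proof. by rewrite /cum big1 ?addr0. Qed.

Let cum_card y : cum y #|A| = hi y.
Proof.
rewrite /cum /hi mass_cons; congr (_ + _); apply: eq_bigl => b.
by rewrite ltn_ord.
Qed.

Definition inI (y : seq A) (r : R) : bool := (lo y <= r < hi y).

Lemma inI_cons a y r : inI (a :: y) r -> inI y r.
Proof.
rewrite /inI cum_lo cum_hi => /andP[h1 h2]; apply/andP; split.
  by apply: le_trans h1; rewrite -cum0 cum_mono.
by apply: lt_le_trans h2 _; rewrite -cum_card cum_mono.
Qed.

Lemma inI_ex y r : inI y r -> exists a, inI (a :: y) r.
Proof.
rewrite /inI -cum0 -cum_card => /andP[h0 h1].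
have ex : exists k, r < cum y k by exists #|A|.
case: (ex_minnP ex) => -[|k] rk kmin; first by rewrite ltNge h0 in rk.
have kA : (k < #|A|)%N by exact: kmin.
exists (enum_val (Ordinal kA)); rewrite cum_lo cum_hi enum_valK /= rk andbT leNgt.
by apply/negP => /kmin; rewrite ltnn.
Qed.

Lemma inI_uniq y r a b : inI (a :: y) r -> inI (b :: y) r -> a = b.
Proof.
rewrite /inI !cum_lo !cum_hi => /andP[a1 a2] /andP[b1 b2].
apply: enum_rank_inj; apply/val_inj/eqP; rewrite eqn_leq.
apply/andP; split; rewrite -ltnS ltnNge; apply/negP => h.
  by have := lt_le_trans b2 (le_trans (cum_mono y h) a1); rewrite ltxx.
by have := lt_le_trans a2 (le_trans (cum_mono y h) b1); rewrite ltxx.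
Qed.

Definition next (y : seq A) (r : R) : A := odflt a0 [pick a | inI (a :: y) r].

Fixpoint word_at (r : R) (n : nat) : seq A :=
  if n is n'.+1 then next (word_at r n') r :: word_at r n' else [::].

Definition digit (r : R) (n : nat) : A :=
  next (word_at (if inI [::] r then r else 0) n) (if inI [::] r then r else 0).

Lemma inI_nil r : inI [::] r = (0 <= r < 1).
Proof. by rewrite /inI /hi /= add0r mass_nil. Qed.

Lemma rword_digit r n : rword (digit r) n = word_at (if inI [::] r then r else 0) n.
Proof. by elim: n => //= n ->. Qed.

Lemma inI_next y r : inI y r -> inI (next y r :: y) r.
Proof.
move=> /inI_ex[a ha]; rewrite /next; case: pickP => //= h.
by have := h a; rewrite ha.
Qed.

Lemma inI_word_at r n : inI [::] r -> inI (word_at r n) r.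
Proof. by move=> r0; elim: n => //= n; exact: inI_next. Qed.

Lemma inI0 y r : inI y r -> inI [::] r.
Proof. by elim: y => //= a y IH /inI_cons. Qed.

Lemma word_atP y r : inI [::] r -> inI y r = (word_at r (size y) == y).
Proof.
move=> r0; apply/idP/eqP => [|<-]; last exact: inI_word_at.
elim: y => //= a y IH h; have hy := inI_cons h; rewrite IH //; congr cons.
by apply: (@inI_uniq y r) => //; exact: inI_next.
Qed.

Lemma measurable_inI y : measurable ([set r | inI y r] : set (measurableTypeR R)).
Proof.
have -> : [set r | inI y r] = [set` `[lo y, hi y[].
  by apply/seteqP; split => r /=; rewrite in_itv.
exact: measurable_itv.
Qed.

Lemma digit_word y : [set r | rword (digit r) (size y) = y] =
  [set r | inI y r] `|`
  ([set r | ~~ inI [::] r] `&` [set r | word_at 0 (size y) = y]).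
Proof.
apply/seteqP; split => r /=; rewrite rword_digit.
  case: ifP => r0; last by right.
  by left; rewrite word_atP //; apply/eqP.
move=> [h|[/negbTE -> //]].
by rewrite (inI0 h); apply/eqP; rewrite -word_atP // (inI0 h).
Qed.

Lemma measurable_digit_word y :
  measurable ([set r | rword (digit r) (size y) = y] : set (measurableTypeR R)).
Proof.
rewrite digit_word; apply: measurableU; first exact: measurable_inI.
have -> : [set r | ~~ inI [::] r] = ~` [set r | inI [::] r].
  by apply/seteqP; split => r /= /negP.
apply: measurableI; first by apply: measurableC; exact: measurable_inI.
have -> : [set r : measurableTypeR R | word_at 0 (size y) = y] =
    if word_at 0 (size y) == y then setT else set0.
  by apply/seteqP; case: eqP; split.
by case: ifP => _; [exact: measurableT|exact: measurable0].
Qed.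

Lemma leb01_digit_word y :
  @leb01 R [set r | rword (digit r) (size y) = y] = (mass y)%:E.
Proof.
rewrite /leb01 /mrestr.
have -> : [set r | rword (digit r) (size y) = y] `&` [set` `[0, 1[] = [set` `[lo y, hi y[].
  rewrite digit_word; apply/seteqP; split => r /=; rewrite !in_itv /=.
    move=> [[h _|[]]]; first by move: h.
    by rewrite inI_nil => /negP.
  move=> h; have h0 : inI [::] r by apply: (@inI0 y).
  by split; [left|rewrite -inI_nil].
rewrite lebesgue_measure_itv /= lte_fin /hi ltrDl.
have [m0|m0] := ltP 0 (mass y); first by rewrite -EFinB addrC addKr.
by congr EFin; apply/eqP; rewrite eq_le m0 mass_ge0.
Qed.

End nested_intervals.

(** * Compactness: Furstenberg systems along subsequences *)

Section furstenberg_subsequence.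
Variables (R : realType) (L : {nonneg R}) (A : finType) (w : A -> disc_type L).

(** Coordinates are enumerated by pickle, so that agreeing on long prefixes
    of c is being close in the product topology. *)
Definition point_of (c : nat -> A) : shift_space L := fun i : int => w (c (pickle i)).

Lemma ptws_cvg (T : Type) (F : set_system T) (FF : Filter F) (g : T -> shift_space L)
    (y : shift_space L) :
  (forall i : int, F [set x | g x i = y i]) -> g x @[x --> F] --> y.
Proof.
move=> h; apply/cvg_sup => i; apply/cvg_image.
  by apply/seteqP; split => // v _; exists (fun=> v).
move=> W Wy; exists ((fun x : shift_space L => x i) @^-1` W).
  have hF : F [set t | W (g t i)] by apply: filterS (h i) => t /= ->; exact: nbhs_singleton.
  exact: hF.
apply/seteqP; split => [_ [x Wx <-] //|v Wv].
by exists (fun=> v).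
Qed.

(** Otherwise points outside V that share longer and longer prefixes with c
    would converge to a point of V. *)
Lemma open_prefix (V : set (shift_space L)) c : open V -> V (point_of c) ->
  exists n, forall d, (forall j, (j < n)%N -> c j = d j) -> V (point_of d).
Proof.
move=> oV Vc; apply: contrapT => /forallNP h.
have /choice [d dP] : forall n, exists d, (forall j, (j < n)%N -> c j = d j) /\ ~ V (point_of d).
  by move=> n; have /existsNP[d /not_implyP[h1 h2]] := h n; exists d.
have cv : point_of (d n) @[n --> \oo] --> point_of c.
  apply: ptws_cvg => i; exists (pickle i).+1 => // n /= ni.
  by rewrite /point_of; have [-> //] := dP n.
have [n _ hn] := cv _ (open_nbhs_nbhs (conj oV Vc)).
by have [_ nV] := dP n; apply: nV; exact: (hn n (leqnn n)).
Qed.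

(** Pairs that violate the bound for longer and longer common prefixes have
    a common limit along an ultrafilter, since each letter is eventually
    constant along it. *)
Lemma uniform_prefix (f : shift_space L -> R) (eta : R) : continuous f -> 0 < eta ->
  exists n, forall c d, (forall j, (j < n)%N -> c j = d j) ->
    `|f (point_of c) - f (point_of d)| <= eta.
Proof.
move=> cf eta0; apply: contrapT => /forallNP h.
have /choice [cd cdP] : forall n, exists cd : (nat -> A) * (nat -> A),
    (forall j, (j < n)%N -> cd.1 j = cd.2 j) /\
    eta < `|f (point_of cd.1) - f (point_of cd.2)|.
  move=> n; have /existsNP[c /existsNP[d /not_implyP[h1 h2]]] := h n.
  by exists (c, d); split => //; rewrite ltNge; apply/negP.
have [U [UU Uoo]] := ultraFilterLemma (eventually_filter : ProperFilter \oo).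
have /choice [c cP] : forall j, exists a, U [set n | (cd n).1 j = a].
  move=> j; apply: contrapT => /forallNP hj.
  have hall : \forall n \near U, forall a : A, (cd n).1 j <> a.
    apply: filter_forall => a; have [/hj //|] := in_ultra_setVsetC [set n | (cd n).1 j = a] UU.
    exact: filterS.
  by have [n] := filter_ex hall; apply.
have agree j : U [set n | (cd n).1 j = c j /\ (cd n).2 j = c j].
  have gt : U [set n | (j < n)%N] by apply: Uoo; exists j.+1.
  apply: filterS (filterI (cP j) gt) => n [/= e jn]; split => //.
  by have [<-] := cdP n.
have cv1 : point_of (cd n).1 @[n --> U] --> point_of c.
  by apply: ptws_cvg => i; apply: filterS (agree (pickle i)) => n [e _]; rewrite /= /point_of e.
have cv2 : point_of (cd n).2 @[n --> U] --> point_of c.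
  by apply: ptws_cvg => i; apply: filterS (agree (pickle i)) => n [_ e]; rewrite /= /point_of e.
have f1 : f (point_of (cd n).1) @[n --> U] --> f (point_of c) := cvg_comp _ _ cv1 (cf _).
have f2 : f (point_of (cd n).2) @[n --> U] --> f (point_of c) := cvg_comp _ _ cv2 (cf _).
have e2 : 0 < eta / 2 by rewrite divr_gt0.
have /cvgrPdist_lt/(_ _ e2) g1 := f1.
have /cvgrPdist_lt/(_ _ e2) g2 := f2.
have [n [/= h1 h2]] := filter_ex (filterI g1 g2).
have [_] := cdP n; apply/negP; rewrite -leNgt.
have -> : f (point_of (cd n).1) - f (point_of (cd n).2) =
    (f (point_of c) - f (point_of (cd n).2)) - (f (point_of c) - f (point_of (cd n).1)).
  by ring.
apply: le_trans (ler_normB _ _) _; lra.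
Qed.


Section word_measure.
Variables (a0 : A) (mass : seq A -> R).
Hypothesis mass_ge0 : forall y, 0 <= mass y.
Hypothesis mass_nil : mass [::] = 1.
Hypothesis mass_cons : forall y, mass y = \sum_a mass (a :: y).

Definition random_point (r : measurableTypeR R) : borel_shift_space L :=
  point_of (digit a0 mass r).

Lemma random_point_measurable : measurable_fun setT random_point.
Proof.
apply: (@measurability _ _ (measurableTypeR R) (borel_shift_space L) setT random_point
  (@open (shift_space L)) erefl).
move=> _ [V oV <-]; rewrite setTI.
pose E (y : seq A) : set (measurableTypeR R) :=
  if `[< forall d, rword d (size y) = y -> V (point_of d) >]
  then [set r | rword (digit a0 mass r) (size y) = y] else set0.
have -> : random_point @^-1` V = \bigcup_y E y.
  apply/seteqP; split => [r Vr|r [y _]].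
    have [n nP] := open_prefix oV Vr.
    exists (rword (digit a0 mass r) n) => //; rewrite /E size_rword.
    case: asboolP => //= -[] d /rword_eq h.
    by apply: nP => j jn; rewrite h.
  by rewrite /E; case: asboolP => // h /h.
apply: countable_bigcupT_measurable => [|y]; first exact: countableP.
by rewrite /E; case: ifP => _; [exact: measurable_digit_word|exact: measurable0].
Qed.

HB.instance Definition _ :=
  isMeasurableFun.Build _ _ _ _ random_point random_point_measurable.

Definition point_law : probability (borel_shift_space L) R :=
  distribution (@leb01 R) random_point.

Let tail_point (y : seq A) := point_of (nth a0 (rev y)).

Lemma rword_mkseq (c : nat -> A) n : rword c n = rev (mkseq c n).
Proof. by elim: n => //= n ->; rewrite mkseqS rev_rcons. Qed.

Lemma rword_nth n (c : nat -> A) j : (j < n)%N -> c j = nth a0 (rev (rword c n)) j.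
Proof. by move=> jn; rewrite rword_mkseq revK nth_mkseq. Qed.

Lemma sum_words n (g : seq A -> R) (x : seq A) : size x = n ->
  \sum_(y : n.-tuple A) g y * (x == y :> seq A)%:R = g x.
Proof.
move=> xn; have xn' : size x == n by apply/eqP.
rewrite (bigD1 (Tuple xn')) //= eqxx mulr1 big1 ?addr0 // => y yx.
case: eqP => [e|_]; last by rewrite mulr0.
by case/negP: yx; apply/eqP/val_inj.
Qed.

Variables (f : shift_space L -> R) (n : nat) (eta : R).
Hypothesis fn : forall c d, (forall j, (j < n)%N -> c j = d j) ->
  `|f (point_of c) - f (point_of d)| <= eta.

Lemma near_words c :
  `|f (point_of c) - \sum_(y : n.-tuple A) f (tail_point y) * (rword c n == y :> seq A)%:R| <= eta.
Proof.
rewrite (@sum_words n (fun y => f (tail_point y))) ?size_rword //.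
by apply: fn => j jn; exact: rword_nth.
Qed.

Lemma av_near_words (cs : nat -> nat -> A) N : (0 < N)%N ->
  `|av (fun t => f (point_of (cs t))) N -
    \sum_(y : n.-tuple A) f (tail_point y) * av (fun t => (rword (cs t) n == y :> seq A)%:R) N|
  <= eta.
Proof.
move=> N0; have eta0 : 0 <= eta by apply: le_trans (near_words (cs 0)).
have -> : \sum_(y : n.-tuple A) f (tail_point y) *
      av (fun t => (rword (cs t) n == y :> seq A)%:R) N =
    av (fun t => \sum_(y : n.-tuple A) f (tail_point y) * (rword (cs t) n == y :> seq A)%:R) N.
  by rewrite av_sum; apply: eq_bigr => y _; rewrite avZ.
rewrite -avN -avD; apply: av_norm_le => // t _; exact: near_words.
Qed.

Hypothesis cf : continuous f.

Lemma integrable_random_point :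
  (@leb01 R).-integrable setT (EFin \o (fun r => f (random_point r))).
Proof.
apply: measurable_bounded_integrable => //.
- have h : (@leb01 R setT < +oo)%E by rewrite probability_setT ltry.
  exact: h.
- apply: (@measurableT_comp _ _ _ _ _ _ (f : borel_shift_space L -> R)).
    exact: continuous_borel_measurable.
  exact: random_point_measurable.
pose B := eta + \sum_(y : n.-tuple A) `|f (tail_point y)|.
exists B; split; first exact: num_real.
move=> B' BB' r _; apply: ltW; apply: le_lt_trans BB'.
have := near_words (digit a0 mass r); rewrite -/(random_point r).
rewrite (@sum_words n (fun y => f (tail_point y))) ?size_rword // => h.
have st : size (rword (digit a0 mass r) n) == n by rewrite size_rword.
have h2 : `|f (tail_point (rword (digit a0 mass r) n))| <=
    \sum_(y : n.-tuple A) `|f (tail_point y)|.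
  by rewrite (bigD1 (Tuple st)) //= lerDl sumr_ge0.
rewrite -(subrK (f (tail_point (rword (digit a0 mass r) n))) (f (random_point r))).
by apply: le_trans (ler_normD _ _) _; exact: lerD.
Qed.

(** The function f of the random point is within eta of a step function of
    its first n letters, whose law is mass. *)
Lemma integral_near_words :
  exists2 I : R, (\int[point_law]_x (f x)%:E = I%:E)%E &
   `|I - \sum_(y : n.-tuple A) f (tail_point y) * mass y| <= eta.
Proof.
pose h r := \sum_(y : n.-tuple A) f (tail_point y) *
   \1_[set r | rword (digit a0 mass r) (size y) = y] r.
have int1 (y : n.-tuple A) : (@leb01 R).-integrable setT
    (fun r => (\1_[set r | rword (digit a0 mass r) (size y) = y] r)%:E).
  by apply: integrable_indic; exact: measurable_digit_word.
have hE : EFin \o h = (fun r => \sum_(y : n.-tuple A) (f (tail_point y))%:E *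
   (\1_[set r | rword (digit a0 mass r) (size y) = y] r)%:E)%E.
  by apply/funext => r; rewrite /h /= -sumEFin; apply: eq_bigr => y _; rewrite EFinM.
have inth : (@leb01 R).-integrable setT (EFin \o h).
  by rewrite hE; apply: integrable_sum => // y _; exact: integrableZl.
have Ih : (\int[@leb01 R]_r (h r) = \sum_(y : n.-tuple A) f (tail_point y) * mass y)%R.
  rewrite /Rintegral (_ : (fun x => (h x)%:E) = EFin \o h) // hE integral_sum //.
    rewrite (eq_bigr (fun y : n.-tuple A => (f (tail_point y) * mass y)%:E)) ?sumEFin //.
    move=> y _; rewrite integralZl // integral_indic //; last exact: measurable_digit_word.
    rewrite setIT EFinM; congr (_ * _)%E.
    have hy := leb01_digit_word a0 mass_ge0 mass_nil mass_cons y; exact: hy.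
  by move=> y; exact: integrableZl.
have intf := integrable_random_point.
exists (\int[@leb01 R]_r f (random_point r))%R.
  rewrite /Rintegral fineK; last exact: integrable_fin_num.
  rewrite /point_law /distribution integral_pushforward //=.
  by apply/measurable_EFinP; exact: continuous_borel_measurable.
have intd : (@leb01 R).-integrable setT (EFin \o (fun r => f (random_point r) - h r)).
  exact: (eq_integrable _ _ _ _ (integrableB measurableT intf inth)).
rewrite -Ih -RintegralB //.
apply: le_trans (le_normr_Rintegral _ _) _ => //.
have -> : eta = \int[@leb01 R]_(r in setT) eta.
  have e1 : @leb01 R setT = 1%E := probability_setT (@leb01 R).
  rewrite Rintegral_cst // -[LHS]mulr1; congr (_ * _).
  exact: (esym (congr1 fine e1)).
apply: le_Rintegral => //.
- exact: integrable_norm intd.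
- by apply: finite_measure_integrable_cst.
move=> r _; have := near_words (digit a0 mass r); rewrite -/(random_point r).
congr (_ <= _); congr (`|_ - _|); apply: eq_bigr => y _; congr (_ * _).
rewrite indicE; congr (nat_of_bool _)%:R; apply/idP/idP => [/eqP e|/set_mem].
  by apply: mem_set; rewrite /= size_tuple.
by rewrite /= size_tuple => ->.
Qed.

End word_measure.

(** An ultrafilter on Q gives frequencies to all words; they are consistent,
    so point_law realizes them, and lengths N_ k in Q are picked along which
    every word frequency converges to its mass. A continuous function is
    uniformly close to functions of finitely many letters, so its averages
    converge as well. *)
Lemma furstenberg_subsequence (z : shift_space L) (code : int -> A) (Q : set nat) :
  (forall i, z i = w (code i)) -> (forall m, exists2 N, (m <= N)%N & Q N) ->
  exists N_, defines_furstenberg z N_ /\ forall k, Q (N_ k).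
Proof.
move=> zw Qoo; pose a0 := code 0.
have PF : ProperFilter (within Q \oo).
  apply: Build_ProperFilter_ex => B [n _ h].
  by have [N nN QN] := Qoo n; exists N; exact: h N nN QN.
have [U [UU Uoo]] := ultraFilterLemma PF.
have FU : Filter U := @filter_filter _ _ (@ultra_proper _ _ UU).
have N_oo m : \forall k \near U, (m <= k)%N by apply: Uoo; exists m.
have UQ : \forall k \near U, Q k by apply: Uoo; exists 0%N.
pose P := ultra_density R UU N_oo.
pose cs (t j : nat) : A := code (odflt 0 (unpickle j) + t%:Z).
have csE t : point_of (cs t) = iter t (@left_shift R L) z.
  by apply/funext => i; rewrite iter_left_shift zw /point_of /cs pickleK.
pose mass (y : seq A) := P (fun t => rword (cs t) (size y) == y).
have mass_ge0 y : 0 <= mass y by exact: Pr_ge0.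
have mass_nil : mass [::] = 1 by rewrite -(Pr_T P); apply: Pr_ext.
have mass_cons y : mass y = \sum_a mass (a :: y).
  rewrite /mass (Pr_partition _ (fun t => cs t (size y))); apply: eq_bigr => a _.
  by apply: Pr_ext => t; rewrite /= eqseq_cons andbC.
have step k N0 : exists N, [/\ (N0 < N)%N, Q N & forall (n : 'I_k.+1) (y : n.-tuple A),
    `|av (fun t => (rword (cs t) n == y :> seq A)%:R) N - mass y| <= k.+1%:R^-1].
  have near1 : \forall N \near U, forall (n : 'I_k.+1) (y : n.-tuple A),
      `|av (fun t => (rword (cs t) n == y :> seq A)%:R) N - mass y| <= k.+1%:R^-1.
    apply: filter_forall => n; apply: filter_forall => y.
    have /cvgrPdist_le/(_ k.+1%:R^-1) := @ultra_Pr_cvg R id U UU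
      (fun t => rword (cs t) (size y) == y).
    rewrite invr_gt0 ltr0n => /(_ isT); rewrite /mass size_tuple.
    by apply: filterS => N; rewrite distrC.
  have [N [[N0N QN] h]] := filter_ex (filterI (filterI (N_oo N0.+1) UQ) near1).
  by exists N; split.
have /choice [g gP] : forall kN : nat * nat, exists N, [/\ (kN.2 < N)%N, Q N &
   forall (n : 'I_kN.1.+1) (y : n.-tuple A),
    `|av (fun t => (rword (cs t) n == y :> seq A)%:R) N - mass y| <= kN.1.+1%:R^-1].
  by move=> [k N0]; exact: step.
pose N_ := fix N_ k := if k is k'.+1 then g (k, N_ k') else g (0, 0)%N.
have N_P k : [/\ (0 < N_ k)%N, Q (N_ k) & forall (n : nat) (y : n.-tuple A), (n <= k)%N ->
    `|av (fun t => (rword (cs t) n == y :> seq A)%:R) (N_ k) - mass y| <= k.+1%:R^-1].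
  have [N0 [N0g ->]] : exists N0, (0 <= N0)%N /\ N_ k = g (k, N0).
    by case: k => [|k]; [exists 0%N|exists (N_ k)].
  have [/= h1 h2 h3] := gP (k, N0); split => //; first exact: leq_trans h1.
  by move=> n y nk; exact: (h3 (Ordinal (nk : (n < k.+1)%N)) y).
exists N_; split; last by move=> k; have [] := N_P k.
split.
- apply: homo_ltn => [? ? ?|k]; first exact: ltn_trans.
  by have [] := gP (k.+1, N_ k).
- by move=> k; have [] := N_P k.
exists (point_law a0 mass_ge0 mass_cons) => f cf.
rewrite (_ : (fun k => _) = fun k => (av (fun n => f (iter n (@left_shift R L) z)) (N_ k))%:E); last first.
  by apply/funext => k; rewrite integral_empirical //; exact: continuous_borel_measurable.
have [n0 hn0] := uniform_prefix cf (ltr01 : 0 < 1 :> R).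
have [I IE _] := integral_near_words a0 mass_ge0 mass_nil mass_cons hn0 cf.
rewrite IE; apply: cvg_EFin; first by apply: nearW.
apply/cvgrPdist_le => e e0; have e4 : 0 < e / 4 by rewrite divr_gt0.
have [n hn] := uniform_prefix cf e4.
have [I' IE'] := integral_near_words a0 mass_ge0 mass_nil mass_cons hn cf.
have -> : I' = I by move: IE'; rewrite IE => -[].
set S := \sum_(y : n.-tuple A) _ => hI.
pose G := \sum_(y : n.-tuple A) `|f (point_of (nth a0 (rev y)))|.
have G0 : 0 <= G by apply: sumr_ge0.
exists (maxn n (Num.trunc (4 * G / e)).+1) => // k /= kn.
have [Nk _ hk] := N_P k.
have h1 := av_near_words a0 hn cs Nk.
set S' := \sum_(y : n.-tuple A) _ in h1.
have h2 : `|S' - S| <= e / 4.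
  rewrite -sumrB; apply: le_trans (ler_norm_sum _ _ _) _.
  apply: (@le_trans _ _ (\sum_(y : n.-tuple A) `|f (point_of (nth a0 (rev y)))| * k.+1%:R^-1)).
    apply: ler_sum => y _; rewrite -mulrBr normrM ler_wpM2l //.
    by apply: hk; rewrite (leq_trans _ kn) // leq_maxl.
  rewrite -mulr_suml -/G ler_pdivrMr ?ltr0n //.
  have : 4 * G / e < k.+1%:R.
    apply: lt_le_trans (truncnS_gt _) _; rewrite ler_nat.
    by apply: leq_trans (leq_trans (leq_maxr _ _) kn) _.
  by rewrite ltr_pdivrMr // => /ltW; lra.
have e1 : av (fun n => f (iter n (@left_shift R L) z)) (N_ k) =
    av (fun t => f (point_of (cs t))) (N_ k).
  by congr av; apply/funext => t; rewrite csE.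
rewrite e1 -[X in `|X|](_ : (I - S) + (S - S') + (S' - av (fun t => f (point_of (cs t))) (N_ k)) = _);
  last by ring.
apply: le_trans (ler_normD _ _) _.
have := ler_normD (I - S) (S - S'); rewrite distrC in h1; rewrite distrC in h2; lra.
Qed.

End furstenberg_subsequence.

(** * Zero entropy: few names shadow every orbit *)

Section zero_entropy_names.
Variables (R : realType) (X : metricType R) (T : X -> X) (phi : X -> R).
Hypothesis cX : compact [set: X].
Hypothesis cphi : continuous phi.

Lemma compact_ultra_limit (U : set_system nat) (x : nat -> X) : UltraFilter U ->
  exists p : X, x n @[n --> U] --> p.
Proof.
move=> UU; have [] := @cX (fmap x U) _ _; first by rewrite /fmap /=; apply: filterS filterT.
move=> p [_ cp]; exists p => V Vp.
rewrite /fmap /=; have [//|UV] := in_ultra_setVsetC (x @^-1` V) UU.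
by have [y [nVy /nVy]] := cp (~` V) V UV Vp.
Qed.

Lemma compact_uniformly_continuous (rho : R) : 0 < rho ->
  exists2 e, 0 < e & forall x y, mdist x y < e -> `|phi x - phi y| <= rho.
Proof.
move=> rho0; apply: contrapT => /forall2NP h.
have /choice [xy xyP] : forall n : nat, exists xy : X * X,
    mdist xy.1 xy.2 < n.+1%:R^-1 /\ rho < `|phi xy.1 - phi xy.2|.
  move=> n; have [|] := h n.+1%:R^-1; first by case; rewrite invr_gt0.
  move=> /existsNP[x /existsNP[y /not_implyP[h1 h2]]].
  by exists (x, y); split => //; rewrite ltNge; apply/negP.
have [U [UU Uoo]] := ultraFilterLemma (eventually_filter : ProperFilter \oo).
have FU : Filter U := @filter_filter _ _ (@ultra_proper _ _ UU).
have [p xp] := compact_ultra_limit (fun n => (xy n).1) UU.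
have yp : (xy n).2 @[n --> U] --> p.
  rewrite -[p]/p => V; rewrite -metricType_numDomainType.filter_from_mdist_nbhs => -[e /= e0 eV].
  have e2 : 0 < e / 2 by rewrite divr_gt0.
  have nb : nbhs p [set q | mdist p q < e / 2].
    by rewrite -metricType_numDomainType.filter_from_mdist_nbhs; exists (e / 2).
  have h1 : U ((fun n => (xy n).1) @^-1` [set q | mdist p q < e / 2]) := xp _ nb.
  have h2 : U [set n | (Num.trunc (2 / e) < n)%N] by apply: Uoo; exists (Num.trunc (2 / e)).+1.
  suff hU : U ((fun n => (xy n).2) @^-1` V) by exact: hU.
  apply: filterS (filterI h1 h2) => n [/= a1 a2]; apply: eV => /=.
  have [d1 _] := xyP n.
  apply: le_lt_trans (metric_triangle _ (xy n).1 _) _.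
  have : n.+1%:R^-1 <= e / 2.
    rewrite invf_ple ?posrE // invf_div; apply/ltW/(lt_le_trans (truncnS_gt _)).
    by rewrite ler_nat; exact: ltnW.
  by move=> i2; rewrite [ltRHS]splitr; apply: ltrD => //; apply: lt_le_trans d1 _; exact: i2.
have f1 : phi (xy n).1 @[n --> U] --> phi p := cvg_comp _ _ xp (@cphi p).
have f2 : phi (xy n).2 @[n --> U] --> phi p := cvg_comp _ _ yp (@cphi p).
have r2 : 0 < rho / 2 by rewrite divr_gt0.
have /cvgrPdist_lt/(_ _ r2) g1 := f1.
have /cvgrPdist_lt/(_ _ r2) g2 := f2.
have [n [/= h1 h2]] := filter_ex (filterI g1 g2).
have [_] := xyP n; apply/negP; rewrite -leNgt.
have -> : phi (xy n).1 - phi (xy n).2 = (phi p - phi (xy n).2) - (phi p - phi (xy n).1).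
  by ring.
apply: le_trans (ler_normB _ _) _; lra.
Qed.

Lemma compact_fun_bounded : exists2 B, 0 <= B & forall x, `|phi x| <= B.
Proof.
have : compact (phi @` setT) by apply: continuous_compact => //; exact: continuous_subspaceT.
move=> /compact_bounded[B [_ hB]]; exists (`|B| + 1); first by rewrite addr_ge0.
by move=> x; apply: (hB (`|B| + 1)); [rewrite ltr_pwDr // ler_norm|exists x].
Qed.

Hypothesis T0 : topological_entropy T = 0%E.

(** The names are the elements of a spanning set of size at most exp (delta
    n), at a scale e from the uniform continuity of phi. *)
Lemma zero_entropy_names (rho delta : R) (n0 : nat) (x0 : X) : 0 < rho -> 0 < delta ->
  exists n (F : finType) (name : X -> F) (rep : F -> X),
   [/\ (n0 <= n)%N, ln #|F|%:R <= delta * n%:R &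
    forall y s, (s < n)%N -> `|phi (iter s T y) - phi (iter s T (rep (name y)))| <= rho].
Proof.
move=> rho0 d0; have [e e0 unif] := compact_uniformly_continuous rho0.
have d2 : 0 < delta / 2 by rewrite divr_gt0.
have lim0 : (limn_esup (fun n => n%:R^-1%:E * lne (span_card T n e)) < (delta / 2)%:E)%E.
  apply: (@le_lt_trans _ _ 0%E); last by rewrite lte_fin.
  by rewrite -T0; apply: ereal_sup_ubound; exists e.
have [_ [V [N _ NV] <-] supV] := ereal_inf_lt lim0.
pose n := (maxn N n0).+1.
have nR : 0 < n%:R :> R by rewrite ltr0n.
have hn : (n%:R^-1%:E * lne (span_card T n e) < (delta / 2)%:E)%E.
  apply: le_lt_trans supV; apply: ereal_sup_ubound; exists n => //.
  by apply: NV; rewrite /= /n leqW // leq_maxl.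
have : (span_card T n e < (expR (delta * n%:R))%:E)%E.
  rewrite ltNge; apply/negP => h.
  have : ((delta * n%:R)%:E <= lne (span_card T n e))%E.
    have <- : lne (expR (delta * n%:R))%:E = (delta * n%:R)%:E.
      by rewrite lne_EFin ?expR_gt0 // expRK.
    rewrite lee_lne // in_itv /= leey ?andbT ?lee_fin ?expR_ge0 //.
    by apply: le_trans h; rewrite lee_fin expR_ge0.
  move=> h2; have : (n%:R^-1%:E * (delta * n%:R)%:E < (delta / 2)%:E)%E.
    by apply: le_lt_trans hn; apply: lee_wpmul2l => //; rewrite lee_fin invr_ge0.
  rewrite -EFinM lte_fin mulrC mulfK ?gt_eqF // => ?; lra.
move=> /ereal_inf_lt[_ [F sF <-]]; rewrite lte_fin => cF.
pose s := finmap.enum_fset F.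
have s0 : (0 < size s)%N.
  have [y yF _] := sF x0.
  have : y \in s by exact: yF.
  by case: s.
have Es : size s = (size s).-1.+1 by rewrite prednK.
have /choice [g gP] : forall y, exists y', y' \in s /\
    forall i, (i < n)%N -> mdist (iter i T y) (iter i T y') < e.
  by move=> y; have [y' y'F h] := sF y; exists y'.
exists n, 'I_(size s).-1.+1, (fun y => inord (index (g y) s)), (fun i : 'I_(size s).-1.+1 => nth x0 s i).
split.
- by rewrite /n leqW // leq_maxr.
- rewrite card_ord -Es -ler_expR lnK ?posrE ?ltr0n //; exact: ltW cF.
move=> y i lin; have [gs hg] := gP y.
by apply: unif; rewrite inordK ?nth_index -?Es ?index_mem //; exact: hg.
Qed.

End zero_entropy_names.

(** * Averages along zero-entropy orbits *)

Section decorrelated_averages.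
Variables (R : realType) (N_ : nat -> nat) (U : set_system nat).
Hypothesis UU : UltraFilter U.
Hypothesis N_oo : forall m, \forall k \near U, (m <= N_ k)%N.
Let FU : Filter U := @filter_filter _ _ (@ultra_proper _ _ UU).
Let P := ultra_density R UU N_oo.
Variables (A : finType) (al : nat -> A) (v : A -> R).
Hypothesis future_small : forall eps : R, 0 < eps -> exists M : nat,
  forall l (D : pred (l.-tuple A)), (0 < l)%N ->
    `|Ex P (fun t => (al t, blk al l (t + M))) (fun w => v w.1 * (D w.2)%:R)| <= eps.
Variables (X : metricType R) (T : X -> X) (phi : X -> R).
Hypothesis cX : compact [set: X].
Hypothesis cphi : continuous phi.
Hypothesis T0 : topological_entropy T = 0%E.

(** The average is compared with its n shifts. In the shift by s, the
    segment of length n of the orbit that starts at time t is replaced by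
    the one of the representative of its name, which makes phi a function
    psi s of the name p t; then low_entropy_decorrelates applies. *)
Lemma decorrelated_averages (x : X) (beta : R) : 0 < beta ->
  \forall k \near U, `|av (fun t => v (al t) * phi (iter t T x)) (N_ k)| <= beta.
Proof.
move=> b0; have [B0 B0_ge phiB0] := compact_fun_bounded cX cphi.
pose B : R := B0 + 1; have B_gt0 : 0 < B by rewrite ltr_wpDl.
have phiB y : `|phi y| <= B by apply: le_trans (phiB0 y) _; rewrite lerDl.
pose L : R := \sum_a `|v a| + 1.
have L_gt0 : 0 < L by rewrite ltr_wpDl ?sumr_ge0.
have vL a : `|v a| <= L by rewrite /L (bigD1 a) //= -addrA lerDl addr_ge0 // sumr_ge0.
pose K : R := L * B; have K_gt0 : 0 < K by rewrite mulr_gt0.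
(* The order of choice matters: tau and the error allowed for the future,
   then the gap M, then delta small compared with tau / M, then n. *)
pose tau := beta / (8 * K); have tau_gt0 : 0 < tau by rewrite divr_gt0 ?mulr_gt0.
have eps_gt0 : 0 < beta / (16 * B) by rewrite divr_gt0 ?mulr_gt0.
have [M hM] := future_small eps_gt0.
pose delta := tau * beta / (8 * K * M.+1%:R).
have delta_gt0 : 0 < delta.
  by apply: divr_gt0; do ?apply: mulr_gt0 => //; rewrite ltr0n.
have rho_gt0 : 0 < beta / (8 * L) by rewrite divr_gt0 ?mulr_gt0.
pose n0 := (Num.trunc (8 * M%:R * K / beta)).+1.
have [n [F [name [rep [n0n cF shadow]]]]] :=
  zero_entropy_names cX cphi T0 n0 x rho_gt0 delta_gt0.
pose p t := name (iter t T x); pose psi s a := phi (iter s T (rep a)).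
have n_gt0 : 0 < n%:R :> R by rewrite ltr0n (leq_trans _ n0n).
pose E s := Ex P (fun t => (al (t + s)%N, p t)) (fun w => v w.1 * psi s w.2).
have sumE : \sum_(s < n) `|E s| <= n%:R * (beta / 2).
  have psiB s a : `|psi s a| <= B by exact: phiB.
  have h0 := low_entropy_decorrelates n p vL psiB (ltW B_gt0) hM tau_gt0.
  apply: (le_trans h0).
  rewrite -/K.
  have h1 : K * (M%:R * ln #|F|%:R / tau) <= n%:R * (beta / 8).
    apply: (@le_trans _ _ (K * (M.+1%:R * (delta * n%:R) / tau))).
      rewrite ler_wpM2l ?(ltW K_gt0) // ler_wpM2r ?invr_ge0 ?(ltW tau_gt0) //.
      apply: (@le_trans _ _ (M%:R * (delta * n%:R))); first by rewrite ler_wpM2l.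
      by rewrite ler_wpM2r ?ler_nat // mulr_ge0 ?(ltW delta_gt0) ?(ltW n_gt0).
    rewrite le_eqVlt; apply/orP; left; apply/eqP.
    rewrite /delta; field; rewrite !gt_eqF ?ltr0n //.
  have h2 : K * (n%:R * tau) = n%:R * (beta / 8).
    by rewrite /tau; field; rewrite gt_eqF.
  have h3 : n%:R * (2 * B * (beta / (16 * B))) = n%:R * (beta / 8).
    by field; rewrite gt_eqF.
  have h4 : M%:R * K <= n%:R * (beta / 8).
    have : 8 * M%:R * K / beta < n%:R.
      by apply: lt_le_trans (truncnS_gt _) _; rewrite ler_nat.
    by rewrite ltr_pdivrMr // => /ltW; lra.
  rewrite mulrDr; lra.
have nearE : \forall k \near U, forall s : 'I_n,
    `|av (fun t => v (al (t + s)%N) * psi s (p t)) (N_ k)| <= `|E s| + beta / 16.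
  apply: filter_forall => s.
  have := @ultra_Ex_cvg R N_ U UU N_oo _ (fun t => (al (t + s)%N, p t)) (fun w => v w.1 * psi s w.2).
  move=> /cvgrPdist_le/(_ (beta / 16)); rewrite divr_gt0 // => /(_ isT).
  apply: filterS => k /= h.
  have := ler_normB (E s) (E s - av (fun t => v (al (t + s)%N) * psi s (p t)) (N_ k)).
  by rewrite opprB addrC subrK; move: h; rewrite -/P -/(E s); lra.
have nearN : \forall k \near U, 2 * K * n%:R / (N_ k)%:R <= beta / 16.
  have := N_oo (Num.trunc (32 * K * n%:R / beta)).+1; apply: filterS => k kN.
  have Nk : 0 < (N_ k)%:R :> R by rewrite ltr0n (leq_trans _ kN).
  rewrite ler_pdivrMr //.
  have : 32 * K * n%:R / beta < (N_ k)%:R.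
    by apply: lt_le_trans (truncnS_gt _) _; rewrite ler_nat.
  by rewrite ltr_pdivrMr // => /ltW; lra.
apply: filterS (filterI (filterI nearE nearN) (N_oo 1)) => k [[hE hN] Nk].
set a := av _ _.
have each (s : 'I_n) : `|a| <= `|E s| + beta / 4.
  have FB t : `|v (al t) * phi (iter t T x)| <= K.
    by rewrite normrM ler_pM.
  have sh := @av_shift R (fun t => v (al t) * phi (iter t T x)) K s (N_ k) Nk (ltW K_gt0) (fun t _ => FB t).
  have sh2 : 2 * K * s%:R / (N_ k)%:R <= beta / 16.
    apply: le_trans hN; rewrite ler_wpM2r ?invr_ge0 //.
    apply: ler_wpM2l; first by apply: mulr_ge0 => //; exact: ltW.
    by rewrite ler_nat ltnW.
  have ap : `|av (fun t => v (al (t + s)%N) * phi (iter (t + s) T x)) (N_ k) -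
      av (fun t => v (al (t + s)%N) * psi s (p t)) (N_ k)| <= beta / 8.
    rewrite -avN -avD; apply: av_norm_le => [|t _]; first by rewrite divr_ge0 // ltW.
    rewrite -mulrBr normrM addnC iterD.
    have -> : beta / 8 = L * (beta / (8 * L)) by field; rewrite gt_eqF.
    by apply: ler_pM => //; exact: shadow.
  have h := hE s; rewrite -/a in sh.
  set a1 := av _ _ in sh ap; set a2 := av _ _ in ap h.
  have -> : a = a2 + (a1 - a2) - (a1 - a) by ring.
  apply: le_trans (ler_normB _ _) _; have := ler_normD a2 (a1 - a2).
  lra.
have : \sum_(s < n) `|a| <= \sum_(s < n) (`|E s| + beta / 4) by apply: ler_sum => s _.
rewrite big_split /= !sumr_const card_ord -(mulr_natl `|a|) -(mulr_natl (beta / 4)) => h.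
have nb := mulr_ge0 (ltW n_gt0) (ltW b0).
have : n%:R * `|a| <= n%:R * beta by lra.
by rewrite ler_pM2l.
Qed.

End decorrelated_averages.

(** * The two implications *)

Section coordinates.
Variable R : realType.

(** Correlations with the complex values of u are handled through their real
    and imaginary parts, up to sign. *)
Definition coordinate_like (pr : R[i] -> R) : Prop :=
  [/\ forall a N, pr (mean a N) = av (fun n => pr (a n)) N,
      forall x (b : bool), pr (x * b%:R) = pr x * b%:R &
      forall x, `|pr x| <= cmod x].

Lemma Re_coordinate : coordinate_like (@complex.Re R).
Proof.
split; [exact: Re_mean|case=> x y []|exact: Re_le_cmod] => /=.
  by rewrite !mulr1 mulr0 subr0.
by rewrite !mulr0 subr0.
Qed.

Lemma Im_coordinate : coordinate_like (@complex.Im R).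
Proof.
split; [exact: Im_mean|case=> x y []|exact: Im_le_cmod] => /=.
  by rewrite !mulr1 mulr0 add0r.
by rewrite !mulr0 addr0.
Qed.

Lemma oppr_coordinate pr : coordinate_like pr -> coordinate_like (fun x => - pr x).
Proof.
move=> [p1 p2 p3]; split=> [a N|x b|x].
- by rewrite p1 avN.
- by rewrite p2 mulNr.
- by rewrite normrN.
Qed.

End coordinates.

Section equivalence.
Variables (R : realType) (u : nat -> R[i]) (s : seq R[i]) (q : nat).
Hypothesis s_uniq : uniq s.
Hypothesis size_s : size s = q.+1.
Hypothesis us : forall n, (0 < n)%N -> u n \in s.
Variables (L : {nonneg R}) (z : shift_space L).
Hypothesis z_u : extends u z.

Let letter := letter u s q.
Let value := @value R s q.
Let letterK n : (0 < n)%N -> value (letter n) = u n := value_letter size_s us (n := n).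

Lemma block_value l j : (0 < j)%N -> block u l j = map_tuple value (blk letter l j).
Proof.
move=> j0; apply: eq_from_tnth => i; rewrite [RHS]tnth_map /block /blk !tnth_mktuple letterK //.
by rewrite ltn_addr.
Qed.

Definition decorrelates_from_future : Prop :=
  forall N_ : nat -> nat, defines_furstenberg z N_ ->
  forall eps : R, 0 < eps ->
  exists2 M : nat, (1 <= M)%N &
    forall l : nat, (1 <= l)%N ->
    forall C : set (l.-tuple R[i]), C `<=` blocks u l ->
    forall m : nat, (M <= m)%N ->
    exists2 a : R,
      cmod (mean (fun n => u n * \1_C (block u l (m + n))) (N_ k))
        @[k --> \oo] --> a
      & a <= eps.

Section orthogonal_future.
Hypothesis orth : orthogonal_ZE u.
Variables (N_ : nat -> nat) (U : set_system nat).
Hypothesis UU : UltraFilter U.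
Hypothesis N_oo : forall m, \forall k \near U, (m <= N_ k)%N.
Let FU : Filter U := @filter_filter _ _ (@ultra_proper _ _ UU).
Let P := ultra_density R UU N_oo.

(** Otherwise correlated_sequence yields a sequence y correlated with u
    infinitely often, while y is an observable along an orbit of a subshift
    of zero entropy. *)
Lemma orthogonal_future_small (pr : R[i] -> R) (eps : R) : coordinate_like pr -> 0 < eps ->
  exists M : nat, forall m c, (M <= m)%N -> future letter m c ->
    corr P letter (fun a => pr (value a)) c <= eps.
Proof.
move=> [pr_mean pr_bool pr_le] eps0; apply: contrapT => /forallNP h.
pose v a := pr (value a).
have vL a : `|v a| <= \sum_b `|v b| by rewrite (bigD1 a) //= lerDl sumr_ge0.
have big m : exists2 c, future letter m c & eps <= corr P letter v c.
  have /existsNP[m' /existsNP[c /not_implyP[mm /not_implyP[fc nc]]]] := h m.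
  by exists c; [exact: future_le fc|apply/ltW; rewrite ltNge; apply/negP].
have [y [few large]] := correlated_sequence vL eps0 big.
have := orth (@subshift_compact R (ext_int y)) (@Tsub_homeo R (ext_int y))
  (subshift_entropy0 few) (base_point R (ext_int y)) (@observable_continuous R (ext_int y)).
move=> /cvgCP/cvgrPdist_lt/(_ (eps / 16)); rewrite divr_gt0 // => /(_ isT) [K _ hK].
have [k [kK]] := large K; apply/negP; rewrite -ltNge.
have := hK _ kK; rewrite /= subr0 sub0r normrN ger0_norm ?cmod_ge0 //.
apply: le_lt_trans; apply: le_trans (pr_le _); rewrite pr_mean.
apply: le_trans (ler_norm _); rewrite le_eqVlt; apply/orP; left; apply/eqP.
apply: eq_av => t t0; rewrite /v letterK // -pr_bool mulrC; congr (pr (_ * _)).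
by rewrite /observable iter_Tsub add0r.
Qed.

End orthogonal_future.

(** The limits exist by furstenberg_block_cvg. Their smallness is seen along
    an ultrafilter, from the one-sided bounds for the real part, the
    imaginary part and their opposites. *)
Lemma orthogonal_decorrelates : orthogonal_ZE u -> decorrelates_from_future.
Proof.
move=> orth N_ fN eps eps0; have [homoN _ _] := fN.
have Nk k : (k <= N_ k)%N.
  by elim: k => // k IH; apply: leq_ltn_trans IH _; exact: homoN.
have [U [UU Uoo]] := ultraFilterLemma (eventually_filter : ProperFilter \oo).
have FU : Filter U := @filter_filter _ _ (@ultra_proper _ _ UU).
have N_oo m : \forall k \near U, (m <= N_ k)%N.
  by apply: Uoo; exists m => // k /= mk; exact: leq_trans mk (Nk k).
have e2 : 0 < eps / 2 by rewrite divr_gt0.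
have [M1 h1] := orthogonal_future_small orth UU N_oo (Re_coordinate R) e2.
have [M2 h2] := orthogonal_future_small orth UU N_oo (oppr_coordinate (Re_coordinate R)) e2.
have [M3 h3] := orthogonal_future_small orth UU N_oo (Im_coordinate R) e2.
have [M4 h4] := orthogonal_future_small orth UU N_oo (oppr_coordinate (Im_coordinate R)) e2.
exists (M1 + M2 + M3 + M4).+1 => // l l0 C CB m mM.
pose D (x : l.-tuple 'I_q.+1) := map_tuple value x \in C.
pose c t := D (blk letter l (t + m)).
have fc : future letter m c by exists l, D.
have m0 : (0 < m)%N by apply: leq_trans mM.
have cE t : (block u l (m + t) \in C) = c t.
  by rewrite block_value ?addn_gt0 ?m0 // addnC.
have lim pr : coordinate_like pr -> corr (ultra_density R UU N_oo) letter (fun a => pr (value a)) c <= eps / 2 ->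
    corr (ultra_density R UU N_oo) letter (fun a => - pr (value a)) c <= eps / 2 ->
    exists2 a : R, pr (mean (fun n => u n * \1_C (block u l (m + n))) (N_ k)) @[k --> \oo] --> a &
      `|a| <= eps / 2.
  move=> [pr_mean pr_bool pr_le] le1 le2.
  pose G a x := pr (value a) * (D x)%:R.
  have GE k : pr (mean (fun n => u n * \1_C (block u l (m + n))) (N_ k)) =
      av (fun n => G (letter n) (blk letter l (n + m))) (N_ k).
    rewrite pr_mean; apply: eq_av => t t0.
    by rewrite indicE cE pr_bool /G letterK.
  have /cvg_ex[a ha] := @furstenberg_block_cvg R u s q s_uniq size_s us L z z_u N_ l m G fN.
  exists a; first by under eq_fun do rewrite GE.
  have hU : av (fun n => G (letter n) (blk letter l (n + m))) (N_ k) @[k --> U] --> a.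
    by move=> V /ha hV; apply: Uoo; exact: hV.
  have hE := @ultra_Ex_cvg R N_ U UU N_oo _ (fun t => (letter t, c t))
    (fun w => pr (value w.1) * w.2%:R).
  have aE : a = corr (ultra_density R UU N_oo) letter (fun a => pr (value a)) c.
    by apply: (cvg_unique _ hU hE).
  rewrite aE ler_norml le1 andbT lerNl; apply: le_trans le2.
  rewrite /corr /Ex -sumrN; apply: ler_sum => w _.
  by rewrite !mulNr.
have [||a ha a_le] := lim _ (Re_coordinate R).
- by apply: h1 fc; lia.
- by apply: h2 fc; lia.
have [||b hb b_le] := lim _ (Im_coordinate R).
- by apply: h3 fc; lia.
- by apply: h4 fc; lia.
exists (cmod (a +i* b)%C); last first.
  by apply: le_trans (cmod_le_abs _) _ => /=; lra.
have cmodE (w : R[i]) : cmod w = Num.sqrt (complex.Re w ^+ 2 + complex.Im w ^+ 2).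
  by case: w.
under eq_fun do rewrite cmodE.
pose S k := complex.Re (mean (fun n => u n * \1_C (block u l (m + n))) (N_ k)) ^+ 2 +
  complex.Im (mean (fun n => u n * \1_C (block u l (m + n))) (N_ k)) ^+ 2.
have hab : S k @[k --> \oo] --> a ^+ 2 + b ^+ 2.
  rewrite (expr2 a) (expr2 b); apply: cvgD.
    exact: (cvgM ha ha).
  exact: (cvgM hb hb).
exact: (cvg_comp S Num.sqrt hab (@sqrt_continuous R _)).
Qed.

(** The value z 0 need not be a value of u, hence the additional letter
    None. *)
Lemma coded_extension : exists (code : int -> option 'I_q.+1) (w : option 'I_q.+1 -> disc_type L),
  forall i, z i = w (code i).
Proof.
exists (fun i => if i == 0 then None else Some (letter (absz i))).
exists (fun a => if a is Some a then xget (z 0) [set y : disc_type L | \val y = value a] else z 0).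
move=> i; case: eqP => [-> //|/eqP i0].
have ai : (0 < absz i)%N by rewrite absz_gt0.
have zi : \val (z i) = value (letter (absz i)).
  rewrite letterK //; have [h1 h2] := z_u ai.
  by case: (intP i) ai h1 h2.
case: xgetP => [y _ /= yE|/(_ (z i))]; last by case.
by apply: val_inj; rewrite /= zi yE.
Qed.

Section zero_entropy_system.
Hypothesis decorr : decorrelates_from_future.
Variables (X : metricType R) (T : X -> X) (x : X).
Hypothesis cX : compact [set: X].
Hypothesis T0 : topological_entropy T = 0%E.

(** If the averages stayed away from 0 along infinitely many lengths, some
    of these lengths would define a Furstenberg system, along which the
    hypothesis makes them small. *)
Lemma coordinate_averages (pr : R[i] -> R) (phi : X -> R) : coordinate_like pr -> continuous phi ->
  av (fun n => pr (u n) * phi (iter n T x)) N @[N --> \oo] --> (0 : R).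
Proof.
move=> [pr_mean pr_bool pr_le] cphi; apply/cvgrPdist_le => e e0.
apply: contrapT => nh.
pose Q := [set N | e < `|av (fun n => pr (u n) * phi (iter n T x)) N|].
have Qoo m : exists2 N, (m <= N)%N & Q N.
  apply: contrapT => /forall2NP hm; apply: nh; exists m => // N /= mN.
  rewrite sub0r normrN leNgt; apply/negP => hN.
  by case: (hm N).
have [code [w zw]] := coded_extension.
have [N_ [fN QN]] := furstenberg_subsequence zw Qoo.
have [homoN _ _] := fN.
have Nk k : (k <= N_ k)%N.
  by elim: k => // k IH; apply: leq_ltn_trans IH _; exact: homoN.
have [U [UU Uoo]] := ultraFilterLemma (eventually_filter : ProperFilter \oo).
have FU : Filter U := @filter_filter _ _ (@ultra_proper _ _ UU).
have N_oo m : \forall k \near U, (m <= N_ k)%N.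
  by apply: Uoo; exists m => // k /= mk; exact: leq_trans mk (Nk k).
have small (eps : R) : 0 < eps -> exists M : nat,
    forall l (D : pred (l.-tuple 'I_q.+1)), (0 < l)%N ->
    `|Ex (ultra_density R UU N_oo) (fun t => (letter t, blk letter l (t + M)))
       (fun w => pr (value w.1) * (D w.2)%:R)| <= eps.
  move=> eps0; have [M M1 hM] := decorr fN eps0; exists M => l D l0.
  pose C := [set block u l j | j in [set j | (0 < j)%N /\ D (blk letter l j)]].
  have CB : C `<=` blocks u l by move=> _ [j [j0 _] <-]; exists j.
  have [a ha a_le] := hM l l0 C CB M (leqnn M).
  have CE t : (block u l (M + t) \in C) = D (blk letter l (t + M)).
    apply/idP/idP => [/set_mem[j [j0 Dj]]|Dt]; last first.
      by apply: mem_set; exists (M + t)%N => //; split; rewrite ?addn_gt0 ?M1 // addnC.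
    rewrite !block_value ?addn_gt0 ?M1 // => /(congr1 val) /= /inj_map jE.
    rewrite addnC -(_ : blk letter l j = blk letter l (M + t)) //.
    by apply: val_inj; apply: jE; exact: value_inj.
  have hE := @ultra_Ex_cvg R N_ U UU N_oo _ (fun t => (letter t, blk letter l (t + M)))
    (fun w => pr (value w.1) * (D w.2)%:R).
  apply: le_trans a_le.
  have hU : cmod (mean (fun n => u n * \1_C (block u l (M + n))) (N_ k)) @[k --> U] --> a.
    by move=> V /ha hV; apply: Uoo; exact: hV.
  apply: (ler_cvg_to (cvg_norm hE) hU); apply: filterE => k.
  apply: le_trans (pr_le _); rewrite pr_mean le_eqVlt; apply/orP; left; apply/eqP.
  by congr (`|_|); apply: eq_av => t t0; rewrite indicE CE pr_bool letterK.
have := @decorrelated_averages R N_ U UU N_oo _ letter (fun a => pr (value a)) small X T phi cX cphi T0 x e e0.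
move=> /filter_ex[k]; apply/negP; rewrite -ltNge.
rewrite (_ : av _ _ = av (fun n => pr (u n) * phi (iter n T x)) (N_ k)); first exact: QN.
by apply: eq_av => t t0; rewrite letterK.
Qed.

Lemma decorrelated_mean (f : X -> R[i]) : continuous f ->
  mean (fun n => f (iter n T x) * u n) N @[N --> \oo] --> (0 : R[i]).
Proof.
move=> cf; apply/cvgCP.
have cRe : continuous (fun y => complex.Re (f y)).
  by move=> y; apply: cvg_comp (cf y) (@Re_continuous R _).
have cIm : continuous (fun y => complex.Im (f y)).
  by move=> y; apply: cvg_comp (cf y) (@Im_continuous R _).
have h1 := coordinate_averages (Re_coordinate R) cRe.
have h2 := coordinate_averages (Im_coordinate R) cIm.
have h3 := coordinate_averages (Im_coordinate R) cRe.
have h4 := coordinate_averages (Re_coordinate R) cIm.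
have norm0 (F : nat -> R) : F N @[N --> \oo] --> (0 : R) -> `|F N| @[N --> \oo] --> (0 : R).
  by move=> h; rewrite -(normr0 R); exact: cvg_norm.
have add0 (F G : nat -> R) : F N @[N --> \oo] --> (0 : R) -> G N @[N --> \oo] --> (0 : R) ->
    F N + G N @[N --> \oo] --> (0 : R).
  by move=> hF hG; rewrite -[X in _ --> X]addr0; exact: cvgD.
have sub0 (F G : nat -> R) : F N @[N --> \oo] --> (0 : R) -> G N @[N --> \oo] --> (0 : R) ->
    F N - G N @[N --> \oo] --> (0 : R).
  by move=> hF hG; rewrite -[X in _ --> X]subr0; exact: cvgB.
have hs := add0 _ _ (norm0 _ (sub0 _ _ h1 h2)) (norm0 _ (add0 _ _ h3 h4)).
apply: (squeeze_cvgr _ (cvg_cst 0) hs); apply: nearW => N.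
rewrite subr0 cmod_ge0 /=; apply: le_trans (cmod_le_abs _) _.
rewrite Re_mean Im_mean /= -avN -!avD le_eqVlt; apply/orP; left; apply/eqP.
congr (_ + _); congr (`|_|); apply: eq_av => t _.
  by case: (f _) (u t) => ? ? [? ?] /=; ring.
by case: (f _) (u t) => ? ? [? ?] /=; ring.
Qed.

End zero_entropy_system.

End equivalence.

Lemma finite_range_enum (R : realType) (u : nat -> R[i]) :
  finite_set [set u n | n in [set n | (0 < n)%N]] ->
  exists s q, [/\ uniq s, size s = q.+1 & forall n, (0 < n)%N -> u n \in s].
Proof.
move=> /finite_seqP[s sE].
have us n : (0 < n)%N -> u n \in undup s.
  by move=> n0; rewrite mem_undup; have : [set` s] (u n) by rewrite -sE; exists n.
exists (undup s), (size (undup s)).-1; split => //; first exact: undup_uniq.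
by have := us 1%N isT; case: (undup s).
Qed.

Theorem corollary3 (R : realType) (u : nat -> R[i])
    (u_fin : finite_set [set u n | n in [set n | (0 < n)%N]])
    (L : {nonneg R}) (z : shift_space L) (z_u : extends u z) :
  orthogonal_ZE u <->
  forall N_ : nat -> nat, defines_furstenberg z N_ ->
  forall eps : R, 0 < eps ->
  exists2 M : nat, (1 <= M)%N &
    forall l : nat, (1 <= l)%N ->
    forall C : set (l.-tuple R[i]), C `<=` blocks u l ->
    forall m : nat, (M <= m)%N ->
    exists2 a : R,
      cmod (mean (fun n => u n * \1_C (block u l (m + n))) (N_ k))
        @[k --> \oo] --> a
      & a <= eps.
Proof.
have [s [q [s_uniq size_s us]]] := finite_range_enum u_fin; split.
  by move=> orth; exact: (orthogonal_decorrelates s_uniq size_s us z_u orth).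
move=> decorr X T cX _ T0 f x cf.
exact: (decorrelated_mean s_uniq size_s us z_u decorr).
Qed.
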